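(* Let $\mathcal{H}\in C^\omega(\mathbb{S}^2)$ and let $\beta,B:I\to\mathbb{R}^3$ be a pair of Björling data defined on an open real interval $I$. Then there exist an open domain $\Omega\subset\mathbb{C}$ containing $I\times\{0\}$ and a conformal immersion $\psi:\Omega\to\mathbb{R}^3$, $z=s+it$, that solves the system $$\psi_{z\overline{z}}=-i\,\mathcal{H}(\eta)\,\psi_z\wedge\psi_{\overline{z}},\qquad \psi(s,0)=\beta(s),\qquad \psi_t(s,0)=B(s)\quad (s\in I),$$ where $\eta=\frac{2}{i\lambda^2}\psi_z\wedge\psi_{\overline{z}}$ is the unit normal of $\psi$ and $\lambda^2=\langle\psi_s,\psi_s\rangle=\langle\psi_t,\psi_t\rangle$ is the conformal factor. As a consequence, $\psi$ defines an $\mathcal{H}$-surface $\Sigma$ that contains the curve $\beta(s)$, and the tangent plane $T_{\beta(s)}\Sigma$ at each point $\beta(s)$ is spanned by $\beta'(s)$ and $B(s)$.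
   Context: $C^\omega(\mathbb{S}^2)$ denotes the real-analytic functions on the unit sphere $\mathbb{S}^2\subset\mathbb{R}^3$. A pair of Björling data on an open interval $I\subset\mathbb{R}$ is a regular real-analytic curve $\beta:I\to\mathbb{R}^3$ together with a real-analytic vector field $B:I\to\mathbb{R}^3$ along $\beta$ such that $|\beta'(s)|=|B(s)|$ and $\langle\beta'(s),B(s)\rangle=0$ for all $s\in I$. Given $\mathcal{H}\in C^1(\mathbb{S}^2)$, an oriented immersed surface $\Sigma$ in $\mathbb{R}^3$ with Gauss map $\eta:\Sigma\to\mathbb{S}^2$ is an $\mathcal{H}$-surface if its mean curvature (computed with respect to $\eta$) satisfies $H_\Sigma(p)=\mathcal{H}(\eta_p)$ for all $p\in\Sigma$. Wirtinger operators: $\partial_z=\frac12(\partial_s-i\partial_t)$, $\partial_{\overline z}=\frac12(\partial_s+i\partial_t)$; $\wedge$ is the cross product extended complex-bilinearly. *)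

(* Defs.v *)
From Stdlib Require Import Reals.
From Coquelicot Require Import Coquelicot.
Open Scope R_scope.

Definition V3 := (R * R * R)%type.
Definition vx (v : V3) : R := fst (fst v).
Definition vy (v : V3) : R := snd (fst v).
Definition vz (v : V3) : R := snd v.
Definition mkV (a b c : R) : V3 := (a, b, c).
Definition vadd (u v : V3) : V3 := mkV (vx u + vx v) (vy u + vy v) (vz u + vz v).
Definition vscal (a : R) (v : V3) : V3 := mkV (a * vx v) (a * vy v) (a * vz v).
Definition vdot (u v : V3) : R := vx u * vx v + vy u * vy v + vz u * vz v.
Definition vnorm (v : V3) : R := sqrt (vdot v v).
Definition vcross (u v : V3) : V3 :=
  mkV (vy u * vz v - vz u * vy v) (vz u * vx v - vx u * vz v) (vx u * vy v - vy u * vx v).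

Definition CV3 := (C * C * C)%type.
Definition cx (v : CV3) : C := fst (fst v).
Definition cy (v : CV3) : C := snd (fst v).
Definition cz (v : CV3) : C := snd v.
Definition mkCV (a b c : C) : CV3 := (a, b, c).
Definition cvadd (u v : CV3) : CV3 := mkCV (Cplus (cx u) (cx v)) (Cplus (cy u) (cy v)) (Cplus (cz u) (cz v)).
Definition cvscal (a : C) (v : CV3) : CV3 := mkCV (Cmult a (cx v)) (Cmult a (cy v)) (Cmult a (cz v)).
Definition cvcross (u v : CV3) : CV3 :=
  mkCV (Cminus (Cmult (cy u) (cz v)) (Cmult (cz u) (cy v)))
       (Cminus (Cmult (cz u) (cx v)) (Cmult (cx u) (cz v)))
       (Cminus (Cmult (cx u) (cy v)) (Cmult (cy u) (cx v))).
Definition V3toCV3 (v : V3) : CV3 := mkCV (RtoC (vx v)) (RtoC (vy v)) (RtoC (vz v)).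
Definition cvRe (v : CV3) : V3 := mkV (Re (cx v)) (Re (cy v)) (Re (cz v)).
Definition cvIm (v : CV3) : V3 := mkV (Im (cx v)) (Im (cy v)) (Im (cz v)).

Definition on_sphere (p : V3) : Prop := vdot p p = 1.

Definition analytic_on (I : R -> Prop) (f : R -> R) : Prop :=
  forall s0, I s0 -> exists (a : nat -> R) (r : R), 0 < r /\
    forall s, Rabs (s - s0) < r -> is_pseries a (s - s0) (f s).

Definition analytic_curve_on (I : R -> Prop) (c : R -> V3) : Prop :=
  analytic_on I (fun s => vx (c s)) /\ analytic_on I (fun s => vy (c s)) /\
  analytic_on I (fun s => vz (c s)).

Definition psum3 (a : nat -> nat -> nat -> R) (p x : V3) (N : nat) : R :=
  sum_f_R0 (fun i => sum_f_R0 (fun j => sum_f_R0 (fun k =>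
     a i j k * (vx x - vx p) ^ i * (vy x - vy p) ^ j * (vz x - vz p) ^ k) N) N) N.
Definition psum3_abs (a : nat -> nat -> nat -> R) (p x : V3) (N : nat) : R :=
  sum_f_R0 (fun i => sum_f_R0 (fun j => sum_f_R0 (fun k =>
     Rabs (a i j k) * Rabs (vx x - vx p) ^ i * Rabs (vy x - vy p) ^ j
       * Rabs (vz x - vz p) ^ k) N) N) N.
Definition in_polydisc (p : V3) (r : R) (x : V3) : Prop :=
  Rabs (vx x - vx p) < r /\ Rabs (vy x - vy p) < r /\ Rabs (vz x - vz p) < r.

(* H in C^omega(S^2): near every point of S^2, H is the restriction to S^2 of
   a power series in 3 variables converging absolutely on a polydisc. *)
Definition analytic_on_sphere (H : V3 -> R) : Prop :=
  forall p, on_sphere p ->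
    exists (a : nat -> nat -> nat -> R) (r : R), 0 < r /\
      (forall x, in_polydisc p r x -> exists M, forall N, psum3_abs a p x N <= M) /\
      (forall x, in_polydisc p r x -> on_sphere x -> is_lim_seq (psum3 a p x) (H x)).

Definition vderiv (c : R -> V3) (s : R) : V3 :=
  mkV (Derive (fun u => vx (c u)) s) (Derive (fun u => vy (c u)) s) (Derive (fun u => vz (c u)) s).

Definition bjorling_data (I : R -> Prop) (beta B : R -> V3) : Prop :=
  analytic_curve_on I beta /\ analytic_curve_on I B /\
  (forall s, I s -> vderiv beta s <> mkV 0 0 0) /\
  (forall s, I s -> vnorm (vderiv beta s) = vnorm (B s)) /\
  (forall s, I s -> vdot (vderiv beta s) (B s) = 0).

Definition rbar_open_interval (a b : Rbar) (s : R) : Prop := Rbar_lt a s /\ Rbar_lt s b.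

Definition ds (f : R -> R -> R) (s t : R) : R := Derive (fun u => f u t) s.
Definition dt (f : R -> R -> R) (s t : R) : R := Derive (fun u => f s u) t.

Definition ps (psi : R -> R -> V3) (s t : R) : V3 :=
  mkV (ds (fun a b => vx (psi a b)) s t) (ds (fun a b => vy (psi a b)) s t) (ds (fun a b => vz (psi a b)) s t).
Definition pt (psi : R -> R -> V3) (s t : R) : V3 :=
  mkV (dt (fun a b => vx (psi a b)) s t) (dt (fun a b => vy (psi a b)) s t) (dt (fun a b => vz (psi a b)) s t).

Definition cds (f : R -> R -> C) (s t : R) : C :=
  (ds (fun a b => Re (f a b)) s t, ds (fun a b => Im (f a b)) s t).
Definition cdt (f : R -> R -> C) (s t : R) : C :=
  (dt (fun a b => Re (f a b)) s t, dt (fun a b => Im (f a b)) s t).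
Definition cps (Phi : R -> R -> CV3) (s t : R) : CV3 :=
  mkCV (cds (fun a b => cx (Phi a b)) s t) (cds (fun a b => cy (Phi a b)) s t) (cds (fun a b => cz (Phi a b)) s t).
Definition cpt (Phi : R -> R -> CV3) (s t : R) : CV3 :=
  mkCV (cdt (fun a b => cx (Phi a b)) s t) (cdt (fun a b => cy (Phi a b)) s t) (cdt (fun a b => cz (Phi a b)) s t).

Definition dz (Phi : R -> R -> CV3) (s t : R) : CV3 :=
  cvscal (RtoC (/2)) (cvadd (cps Phi s t) (cvscal (Copp Ci) (cpt Phi s t))).
Definition dzb (Phi : R -> R -> CV3) (s t : R) : CV3 :=
  cvscal (RtoC (/2)) (cvadd (cps Phi s t) (cvscal Ci (cpt Phi s t))).

Definition cpsi (psi : R -> R -> V3) : R -> R -> CV3 := fun a b => V3toCV3 (psi a b).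
Definition psi_z (psi : R -> R -> V3) := dz (cpsi psi).
Definition psi_zb (psi : R -> R -> V3) := dzb (cpsi psi).
Definition psi_zzb (psi : R -> R -> V3) := dz (dzb (cpsi psi)).

Definition lambda2 (psi : R -> R -> V3) (s t : R) : R := vdot (ps psi s t) (ps psi s t).
Definition eta_c (psi : R -> R -> V3) (s t : R) : CV3 :=
  cvscal (Cdiv (RtoC 2) (Cmult Ci (RtoC (lambda2 psi s t))))
         (cvcross (psi_z psi s t) (psi_zb psi s t)).

Definition C2_on (Om : R * R -> Prop) (f : R -> R -> R) : Prop :=
  forall s t, Om (s, t) ->
    ex_derive (fun u => f u t) s /\ ex_derive (fun u => f s u) t /\
    ex_derive (fun u => ds f u t) s /\ ex_derive (fun u => ds f s u) t /\
    ex_derive (fun u => dt f u t) s /\ ex_derive (fun u => dt f s u) t /\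
    continuous (fun p : R * R => f (fst p) (snd p)) (s, t) /\
    continuous (fun p : R * R => ds f (fst p) (snd p)) (s, t) /\
    continuous (fun p : R * R => dt f (fst p) (snd p)) (s, t) /\
    continuous (fun p : R * R => ds (ds f) (fst p) (snd p)) (s, t) /\
    continuous (fun p : R * R => dt (ds f) (fst p) (snd p)) (s, t) /\
    continuous (fun p : R * R => ds (dt f) (fst p) (snd p)) (s, t) /\
    continuous (fun p : R * R => dt (dt f) (fst p) (snd p)) (s, t).

Definition C2_map_on (Om : R * R -> Prop) (psi : R -> R -> V3) : Prop :=
  C2_on Om (fun a b => vx (psi a b)) /\ C2_on Om (fun a b => vy (psi a b)) /\
  C2_on Om (fun a b => vz (psi a b)).

Definition connected_set (Om : R * R -> Prop) : Prop :=
  forall U V : R * R -> Prop, open U -> open V ->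
    (forall p, Om p -> U p \/ V p) ->
    (forall p, Om p -> U p -> V p -> False) ->
    (exists p, Om p /\ U p) -> (exists p, Om p /\ V p) -> False.

Definition is_domain (Om : R * R -> Prop) : Prop := open Om /\ connected_set Om.

Definition conformal_immersion_on (Om : R * R -> Prop) (psi : R -> R -> V3) : Prop :=
  C2_map_on Om psi /\
  forall s t, Om (s, t) ->
    vdot (ps psi s t) (ps psi s t) = vdot (pt psi s t) (pt psi s t) /\
    vdot (ps psi s t) (pt psi s t) = 0 /\
    ps psi s t <> mkV 0 0 0.

Definition mean_curvature (psi : R -> R -> V3) (n : V3) (s t : R) : R :=
  let E := vdot (ps psi s t) (ps psi s t) in
  let F := vdot (ps psi s t) (pt psi s t) in
  let G := vdot (pt psi s t) (pt psi s t) in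
  let L := vdot (ps (ps psi) s t) n in
  let M := vdot (pt (ps psi) s t) n in
  let N := vdot (pt (pt psi) s t) n in
  (E * N - 2 * F * M + G * L) / (2 * (E * G - F * F)).

(* Main.v *)
(* With p = psi_s and q = psi_t the system reads p_t = q_s, q_t = -p_s + 2 H(n) p x q, where
   n = (p x q) / |p|^2 and, near a given s0, H is replaced by the power series that extends it around the
   initial normal. The weights w(n, m) = A^n r^(n+m) n! m! / (n+m)! make the formal power series in (t, s)
   with finite weighted l^1 norm a Banach algebra on which the integral in t of the derivative in s has
   norm at most A. Since the nonlinearity involves no derivatives of p and q, for small r and then small A
   the Picard iterates stay in a small ball; their coefficients are eventually stationary, which gives a
   convergent solution. Conformality holds because |p|^2 - |q|^2 and 2 <p, q> satisfy the Cauchy-Riemann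
   equations and vanish on t = 0; hence n lies on the sphere, where the extension of H is H itself.
   Local solutions around different points of I have the same coefficients in powers of t, so they glue
   on the union of the boxes on which they converge. *)
Require Import Defs.
From Stdlib Require Import Reals Lra Lia Psatz FunctionalExtensionality ClassicalEpsilon Classical.
From Coquelicot Require Import Coquelicot.
Open Scope R_scope.

(** * Formal power series *)

(** Two obstacles shape the argument. First, in a norm with geometric weights a derivative in s
    costs radius, so iterating it would exhaust the box. Integration in t after derivation in s
    carries the coefficient at (n, m+1) to (n+1, m) with the factor (m+1)/(n+1); the binomials in
    the weights are there to cancel exactly this factor. Integration also raises the order in t by
    one, which is why the iterates become stationary: an invariant ball is enough and no contraction
    estimate is made. Second, H has a meaning only on the sphere, whereas the normals of the
    iterates leave it. Conformality is therefore proved for an arbitrary series h in place of H(n),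
    because h p x q is orthogonal to p and q. For the same reason uniqueness compares values along t
    instead of substituted series: extensions of H at different points may have different
    coefficients, while a Lipschitz bound for H on the sphere does not see them. *)

Section SeriesRing.
Context {K : Type} (k0 k1 : K) (kadd kmul ksub : K -> K -> K) (kopp : K -> K).
Context (Kring : ring_theory k0 k1 kadd kmul ksub kopp (@eq K)).
Add Ring Kring_inst : Kring.
Notation "x +! y" := (kadd x y) (at level 50, left associativity).
Notation "x *! y" := (kmul x y) (at level 40, left associativity).

Definition shift (f : nat -> K) : nat -> K := fun n => f (S n).

(** The Cauchy product, with the leading coefficient of [f] peeled off. This recursion allows proofs
    of the ring laws by induction without index sums, and the abstract ring allows the construction
    to be applied twice: series in t whose coefficients are series in s. *)
Fixpoint conv (f g : nat -> K) (n : nat) : K :=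
  match n with
  | O => f O *! g O
  | S n' => f O *! g (S n') +! conv (shift f) g n'
  end.

Definition ser0 : nat -> K := fun _ => k0.
Definition ser1 : nat -> K := fun n => match n with O => k1 | _ => k0 end.
Definition seradd (f g : nat -> K) : nat -> K := fun n => f n +! g n.
Definition sersub (f g : nat -> K) : nat -> K := fun n => ksub (f n) (g n).
Definition seropp (f : nat -> K) : nat -> K := fun n => kopp (f n).

Lemma conv_add_l f f' g n : conv (seradd f f') g n = conv f g n +! conv f' g n.
Proof.
  revert f f'; induction n as [|n IH]; intros f f'; simpl; unfold seradd.
  - ring.
  - change (shift (fun n0 => f n0 +! f' n0)) with (seradd (shift f) (shift f')).
    rewrite IH; ring.
Qed.

Lemma conv_scal_l c f g n : conv (fun i => c *! f i) g n = c *! conv f g n.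
Proof.
  revert f; induction n as [|n IH]; intros f; simpl.
  - ring.
  - change (shift (fun i => c *! f i)) with (fun i => c *! shift f i).
    rewrite IH; ring.
Qed.

Lemma conv_0_l g n : conv ser0 g n = k0.
Proof.
  induction n as [|n IH]; simpl; unfold ser0 at 1.
  - ring.
  - change (shift ser0) with ser0; rewrite IH; ring.
Qed.

Lemma conv_1_l g n : conv ser1 g n = g n.
Proof.
  destruct n as [|n]; simpl.
  - ring.
  - change (shift ser1) with ser0; rewrite conv_0_l; ring.
Qed.

(** The same product with the leading coefficient of [g] peeled off; played against the recursion on
    the left it yields commutativity. *)
Lemma conv_S_r f g n : conv f g (S n) = conv f (shift g) n +! f (S n) *! g O.
Proof.
  revert f; induction n as [|n IH]; intros f.
  - reflexivity.
  - change (conv f g (S (S n))) with (f O *! g (S (S n)) +! conv (shift f) g (S n)).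
    rewrite IH; simpl conv; unfold shift; ring.
Qed.

Lemma conv_comm f g n : conv f g n = conv g f n.
Proof.
  revert f g; induction n as [|n IH]; intros f g.
  - simpl; ring.
  - rewrite conv_S_r; simpl; rewrite (IH f (shift g)); ring.
Qed.

Lemma conv_assoc f g h n : conv f (conv g h) n = conv (conv f g) h n.
Proof.
  revert f; induction n as [|n IH]; intros f.
  - simpl; ring.
  - simpl.
    change (shift (conv f g)) with (seradd (fun i => f O *! shift g i) (conv (shift f) g)).
    rewrite conv_add_l, conv_scal_l, <- IH; ring.
Qed.

Lemma series_ring : ring_theory ser0 ser1 seradd conv sersub seropp (@eq (nat -> K)).
Proof.
  constructor; intros; apply functional_extensionality; intros n;
    unfold seradd, sersub, seropp.
  - unfold ser0; ring.
  - ring.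
  - ring.
  - apply conv_1_l.
  - apply conv_comm.
  - apply conv_assoc.
  - apply conv_add_l.
  - ring.
  - unfold ser0; ring.
Qed.

Fixpoint natK (n : nat) : K := match n with O => k0 | S n' => natK n' +! k1 end.

Definition euler (f : nat -> K) : nat -> K := fun n => natK n *! f n.
Definition serD (f : nat -> K) : nat -> K := fun n => natK (S n) *! f (S n).

(** [euler] is x d/dx. It preserves degrees, so the Leibniz rule goes through by induction; [euler]
    and [shift] commute up to one extra [shift f]. *)
Lemma euler_mul f g n : euler (conv f g) n = conv (euler f) g n +! conv f (euler g) n.
Proof.
  revert f; induction n as [|n IH]; intros f.
  - unfold euler; simpl; ring.
  - unfold euler at 1; simpl.
    replace (shift (euler f)) with (seradd (euler (shift f)) (shift f)).
    2:{ apply functional_extensionality; intros i.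
        unfold seradd, euler, shift; simpl; ring. }
    rewrite conv_add_l.
    specialize (IH (shift f)). unfold euler at 1 in IH.
    assert (E : conv (euler (shift f)) g n =
                natK n *! conv (shift f) g n +! kopp (conv (shift f) (euler g) n))
      by (rewrite IH; ring).
    rewrite E; unfold euler; simpl natK. ring.
Qed.

(** This is the rule for [euler] in degree n + 1: [euler f 0] and [euler g 0] vanish, which leaves
    two products of degree n. *)
Lemma serD_mul f g n : serD (conv f g) n = conv (serD f) g n +! conv f (serD g) n.
Proof.
  change (euler (conv f g) (S n) = conv (serD f) g n +! conv f (serD g) n).
  rewrite euler_mul, (conv_S_r f); simpl conv.
  change (shift (euler f)) with (serD f); change (shift (euler g)) with (serD g).
  unfold euler; simpl natK; ring.
Qed.

(** A derivation of the coefficient ring extends coefficientwise to the series ring. With series in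
    s as coefficients this becomes the product rule for [Ds]. *)
Lemma conv_derivation (d : K -> K)
  (dadd : forall x y, d (x +! y) = d x +! d y)
  (dmul : forall x y, d (x *! y) = d x *! y +! x *! d y) f g n :
  d (conv f g n) = conv (fun i => d (f i)) g n +! conv f (fun i => d (g i)) n.
Proof.
  revert f; induction n as [|n IH]; intros f; simpl.
  - apply dmul.
  - rewrite dadd, dmul, IH.
    change (shift (fun i => d (f i))) with (fun i => d (shift f i)); ring.
Qed.

End SeriesRing.

Definition fps := nat -> R.
Definition fmul : fps -> fps -> fps := conv Rplus Rmult.
Definition fadd : fps -> fps -> fps := seradd Rplus.

Lemma R_ring : ring_theory 0 1 Rplus Rmult Rminus Ropp (@eq R).
Proof. constructor; intros; ring. Qed.

Definition fps_ring := series_ring _ _ _ _ _ _ R_ring.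

(* [u n m] is the coefficient of [t^n s^m]. *)
Definition fps2 := nat -> nat -> R.
Definition zero2 : fps2 := ser0 (ser0 0).
Definition one2 : fps2 := ser1 (ser0 0) (ser1 0 1).
Definition add2 : fps2 -> fps2 -> fps2 := seradd fadd.
Definition mul2 : fps2 -> fps2 -> fps2 := conv fadd fmul.
Definition sub2 : fps2 -> fps2 -> fps2 := sersub (sersub Rminus).
Definition opp2 : fps2 -> fps2 := seropp (seropp Ropp).

Declare Scope fps_scope.
Delimit Scope fps_scope with S.
Bind Scope fps_scope with fps2.
Infix "+" := add2 : fps_scope.
Infix "*" := mul2 : fps_scope.
Infix "-" := sub2 : fps_scope.
Notation "- u" := (opp2 u) : fps_scope.

Definition fps2_ring : ring_theory zero2 one2 add2 mul2 sub2 opp2 (@eq fps2) :=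
  series_ring _ _ _ _ _ _ fps_ring.
Add Ring fps2_ring_inst : fps2_ring.

Definition const2 (c : R) : fps2 :=
  fun n m => match n, m with O, O => c | _, _ => 0 end.

Lemma const2_1 : const2 1 = one2.
Proof. apply functional_extensionality; intros [|n]; apply functional_extensionality; intros [|m]; reflexivity. Qed.

Lemma fmul_scal c (f : fps) n : fmul (fun m => match m with O => c | _ => 0 end) f n = c * f n.
Proof.
  unfold fmul; destruct n as [|n]; simpl; [ring|].
  change (shift _) with (ser0 0 : fps).
  rewrite (conv_0_l _ _ _ _ _ _ R_ring); ring.
Qed.

Lemma const2_mul c u n m : (const2 c * u)%S n m = c * u n m.
Proof.
  assert (E : forall n, const2 c n = match n with
     O => (fun m => match m with O => c | _ => 0 end) | _ => ser0 0 end).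
  { intros [|k]; apply functional_extensionality; intros [|j]; reflexivity. }
  unfold mul2; destruct n as [|n]; simpl.
  - rewrite E; apply fmul_scal.
  - rewrite E. change (shift (const2 c)) with (zero2).
    unfold zero2. rewrite (conv_0_l _ _ _ _ _ _ fps_ring).
    unfold fadd, seradd, ser0; rewrite fmul_scal; ring.
Qed.

Definition Ds (u : fps2) : fps2 := fun n m => INR (S m) * u n (S m).
Definition Dt (u : fps2) : fps2 := fun n m => INR (S n) * u (S n) m.
Definition It (u : fps2) : fps2 :=
  fun n m => match n with O => 0 | S n' => u n' m / INR (S n') end.

Lemma natK_INR n : natK 0 1 Rplus n = INR n.
Proof. induction n as [|n IH]; [reflexivity|]. rewrite S_INR; simpl; rewrite IH; reflexivity. Qed.

Lemma Ds_mul u v : Ds (u * v)%S = (Ds u * v + u * Ds v)%S.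
Proof.
  assert (E : forall w, Ds w = (fun n => serD 0 1 Rplus Rmult (w n))).
  { intros w; apply functional_extensionality; intros n; apply functional_extensionality; intros m.
    unfold Ds, serD; rewrite natK_INR; reflexivity. }
  rewrite !E; apply functional_extensionality; intros n.
  apply (conv_derivation _ _ _ _ _ _ fps_ring (serD 0 1 Rplus Rmult)).
  - intros x y; apply functional_extensionality; intros i; unfold serD, fadd, seradd; ring.
  - intros x y; apply functional_extensionality; intros i.
    apply (serD_mul _ _ _ _ _ _ R_ring).
Qed.

Lemma natK_fps n (f : fps) : fmul (natK (ser0 0) (ser1 0 1) fadd n) f = (fun m => INR n * f m).
Proof.
  apply functional_extensionality; intros m.
  replace (natK (ser0 0) (ser1 0 1) fadd n) with (fun m : nat => match m with O => INR n | _ => 0 end).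
  - apply fmul_scal.
  - induction n as [|n IH].
    + apply functional_extensionality; intros [|j]; reflexivity.
    + simpl natK; rewrite <- IH; apply functional_extensionality; intros [|j];
        unfold fadd, seradd, ser1; [rewrite S_INR; reflexivity|ring].
Qed.

Lemma Dt_mul u v : Dt (u * v)%S = (Dt u * v + u * Dt v)%S.
Proof.
  assert (E : forall w : fps2, Dt w = serD (ser0 0) (ser1 0 1) fadd fmul w).
  { intros w; apply functional_extensionality; intros n; unfold serD; rewrite natK_fps; reflexivity. }
  rewrite !E; apply functional_extensionality; intros n.
  apply (serD_mul _ _ _ _ _ _ fps_ring).
Qed.

Ltac fps_ext := apply functional_extensionality; intros ?n; apply functional_extensionality; intros ?m.

Lemma Ds_add u v : Ds (u + v)%S = (Ds u + Ds v)%S.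
Proof. fps_ext; unfold Ds, add2, fadd, seradd; ring. Qed.
Lemma Dt_add u v : Dt (u + v)%S = (Dt u + Dt v)%S.
Proof. fps_ext; unfold Dt, add2, fadd, seradd; ring. Qed.
Lemma Ds_sub u v : Ds (u - v)%S = (Ds u - Ds v)%S.
Proof. fps_ext; unfold Ds, sub2, sersub; ring. Qed.
Lemma Dt_sub u v : Dt (u - v)%S = (Dt u - Dt v)%S.
Proof. fps_ext; unfold Dt, sub2, sersub; ring. Qed.
Lemma Ds_Dt u : Ds (Dt u) = Dt (Ds u).
Proof. fps_ext; unfold Ds, Dt; ring. Qed.
Lemma Dt_It u : Dt (It u) = u.
Proof.
  fps_ext; unfold Dt, It; field; apply not_0_INR; lia.
Qed.
Lemma Ds_It u : Ds (It u) = It (Ds u).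
Proof. fps_ext; unfold Ds, It; destruct n; unfold Rdiv; ring. Qed.

(** * Double series *)

Lemma common_lower_bound a b : 0 < a -> 0 < b -> exists d, 0 < d /\ d <= a /\ d <= b.
Proof.
  intros Ha Hb; exists (Rmin a b); split; [apply Rmin_glb_lt; auto|split; [apply Rmin_l|apply Rmin_r]].
Qed.

Lemma sum_nonneg a N : (forall n, 0 <= a n) -> 0 <= sum_f_R0 a N.
Proof. intros Ha; induction N as [|N IH]; simpl; [apply Ha|]. specialize (Ha (S N)); lra. Qed.

Lemma sum_mono_N a N N' : (forall n, 0 <= a n) -> (N <= N')%nat -> sum_f_R0 a N <= sum_f_R0 a N'.
Proof. intros Ha; induction 1 as [|N' _ IH]; simpl; [lra|]. specialize (Ha (S N')); lra. Qed.

Lemma sum_le a b N : (forall n, (n <= N)%nat -> a n <= b n) -> sum_f_R0 a N <= sum_f_R0 b N.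
Proof.
  induction N as [|N IH]; intros Hab; simpl; [apply Hab; lia|].
  apply Rplus_le_compat; [apply IH; intros; apply Hab; lia|apply Hab; lia].
Qed.

Lemma sum_ext a b N : (forall n, (n <= N)%nat -> a n = b n) -> sum_f_R0 a N = sum_f_R0 b N.
Proof. intros Hab; apply Rle_antisym; apply sum_le; intros; rewrite Hab; auto; lra. Qed.

Lemma sum_swap (x : nat -> nat -> R) N M :
  sum_f_R0 (fun n => sum_f_R0 (x n) M) N = sum_f_R0 (fun m => sum_f_R0 (fun n => x n m) N) M.
Proof.
  induction N as [|N IH]; simpl; [apply sum_ext; reflexivity|].
  rewrite IH, <- sum_plus; reflexivity.
Qed.

Lemma sum_scal_l c a N : sum_f_R0 (fun n => c * a n) N = c * sum_f_R0 a N.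
Proof. rewrite scal_sum; apply sum_ext; intros; ring. Qed.

Lemma term_le_sum a N n : (forall n, 0 <= a n) -> (n <= N)%nat -> a n <= sum_f_R0 a N.
Proof.
  intros Ha Hn; apply Rle_trans with (sum_f_R0 a n); [|apply sum_mono_N; auto].
  destruct n; simpl; [lra|]. pose proof (sum_nonneg a n Ha); lra.
Qed.

Lemma is_series_sum (a : nat -> R) l : is_series a l <-> is_lim_seq (sum_f_R0 a) l.
Proof.
  unfold is_series. split; intros H.
  - apply is_lim_seq_ext with (sum_n a); [intros n; apply sum_n_Reals|exact H].
  - change (is_lim_seq (sum_n a) l).
    apply is_lim_seq_ext with (sum_f_R0 a); [intros n; symmetry; apply sum_n_Reals|exact H].
Qed.

Lemma Series_lim a : ex_series a -> is_lim_seq (sum_f_R0 a) (Series a).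
Proof. intros H; apply is_series_sum, Series_correct, H. Qed.

Lemma ex_series_bounded a M :
  (forall n, 0 <= a n) -> (forall N, sum_f_R0 a N <= M) -> ex_series a.
Proof.
  intros Ha HM.
  destruct (ex_finite_lim_seq_incr (sum_f_R0 a) M) as [l Hl].
  - intros n; simpl; specialize (Ha (S n)); lra.
  - exact HM.
  - exists l; apply is_series_sum; exact Hl.
Qed.

Lemma Series_le_bound a M :
  ex_series a -> (forall N, sum_f_R0 a N <= M) -> Series a <= M.
Proof.
  intros Ha HM. apply (is_lim_seq_le (sum_f_R0 a) (fun _ => M) (Series a) M); auto.
  - apply Series_lim; auto.
  - apply is_lim_seq_const.
Qed.

Lemma sum_le_Series a N : (forall n, 0 <= a n) -> ex_series a -> sum_f_R0 a N <= Series a.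
Proof.
  intros Ha Hex.
  apply (is_lim_seq_le_loc (fun _ => sum_f_R0 a N) (sum_f_R0 a) (sum_f_R0 a N) (Series a)).
  - exists N; intros n Hn; apply sum_mono_N; auto.
  - apply is_lim_seq_const.
  - apply Series_lim; auto.
Qed.

Lemma Series_nonneg a : (forall n, 0 <= a n) -> ex_series a -> 0 <= Series a.
Proof. intros Ha Hex; apply Rle_trans with (sum_f_R0 a 0); [apply Ha|apply sum_le_Series; auto]. Qed.

Lemma sum_Series (x : nat -> nat -> R) N : (forall n, ex_series (x n)) ->
  ex_series (fun m => sum_f_R0 (fun n => x n m) N) /\
  Series (fun m => sum_f_R0 (fun n => x n m) N) = sum_f_R0 (fun n => Series (x n)) N.
Proof.
  intros Hx; induction N as [|N [E IH]]; simpl.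
  - split; [apply (Hx O)|reflexivity].
  - split; [apply (ex_series_plus (fun m => sum_f_R0 (fun n => x n m) N) (x (S N)) E (Hx (S N)))|].
    rewrite Series_plus, IH; auto.
Qed.

(** Summability is expressed throughout by a uniform bound on square partial sums. For nonnegative
    terms it controls every rectangle, and norm estimates become inequalities between finite
    sums. *)
Definition box (x : nat -> nat -> R) (N : nat) : R := sum_f_R0 (fun n => sum_f_R0 (x n) N) N.

Lemma rect_le_box x N M K : (forall n m, 0 <= x n m) -> (N <= K)%nat -> (M <= K)%nat ->
  sum_f_R0 (fun n => sum_f_R0 (x n) M) N <= box x K.
Proof.
  intros Hx HN HM; apply Rle_trans with (sum_f_R0 (fun n => sum_f_R0 (x n) M) K).
  - apply sum_mono_N; auto; intros; apply sum_nonneg; auto.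
  - apply sum_le; intros; apply sum_mono_N; auto.
Qed.

Lemma box_tr x N : box (fun n m => x m n) N = box x N.
Proof. unfold box; rewrite sum_swap; reflexivity. Qed.

Lemma double_nonneg x M : (forall n m, 0 <= x n m) -> (forall N, box x N <= M) ->
  (forall n, ex_series (x n)) /\ ex_series (fun n => Series (x n)) /\
  Series (fun n => Series (x n)) <= M.
Proof.
  intros Hx HM.
  assert (E1 : forall n, ex_series (x n)).
  { intros n; apply ex_series_bounded with M; auto; intros N.
    apply Rle_trans with (sum_f_R0 (fun n => sum_f_R0 (x n) N) n).
    - apply (term_le_sum (fun n => sum_f_R0 (x n) N)); auto; intros; apply sum_nonneg; auto.
    - apply Rle_trans with (box x (max n N)); auto; apply rect_le_box; auto; lia. }
  assert (B : forall N, sum_f_R0 (fun n => Series (x n)) N <= M).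
  { intros N; destruct (sum_Series x N E1) as [E2 <-].
    apply Series_le_bound; auto; intros K; rewrite <- sum_swap.
    apply Rle_trans with (box x (max N K)); auto; apply rect_le_box; auto; lia. }
  assert (E2 : ex_series (fun n => Series (x n))).
  { apply ex_series_bounded with M; auto; intros; apply Series_nonneg; auto. }
  repeat split; auto; apply Series_le_bound; auto.
Qed.

(** One half of Tonelli: a finite block of columns commutes with the sum over the rows and is at
    most the full row sums. The other half is the same inequality for the transpose. *)
Lemma double_swap_le x M : (forall n m, 0 <= x n m) -> (forall N, box x N <= M) ->
  Series (fun m => Series (fun n => x n m)) <= Series (fun n => Series (x n)).
Proof.
  intros Hx HM.
  destruct (double_nonneg x M Hx HM) as (E1 & E2 & _).
  destruct (double_nonneg (fun m n => x n m) M) as (E3 & E4 & _); auto.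
  { intros N; rewrite box_tr; auto. }
  apply Series_le_bound; auto; intros N.
  destruct (sum_Series (fun m n => x n m) N E3) as [E5 <-].
  apply Series_le; auto; intros n; split.
  - apply sum_nonneg; auto.
  - apply sum_le_Series; auto.
Qed.

Lemma double_swap_nonneg x M : (forall n m, 0 <= x n m) -> (forall N, box x N <= M) ->
  Series (fun m => Series (fun n => x n m)) = Series (fun n => Series (x n)).
Proof.
  intros Hx HM; apply Rle_antisym.
  - apply double_swap_le with M; auto.
  - apply (double_swap_le (fun m n => x n m)) with M; auto.
    intros N; rewrite box_tr; auto.
Qed.

Definition absbox_le (x : nat -> nat -> R) (M : R) : Prop :=
  forall N, box (fun n m => Rabs (x n m)) N <= M.

Lemma absbox_tr x M : absbox_le x M -> absbox_le (fun n m => x m n) M.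
Proof. intros H N; rewrite (box_tr (fun n m => Rabs (x n m))); apply H. Qed.

Lemma double_abs x M : absbox_le x M ->
  (forall n, ex_series (fun m => Rabs (x n m))) /\ ex_series (fun n => Series (fun m => Rabs (x n m))) /\
  (forall n, ex_series (x n)) /\ ex_series (fun n => Series (x n)) /\
  Rabs (Series (fun n => Series (x n))) <= M.
Proof.
  intros HM.
  destruct (double_nonneg (fun n m => Rabs (x n m)) M) as (E1 & E2 & E3); auto.
  { intros; apply Rabs_pos. }
  assert (E4 : forall n, ex_series (x n)) by (intros; apply ex_series_Rabs; auto).
  assert (E5 : ex_series (fun n => Rabs (Series (x n)))).
  { apply (ex_series_le (fun n => Rabs (Series (x n))) (fun n => Series (fun m => Rabs (x n m)))); auto.
    intros n; unfold norm; simpl; unfold abs; simpl; rewrite Rabs_Rabsolu; apply Series_Rabs; auto. }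
  repeat split; auto.
  - apply ex_series_Rabs; auto.
  - apply Rle_trans with (2 := E3).
    apply Rle_trans with (1 := Series_Rabs _ E5).
    apply Series_le; auto; intros n; split; [apply Rabs_pos|apply Series_Rabs; auto].
Qed.

Lemma double_swap x M : absbox_le x M ->
  Series (fun m => Series (fun n => x n m)) = Series (fun n => Series (x n)).
Proof.
  intros HM.
  destruct (double_abs x M HM) as (E1 & E2 & E3 & E4 & _).
  destruct (double_abs _ M (absbox_tr x M HM)) as (F1 & F2 & F3 & F4 & _).
  cbv beta in F1, F2, F3, F4.
  assert (A := double_swap_nonneg (fun n m => Rabs (x n m)) M (fun n m => Rabs_pos _) HM).
  assert (B : forall n m, 0 <= Rabs (x n m) + x n m).
  { intros n m; generalize (Rle_abs (- x n m)); rewrite Rabs_Ropp; lra. }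
  (* Fubini from Tonelli: |x| and |x| + x are nonnegative, and the identity for the first is
     subtracted from that for the second. *)
  assert (C := double_swap_nonneg (fun n m => Rabs (x n m) + x n m) (M + M) B).
  assert (D : forall N, box (fun n m => Rabs (x n m) + x n m) N <= M + M).
  { intros N; apply Rle_trans with (box (fun n m => Rabs (x n m) + Rabs (x n m)) N).
    - apply sum_le; intros; apply sum_le; intros; apply Rplus_le_compat_l, Rle_abs.
    - unfold box. rewrite (sum_ext _ (fun n => sum_f_R0 (fun m => Rabs (x n m)) N + sum_f_R0 (fun m => Rabs (x n m)) N)).
      + rewrite sum_plus; specialize (HM N); unfold box in HM; lra.
      + intros; apply sum_plus. }
  specialize (C D).
  rewrite (Series_ext _ (fun m => Series (fun n => Rabs (x n m)) + Series (fun n => x n m))) in C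
    by (intros; apply Series_plus; auto).
  rewrite (Series_ext (fun n => Series (fun m => Rabs (x n m) + x n m))
     (fun n => Series (fun m => Rabs (x n m)) + Series (fun m => x n m))) in C
    by (intros; apply Series_plus; auto).
  rewrite !Series_plus in C; auto.
  cbv beta in A; rewrite A in C; apply Rplus_eq_reg_l in C; exact C.
Qed.

(** The weighted l^1 norm as a relation, so that series of infinite norm need no value. *)
Definition nle (w : nat -> nat -> R) (u : fps2) (M : R) : Prop :=
  forall N, box (fun n m => Rabs (u n m) * w n m) N <= M.

Lemma box_le x y N : (forall n m, (n <= N)%nat -> (m <= N)%nat -> x n m <= y n m) -> box x N <= box y N.
Proof. intros H; apply sum_le; intros; apply sum_le; auto. Qed.

Lemma box_plus x y N : box (fun n m => x n m + y n m) N = box x N + box y N.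
Proof.
  unfold box; rewrite <- sum_plus; apply sum_ext; intros; apply sum_plus.
Qed.

Lemma box_scal c x N : box (fun n m => c * x n m) N = c * box x N.
Proof.
  unfold box; rewrite <- sum_scal_l; apply sum_ext; intros; apply sum_scal_l.
Qed.

Lemma box_nonneg x N : (forall n m, 0 <= x n m) -> 0 <= box x N.
Proof. intros; apply sum_nonneg; intros; apply sum_nonneg; auto. Qed.

Section Norm.
Variable w : nat -> nat -> R.
Hypothesis w_nonneg : forall n m, 0 <= w n m.

Lemma nle_ge0 u M : nle w u M -> 0 <= M.
Proof.
  intros H; eapply Rle_trans; [|apply (H O)].
  apply box_nonneg; intros; apply Rmult_le_pos; auto using Rabs_pos.
Qed.

Lemma nle_weaken u M M' : nle w u M -> M <= M' -> nle w u M'.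
Proof. intros H L N; eapply Rle_trans; eauto. Qed.

Lemma nle_add u v M M' : nle w u M -> nle w v M' -> nle w (u + v)%S (M + M').
Proof.
  intros Hu Hv N.
  eapply Rle_trans; [|apply Rplus_le_compat; [apply (Hu N)|apply (Hv N)]].
  rewrite <- box_plus; apply box_le; intros n m _ _.
  rewrite <- Rmult_plus_distr_r; apply Rmult_le_compat_r; auto; apply Rabs_triang.
Qed.

Lemma nle_opp u M : nle w u M -> nle w (- u)%S M.
Proof.
  intros Hu N; eapply Rle_trans; [|apply (Hu N)]; apply box_le; intros n m _ _.
  unfold opp2, seropp; rewrite Rabs_Ropp; lra.
Qed.

Lemma nle_sub u v M M' : nle w u M -> nle w v M' -> nle w (u - v)%S (M + M').
Proof.
  intros Hu Hv; replace (u - v)%S with (u + - v)%S by ring.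
  apply nle_add, nle_opp; auto.
Qed.

Lemma nle_const c : w O O = 1 -> nle w (const2 c) (Rabs c).
Proof.
  intros H1 N; unfold box.
  assert (E : forall n, sum_f_R0 (fun m => Rabs (const2 c n m) * w n m) N = match n with O => Rabs c | _ => 0 end).
  { intros n; induction N as [|N IH]; simpl.
    - destruct n; simpl; [rewrite H1; ring|rewrite Rabs_R0; ring].
    - rewrite IH; destruct n; simpl; rewrite Rabs_R0; ring. }
  rewrite (sum_ext _ _ N (fun n _ => E n)); clear.
  induction N as [|N IH]; simpl; lra.
Qed.

End Norm.

(** The index pairs of the product form a triangle inside the square of pairs on the right. *)
Lemma sum_conv_le (f g : nat -> R) N : (forall n, 0 <= f n) -> (forall n, 0 <= g n) ->
  sum_f_R0 (fmul f g) N <= sum_f_R0 f N * sum_f_R0 g N.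
Proof.
  intros Hf Hg; revert f Hf; induction N as [|N IH]; intros f Hf.
  - simpl; unfold fmul; simpl; lra.
  - rewrite !decomp_sum with (N := S N) by lia; simpl pred.
    assert (E : sum_f_R0 (fun i => fmul f g (S i)) N =
      f O * sum_f_R0 (fun i => g (S i)) N + sum_f_R0 (fmul (shift f) g) N).
    { rewrite <- sum_scal_l, <- sum_plus; apply sum_ext; reflexivity. }
    rewrite E. change (fmul f g O) with (f O * g O).
    assert (I := IH (shift f) (fun n => Hf (S n))).
    change (fun i => f (S i)) with (shift f).
    pose proof (sum_nonneg (shift f) N (fun n => Hf (S n))).
    assert (G : sum_f_R0 g N <= g O + sum_f_R0 (fun i => g (S i)) N).
    { replace (g O + sum_f_R0 (fun i => g (S i)) N) with (sum_f_R0 g (S N)).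
      - apply sum_mono_N; auto.
      - rewrite decomp_sum by lia; reflexivity. }
    nra.
Qed.

Lemma conv_sum_R (f g : nat -> R) n : fmul f g n = sum_f_R0 (fun i => f i * g (n - i)%nat) n.
Proof.
  revert f; induction n as [|n IH]; intros f; [reflexivity|].
  rewrite decomp_sum by lia; simpl pred.
  change (fmul f g (S n)) with (f O * g (S n) + fmul (shift f) g n).
  rewrite IH; f_equal.
Qed.

Lemma mul2_sum u v n m :
  (u * v)%S n m = sum_f_R0 (fun j => sum_f_R0 (fun i => u j i * v (n - j)%nat (m - i)%nat) m) n.
Proof.
  revert u; induction n as [|n IH]; intros u.
  - simpl; apply conv_sum_R.
  - rewrite decomp_sum by lia; simpl pred.
    change ((u * v)%S (S n) m) with (fmul (u O) (v (S n)) m + ((shift u) * v)%S n m).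
    rewrite IH, conv_sum_R; f_equal.
Qed.

Lemma box_mul_le (u v : fps2) N : (forall n m, 0 <= u n m) -> (forall n m, 0 <= v n m) ->
  box (u * v)%S N <= box u N * box v N.
Proof.
  intros Hu Hv; unfold box.
  apply Rle_trans with (sum_f_R0 (fmul (fun n => sum_f_R0 (u n) N) (fun n => sum_f_R0 (v n) N)) N).
  - apply sum_le; intros n _; clear - Hu Hv; revert u Hu; induction n as [|n IH]; intros u Hu.
    + apply (sum_conv_le (u O) (v O)); auto.
    + change ((u * v)%S (S n)) with (fun m => fmul (u O) (v (S n)) m + ((shift u) * v)%S n m).
      rewrite sum_plus.
      change (fmul ?f ?g (S n)) with (f O * g (S n) + fmul (shift f) g n); cbv beta.
      apply Rplus_le_compat.
      * apply (sum_conv_le (u O) (v (S n))); auto.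
      * apply IH; unfold shift; auto.
  - apply sum_conv_le; intros; apply sum_nonneg; auto.
Qed.

(** A submultiplicative weight at (n, m) can be split over the two factors of each term of the
    Cauchy product, so the weighted coefficients are dominated by those of the product of the
    weighted absolute series. *)
Lemma nle_mul w u v M M' : (forall n m, 0 <= w n m) ->
  (forall n m n' m', w (n + n')%nat (m + m')%nat <= w n m * w n' m') ->
  nle w u M -> nle w v M' -> nle w (u * v)%S (M * M').
Proof.
  intros w_nonneg Hw Hu Hv N.
  set (u' := fun n m => Rabs (u n m) * w n m); set (v' := fun n m => Rabs (v n m) * w n m).
  assert (Pu : forall n m, 0 <= u' n m) by (intros; apply Rmult_le_pos; auto using Rabs_pos).
  assert (Pv : forall n m, 0 <= v' n m) by (intros; apply Rmult_le_pos; auto using Rabs_pos).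
  apply Rle_trans with (box (u' * v')%S N).
  - apply box_le; intros n m _ _; rewrite !mul2_sum.
    rewrite Rmult_comm.
    eapply Rle_trans; [apply Rmult_le_compat_l; [auto|apply Rsum_abs]|].
    rewrite <- sum_scal_l; apply sum_le; intros j Hj.
    eapply Rle_trans; [apply Rmult_le_compat_l; [auto|apply Rsum_abs]|].
    rewrite <- sum_scal_l; apply sum_le; intros i Hi.
    rewrite Rabs_mult; unfold u', v'.
    assert (L := Hw j i (n - j)%nat (m - i)%nat).
    replace (j + (n - j))%nat with n in L by lia; replace (i + (m - i))%nat with m in L by lia.
    assert (P : 0 <= Rabs (u j i) * Rabs (v (n - j)%nat (m - i)%nat)) by (apply Rmult_le_pos; apply Rabs_pos).
    apply Rle_trans with (1 := Rmult_le_compat_r _ _ _ P L); lra.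
  - eapply Rle_trans; [apply box_mul_le; auto|].
    apply Rmult_le_compat; try (apply box_nonneg; auto); [apply Hu|apply Hv].
Qed.

(** * Sums of double power series *)

Definition pw (r1 r2 : R) (n m : nat) : R := r2 ^ n * r1 ^ m.

(** Each strictly smaller box may have its own bound, which makes the class stable under [Ds] and
    [Dt]. [R1] belongs to s and [R2] to t. *)
Definition An (R1 R2 : R) (u : fps2) : Prop :=
  forall r1 r2, 0 < r1 < R1 -> 0 < r2 < R2 -> exists M, nle (pw r1 r2) u M.

(** As an iterated sum it falls under the one-variable theory of [PSeries] in t; the corresponding
    facts in s come from the transpose [tr] and Fubini. *)
Definition ev (u : fps2) (s t : R) : R := PSeries (fun n => PSeries (u n) s) t.

Definition tr (u : fps2) : fps2 := fun n m => u m n.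

Lemma pw_nonneg r1 r2 n m : 0 < r1 -> 0 < r2 -> 0 <= pw r1 r2 n m.
Proof. intros; apply Rmult_le_pos; apply pow_le; lra. Qed.

Lemma nle_pw_tr r1 r2 u M : nle (pw r1 r2) u M -> nle (pw r2 r1) (tr u) M.
Proof.
  intros H N; rewrite <- box_tr; eapply Rle_trans; [|apply (H N)].
  apply box_le; intros n m _ _; unfold tr, pw; apply Req_le; ring.
Qed.

Lemma An_tr R1 R2 u : An R1 R2 u -> An R2 R1 (tr u).
Proof.
  intros H r1 r2 H1 H2; destruct (H r2 r1 H2 H1) as [M HM]; exists M; apply nle_pw_tr, HM.
Qed.

Lemma An_point R1 R2 u s t : An R1 R2 u -> Rabs s < R1 -> Rabs t < R2 ->
  exists r1 r2 M, Rabs s < r1 < R1 /\ Rabs t < r2 < R2 /\ 0 < r1 /\ 0 < r2 /\ nle (pw r1 r2) u M.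
Proof.
  intros H Hs Ht; exists ((Rabs s + R1) / 2), ((Rabs t + R2) / 2).
  pose proof (Rabs_pos s); pose proof (Rabs_pos t).
  destruct (H ((Rabs s + R1) / 2) ((Rabs t + R2) / 2)) as [M HM]; [lra|lra|].
  exists M; repeat split; try lra; exact HM.
Qed.

Lemma ev_double u s t :
  ev u s t = Series (fun n => Series (fun m => u n m * s ^ m * t ^ n)).
Proof.
  unfold ev, PSeries; apply Series_ext; intros n; symmetry; apply Series_scal_r.
Qed.

Lemma absbox_ev r1 r2 u M s t : nle (pw r1 r2) u M -> Rabs s <= r1 -> Rabs t <= r2 ->
  absbox_le (fun n m => u n m * s ^ m * t ^ n) M.
Proof.
  intros H Hs Ht N; eapply Rle_trans; [|apply (H N)].
  apply box_le; intros n m _ _; rewrite !Rabs_mult, <- !RPow_abs, Rmult_assoc.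
  apply Rmult_le_compat_l; [apply Rabs_pos|]; unfold pw; rewrite Rmult_comm.
  apply Rmult_le_compat; try (apply pow_le, Rabs_pos); apply pow_incr; split; auto using Rabs_pos.
Qed.

Lemma ev_tr R1 R2 u s t : An R1 R2 u -> Rabs s < R1 -> Rabs t < R2 -> ev (tr u) t s = ev u s t.
Proof.
  intros H Hs Ht; destruct (An_point _ _ _ _ _ H Hs Ht) as (r1 & r2 & M & ? & ? & ? & ? & HM).
  rewrite !ev_double.
  rewrite <- (double_swap (fun n m => u n m * s ^ m * t ^ n) M).
  - apply Series_ext; intros n; apply Series_ext; intros m; unfold tr; ring.
  - apply (absbox_ev r1 r2); auto; lra.
Qed.

Lemma ev_bound r1 r2 u M s t : nle (pw r1 r2) u M -> Rabs s <= r1 -> Rabs t <= r2 ->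
  Rabs (ev u s t) <= M.
Proof.
  intros H Hs Ht; rewrite ev_double; apply (double_abs _ M), (absbox_ev r1 r2); auto.
Qed.

Lemma radius_bound a r M x : (forall n, Rabs (a n) * r ^ n <= M) -> 0 < r -> Rabs x < r ->
  Rbar_lt (Rabs x) (CV_radius a).
Proof.
  intros H Hr Hx; apply Rbar_lt_le_trans with (Finite r); [exact Hx|].
  destruct (CV_radius_bounded a) as [U _]; apply U; exists M; intros n.
  rewrite Rabs_mult, <- RPow_abs, (Rabs_pos_eq r) by lra; apply H.
Qed.

Lemma nle_term w u M n m : (forall n m, 0 <= w n m) -> nle w u M -> Rabs (u n m) * w n m <= M.
Proof.
  intros Hw H.
  assert (P : forall n m, 0 <= Rabs (u n m) * w n m) by (intros; apply Rmult_le_pos; auto using Rabs_pos).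
  apply Rle_trans with (2 := H (max n m)).
  apply Rle_trans with (sum_f_R0 (fun n => sum_f_R0 (fun m => Rabs (u n m) * w n m) m) n).
  - apply Rle_trans with (sum_f_R0 (fun m => Rabs (u n m) * w n m) m).
    + apply (term_le_sum (fun m => Rabs (u n m) * w n m)); auto.
    + apply (term_le_sum (fun n => sum_f_R0 (fun m => Rabs (u n m) * w n m) m)); auto.
      intros; apply sum_nonneg; auto.
  - apply rect_le_box; auto; lia.
Qed.

Lemma row_radius r1 r2 u M n s : 0 < r1 -> 0 < r2 -> nle (pw r1 r2) u M -> Rabs s < r1 ->
  Rbar_lt (Rabs s) (CV_radius (u n)).
Proof.
  intros H1 H2 H Hs; apply radius_bound with r1 (M / r2 ^ n); auto.
  intros m; pose proof (pow_lt r2 n H2).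
  apply Rmult_le_reg_r with (r2 ^ n); auto.
  unfold Rdiv; rewrite (Rmult_assoc M), Rinv_l, Rmult_1_r by lra.
  pose proof (nle_term (pw r1 r2) u M n m (fun n m => pw_nonneg r1 r2 n m H1 H2) H) as T.
  unfold pw in T; lra.
Qed.

(** A coefficient in t, multiplied by r2^n, is at most one row of an absolutely summable double
    series with total at most [M]. *)
Lemma col_radius r1 r2 u M s t : 0 < r1 -> 0 < r2 -> nle (pw r1 r2) u M -> Rabs s <= r1 -> Rabs t < r2 ->
  Rbar_lt (Rabs t) (CV_radius (fun n => PSeries (u n) s)).
Proof.
  intros H1 H2 H Hs Ht; apply radius_bound with r2 M; auto.
  intros n.
  assert (A : absbox_le (fun n m => u n m * s ^ m * r2 ^ n) M).
  { apply (absbox_ev r1 r2); auto; rewrite Rabs_pos_eq; lra. }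
  destruct (double_abs _ M A) as (E1 & E2 & E3 & E4 & E5).
  replace (Rabs (PSeries (u n) s) * r2 ^ n) with (Rabs (Series (fun m => u n m * s ^ m * r2 ^ n))).
  2:{ unfold PSeries; rewrite Series_scal_r, Rabs_mult, (Rabs_pos_eq (r2 ^ n)); auto.
      apply pow_le; lra. }
  eapply Rle_trans; [apply Series_Rabs; auto|].
  destruct (double_nonneg (fun n m => Rabs (u n m * s ^ m * r2 ^ n)) M) as (_ & _ & B); auto using Rabs_pos.
  eapply Rle_trans; [|apply B].
  assert (P : forall n, 0 <= Series (fun m => Rabs (u n m * s ^ m * r2 ^ n))).
  { intros; apply Series_nonneg; auto; intros; apply Rabs_pos. }
  eapply Rle_trans; [|apply (sum_le_Series (fun n => Series (fun m => Rabs (u n m * s ^ m * r2 ^ n))) n); auto].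
  apply (term_le_sum (fun n => Series (fun m => Rabs (u n m * s ^ m * r2 ^ n)))); auto.
Qed.

Lemma ex_pseries_row R1 R2 u n s : 0 < R2 -> An R1 R2 u -> Rabs s < R1 ->
  Rbar_lt (Rabs s) (CV_radius (u n)).
Proof.
  intros HR H Hs; destruct (An_point _ _ _ s 0 H Hs) as (r1 & r2 & M & ? & ? & ? & ? & HM).
  { rewrite Rabs_R0; auto. }
  apply (row_radius r1 r2 u M); auto; lra.
Qed.

Lemma ex_pseries_col R1 R2 u s t : An R1 R2 u -> Rabs s < R1 -> Rabs t < R2 ->
  Rbar_lt (Rabs t) (CV_radius (fun n => PSeries (u n) s)).
Proof.
  intros H Hs Ht; destruct (An_point _ _ _ s t H Hs Ht) as (r1 & r2 & M & ? & ? & ? & ? & HM).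
  apply (col_radius r1 r2 u M); auto; lra.
Qed.

Section Box.
Variables R1 R2 : R.

Lemma pos_of_abs x y : Rabs x < y -> 0 < y.
Proof. intros; pose proof (Rabs_pos x); lra. Qed.

Lemma ev_add u v s t : An R1 R2 u -> An R1 R2 v -> Rabs s < R1 -> Rabs t < R2 ->
  ev (u + v)%S s t = ev u s t + ev v s t.
Proof.
  intros Hu Hv Hs Ht; pose proof (pos_of_abs _ _ Ht); unfold ev.
  rewrite <- PSeries_plus; try (apply CV_radius_inside; eapply ex_pseries_col; eauto).
  apply PSeries_ext; intros n.
  apply (PSeries_plus (u n) (v n)); apply CV_radius_inside; eapply ex_pseries_row; eauto.
Qed.

Lemma ev_opp u s t : ev (- u)%S s t = - ev u s t.
Proof.
  unfold ev; rewrite <- PSeries_opp; apply PSeries_ext; intros n; apply (PSeries_opp (u n)).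
Qed.

Lemma An_add u v : An R1 R2 u -> An R1 R2 v -> An R1 R2 (u + v)%S.
Proof.
  intros Hu Hv r1 r2 H1 H2; destruct (Hu r1 r2 H1 H2) as [M HM]; destruct (Hv r1 r2 H1 H2) as [M' HM'].
  exists (M + M'); apply nle_add; auto; intros; apply pw_nonneg; lra.
Qed.

Lemma An_opp u : An R1 R2 u -> An R1 R2 (- u)%S.
Proof.
  intros Hu r1 r2 H1 H2; destruct (Hu r1 r2 H1 H2) as [M HM].
  exists M; apply nle_opp; auto.
Qed.

Lemma sub2_opp u v : (u - v)%S = (u + - v)%S.
Proof. ring. Qed.

Lemma An_sub u v : An R1 R2 u -> An R1 R2 v -> An R1 R2 (u - v)%S.
Proof. intros; rewrite sub2_opp; auto using An_add, An_opp. Qed.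

Lemma ev_sub u v s t : An R1 R2 u -> An R1 R2 v -> Rabs s < R1 -> Rabs t < R2 ->
  ev (u - v)%S s t = ev u s t - ev v s t.
Proof. intros; rewrite sub2_opp, ev_add, ev_opp; auto using An_opp. Qed.

Lemma An_mul u v : An R1 R2 u -> An R1 R2 v -> An R1 R2 (u * v)%S.
Proof.
  intros Hu Hv r1 r2 H1 H2; destruct (Hu r1 r2 H1 H2) as [M HM]; destruct (Hv r1 r2 H1 H2) as [M' HM'].
  exists (M * M'); apply nle_mul; auto.
  - intros; apply pw_nonneg; lra.
  - intros n m n' m'; unfold pw; rewrite !pow_add; apply Req_le; ring.
Qed.

Lemma PS_mult_fmul (a b : fps) n : PS_mult a b n = fmul a b n.
Proof. symmetry; apply conv_sum_R. Qed.

Lemma PSeries_conv (u v : fps2) n s :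
  (forall n, Rbar_lt (Rabs s) (CV_radius (u n))) -> (forall n, Rbar_lt (Rabs s) (CV_radius (v n))) ->
  Rbar_lt (Rabs s) (CV_radius ((u * v)%S n)) /\
  PSeries ((u * v)%S n) s = fmul (fun n => PSeries (u n) s) (fun n => PSeries (v n) s) n.
Proof.
  intros Hu Hv.
  assert (Hm : forall i j, Rbar_lt (Rabs s) (CV_radius (fmul (u i) (v j)))).
  { intros i j; rewrite <- (CV_radius_ext _ _ (PS_mult_fmul (u i) (v j))).
    specialize (Hu i); specialize (Hv j).
    destruct (Rbar_lt_le_dec (Rabs s) (CV_radius (PS_mult (u i) (v j)))) as [|E]; auto; exfalso.
    (* Suppose the product had radius at most |s|. Some [x] beyond |s| lies inside both discs of
       convergence; the product series converges there, although outside its own disc its terms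
       cannot tend to zero. *)
    assert (exists x, Rabs s < x /\ Rbar_lt x (CV_radius (u i)) /\ Rbar_lt x (CV_radius (v j))) as (x & X1 & X2 & X3).
    { clear E; destruct (CV_radius (u i)) as [ru| |], (CV_radius (v j)) as [rv| |]; simpl in *; try easy.
      - exists ((Rabs s + Rmin ru rv) / 2); unfold Rmin; destruct (Rle_dec ru rv); lra.
      - exists ((Rabs s + ru) / 2); repeat split; lra.
      - exists ((Rabs s + rv) / 2); repeat split; lra.
      - exists (Rabs s + 1); repeat split; lra. }
    assert (Ax : Rabs x = x) by (apply Rabs_pos_eq; pose proof (Rabs_pos s); lra).
    rewrite <- Ax in X2, X3.
    assert (Z := ex_pseries_mult _ _ _ X2 X3).
    apply (CV_disk_outside (PS_mult (u i) (v j)) x).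
    - rewrite Ax; apply Rbar_le_lt_trans with (1 := E); exact X1.
    - apply ex_pseries_R in Z. apply ex_series_lim_0, Z. }
  revert u Hu Hm; induction n as [|n IH]; intros u Hu Hm.
  - split; [apply (Hm O O)|]. unfold mul2; simpl.
    rewrite <- (PSeries_ext _ _ s (PS_mult_fmul (u O) (v O))); apply PSeries_mult; auto.
  - change ((u * v)%S (S n)) with (PS_plus (fmul (u O) (v (S n))) (((shift u) * v)%S n)).
    destruct (IH (shift u)) as [A B]; [intros; apply Hu|intros; apply Hm|].
    split.
    + eapply Rbar_lt_le_trans; [|apply CV_radius_plus].
      unfold Rbar_min; destruct (CV_radius (fmul (u O) (v (S n)))) eqn:E1, (CV_radius ((shift u * v)%S n)) eqn:E2;
        try easy; specialize (Hm O (S n)); rewrite E1 in Hm; simpl in *; auto.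
      apply Rmin_glb_lt; auto.
    + rewrite PSeries_plus by (apply CV_radius_inside; auto).
      rewrite B, <- (PSeries_ext _ _ s (PS_mult_fmul (u O) (v (S n)))), PSeries_mult; auto.
Qed.

Lemma ev_mul u v s t : An R1 R2 u -> An R1 R2 v -> Rabs s < R1 -> Rabs t < R2 ->
  ev (u * v)%S s t = ev u s t * ev v s t.
Proof.
  intros Hu Hv Hs Ht; pose proof (pos_of_abs _ _ Ht); unfold ev.
  rewrite <- PSeries_mult; try (eapply ex_pseries_col; eauto).
  apply PSeries_ext; intros n; rewrite PS_mult_fmul.
  apply PSeries_conv; intros; eapply ex_pseries_row; eauto.
Qed.

End Box.

(** The factor created by differentiation is paid for by a slightly larger radius. Bernoulli gives
    (r'/r)^m >= 1 + m d with d = r'/r - 1, and m + 1 <= (1 + 1/d)(1 + m d). *)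
Lemma pow_deriv_bound r r' : 0 < r < r' -> exists C, 0 <= C /\ forall m, INR (S m) * r ^ m <= C * r' ^ S m.
Proof.
  intros [H1 H2]; set (d := r' / r - 1).
  assert (Hd : 0 < d).
  { unfold d; apply Rlt_0_minus, Rmult_lt_reg_r with r; auto.
    unfold Rdiv; rewrite Rmult_assoc, Rinv_l by lra; lra. }
  assert (P : 0 < / d) by (apply Rinv_0_lt_compat; auto).
  assert (P' : 0 < / r') by (apply Rinv_0_lt_compat; lra).
  exists ((1 + / d) / r'); split.
  - apply Rmult_le_pos; lra.
  - intros m.
    assert (B : 1 + INR m * d <= (r' / r) ^ m).
    { replace (r' / r) with (1 + d) by (unfold d; ring); apply poly; auto. }
    assert (E : r' ^ m = (r' / r) ^ m * r ^ m).
    { rewrite <- Rpow_mult_distr; f_equal; field; lra. }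
    replace ((1 + / d) / r' * r' ^ S m) with ((1 + / d) * r' ^ m) by (simpl; field; lra).
    rewrite E, <- Rmult_assoc; apply Rmult_le_compat_r; [apply pow_le; lra|].
    rewrite S_INR. pose proof (pos_INR m).
    apply Rle_trans with ((1 + / d) * (1 + INR m * d)).
    + replace ((1 + / d) * (1 + INR m * d)) with (1 + INR m * d + / d + INR m) by (field; lra); nra.
    + apply Rmult_le_compat_l; lra.
Qed.

Lemma An_Ds R1 R2 u : An R1 R2 u -> An R1 R2 (Ds u).
Proof.
  intros H r1 r2 H1 H2.
  destruct (H ((r1 + R1) / 2) r2) as [M HM]; [lra|lra|].
  destruct (pow_deriv_bound r1 ((r1 + R1) / 2)) as (C & HC & B); [lra|].
  set (r' := (r1 + R1) / 2) in *.
  exists (C * M); intros N.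
  assert (P : forall n m, 0 <= Rabs (u n m) * pw r' r2 n m).
  { intros; apply Rmult_le_pos; [apply Rabs_pos|apply pw_nonneg; unfold r'; lra]. }
  (* [Ds] reads column m + 1, so the columns reach N + 1 and the larger box is used. *)
  apply Rle_trans with (C * box (fun n m => Rabs (u n m) * pw r' r2 n m) (S N)).
  2:{ apply Rmult_le_compat_l; auto. }
  apply Rle_trans with (C * sum_f_R0 (fun n => sum_f_R0 (fun m => Rabs (u n m) * pw r' r2 n m) (S N)) N).
  2:{ apply Rmult_le_compat_l; auto; apply rect_le_box; auto. }
  rewrite <- sum_scal_l; apply sum_le; intros n _.
  rewrite decomp_sum with (N := S N) by lia; simpl pred.
  apply Rle_trans with (C * sum_f_R0 (fun i => Rabs (u n (S i)) * pw r' r2 n (S i)) N).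
  - rewrite <- sum_scal_l; apply sum_le; intros m _; unfold Ds, pw.
    rewrite Rabs_mult, (Rabs_pos_eq (INR _)) by apply pos_INR.
    assert (Q : 0 <= Rabs (u n (S m)) * r2 ^ n) by (apply Rmult_le_pos; [apply Rabs_pos|apply pow_le; lra]).
    pose proof (Rmult_le_compat_l _ _ _ Q (B m)); lra.
  - apply Rmult_le_compat_l; auto; specialize (P n O); lra.
Qed.

Lemma An_Dt R1 R2 u : An R1 R2 u -> An R1 R2 (Dt u).
Proof. intros H; apply (An_tr R2 R1 (Ds (tr u))), An_Ds, An_tr, H. Qed.

Lemma ev_Dt R1 R2 u s t : An R1 R2 u -> Rabs s < R1 -> Rabs t < R2 ->
  is_derive (fun t => ev u s t) t (ev (Dt u) s t).
Proof.
  intros Hu Hs Ht.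
  replace (ev (Dt u) s t) with (PSeries (PS_derive (fun n => PSeries (u n) s)) t).
  - apply is_derive_PSeries; eapply ex_pseries_col; eauto.
  - apply PSeries_ext; intros n; unfold PS_derive, Dt.
    symmetry; apply (PSeries_scal (INR (S n)) (u (S n))).
Qed.

Lemma locally_abs_lt x R : Rabs x < R -> locally x (fun y => Rabs y < R).
Proof.
  intros H; exists (mkposreal (R - Rabs x) (proj1 (Rminus_lt_0 _ _) H)); intros y Hy.
  unfold ball in Hy; simpl in Hy; unfold AbsRing_ball, abs, minus, plus, opp in Hy; simpl in Hy.
  replace y with (x + (y + - x)) by ring; eapply Rle_lt_trans; [apply Rabs_triang|lra].
Qed.

Lemma ev_Ds R1 R2 u s t : An R1 R2 u -> Rabs s < R1 -> Rabs t < R2 ->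
  is_derive (fun s => ev u s t) s (ev (Ds u) s t).
Proof.
  intros Hu Hs Ht.
  rewrite <- (ev_tr R1 R2) by (auto using An_Ds).
  apply is_derive_ext_loc with (fun s => ev (tr u) t s).
  - apply filter_imp with (2 := locally_abs_lt _ _ Hs).
    intros y Hy; apply (ev_tr R1 R2); auto.
  - apply (ev_Dt R2 R1 (tr u)); auto using An_tr.
Qed.

Lemma ev_Lipschitz_s R1 R2 u r1 r2 M s s' t : An R1 R2 u -> r1 < R1 -> r2 < R2 -> nle (pw r1 r2) (Ds u) M ->
  Rabs s <= r1 -> Rabs s' <= r1 -> Rabs t <= r2 -> Rabs (ev u s' t - ev u s t) <= M * Rabs (s' - s).
Proof.
  intros Hu H1 H2 HM Hs Hs' Ht.
  assert (B : forall x, Rmin s s' <= x <= Rmax s s' -> Rabs x <= r1).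
  { intros x Hx; apply Rabs_le; apply Rabs_le_between in Hs, Hs'.
    unfold Rmin, Rmax in Hx; destruct (Rle_dec s s'); lra. }
  destruct (MVT_gen (fun s => ev u s t) s s' (fun s => ev (Ds u) s t)) as (c & Hc & E).
  - intros x Hx; apply (ev_Ds R1 R2); auto; [|lra].
    apply Rle_lt_trans with (2 := H1), B; lra.
  - intros x Hx; apply continuity_pt_filterlim, (ex_derive_continuous (fun s => ev u s t)).
    exists (ev (Ds u) x t); apply (ev_Ds R1 R2); auto; [|lra].
    apply Rle_lt_trans with (2 := H1), B; lra.
  - rewrite E, Rabs_mult; apply Rmult_le_compat_r; [apply Rabs_pos|].
    apply (ev_bound r1 r2); auto.
Qed.

(** A Lipschitz bound in s that is uniform in t, combined with continuity in t alone. *)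
Lemma ev_continuous R1 R2 u s t : An R1 R2 u -> Rabs s < R1 -> Rabs t < R2 ->
  continuity_2d_pt (ev u) s t.
Proof.
  intros Hu Hs Ht eps.
  destruct (An_point _ _ _ s t (An_Ds _ _ _ Hu) Hs Ht) as (r1 & r2 & M & A1 & A2 & A3 & A4 & HM).
  assert (T : is_derive (fun t => ev u s t) t (ev (Dt u) s t)) by (apply (ev_Dt R1 R2); auto).
  assert (C : continuity_pt (fun t => ev u s t) t).
  { apply continuity_pt_filterlim, (ex_derive_continuous (fun t => ev u s t)).
    exists (ev (Dt u) s t); exact T. }
  assert (M0 : 0 <= M) by (apply (nle_ge0 (pw r1 r2)) with (Ds u); auto; intros; apply pw_nonneg; auto).
  assert (e2 : 0 < eps / 2) by (destruct eps as [e He]; simpl; lra).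
  destruct (proj1 (continuity_pt_locally _ _) C (mkposreal _ e2)) as [d Hd].
  assert (HK : 0 < eps / (2 * (M + 1))).
  { apply Rdiv_lt_0_compat; [apply eps|lra]. }
  destruct (common_lower_bound d (r1 - Rabs s)) as (x1 & ? & ? & ?); [apply d|lra|].
  destruct (common_lower_bound x1 (r2 - Rabs t)) as (x2 & ? & ? & ?); [auto|lra|].
  destruct (common_lower_bound x2 (eps / (2 * (M + 1)))) as (d' & Hd' & ? & D4); auto.
  exists (mkposreal d' Hd'); simpl; intros x y Hx Hy.
  assert (D1 : d' <= d) by lra.
  assert (X : Rabs x <= r1).
  { replace x with (s + (x - s)) by ring; eapply Rle_trans; [apply Rabs_triang|lra]. }
  assert (Y : Rabs y <= r2).
  { replace y with (t + (y - t)) by ring; eapply Rle_trans; [apply Rabs_triang|lra]. }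
  replace (ev u x y - ev u s t) with ((ev u x y - ev u s y) + (ev u s y - ev u s t)) by ring.
  eapply Rle_lt_trans; [apply Rabs_triang|].
  assert (L : Rabs (ev u x y - ev u s y) <= M * Rabs (x - s)).
  { apply (ev_Lipschitz_s R1 R2 u r1 r2); auto; lra. }
  assert (L2 : Rabs (ev u s y - ev u s t) < eps / 2).
  { apply (Hd y). unfold ball; simpl; unfold AbsRing_ball, abs, minus, plus, opp; simpl.
    eapply Rlt_le_trans; [apply Hy|auto]. }
  assert (L3 : M * Rabs (x - s) <= eps / 2).
  { apply Rle_trans with (M * (eps / (2 * (M + 1)))).
    - apply Rmult_le_compat_l; lra.
    - apply Rle_trans with ((M + 1) * (eps / (2 * (M + 1)))).
      + apply Rmult_le_compat_r; lra.
      + apply Req_le; field; lra. }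
  lra.
Qed.

(** * Functions given by a double power series on a box *)

Definition in_box (s0 R1 R2 s t : R) : Prop := Rabs (s - s0) < R1 /\ Rabs t < R2.

Definition rep (s0 R1 R2 : R) (f : R -> R -> R) (u : fps2) : Prop :=
  An R1 R2 u /\ forall s t, in_box s0 R1 R2 s t -> f s t = ev u (s - s0) t.

Section Rep.
Variables s0 R1 R2 : R.
Notation rep := (rep s0 R1 R2).
Notation in_box := (in_box s0 R1 R2).

Lemma in_box_near_s s t : in_box s t -> locally s (fun s' => in_box s' t).
Proof.
  intros [Hs Ht].
  exists (mkposreal (R1 - Rabs (s - s0)) (proj1 (Rminus_lt_0 _ _) Hs)); intros y Hy; split; auto.
  unfold ball in Hy; simpl in Hy; unfold AbsRing_ball, abs, minus, plus, opp in Hy; simpl in Hy.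
  replace (y - s0) with ((s - s0) + (y + - s)) by ring; eapply Rle_lt_trans; [apply Rabs_triang|lra].
Qed.

Lemma in_box_near_t s t : in_box s t -> locally t (fun t' => in_box s t').
Proof.
  intros [Hs Ht]; apply filter_imp with (2 := locally_abs_lt _ _ Ht); intros; split; auto.
Qed.

Lemma rep_is_ds f u s t : rep f u -> in_box s t -> is_derive (fun x => f x t) s (ev (Ds u) (s - s0) t).
Proof.
  intros [Hu Hf] Hb.
  apply is_derive_ext_loc with (fun x => ev u (x - s0) t).
  - apply filter_imp with (2 := in_box_near_s _ _ Hb); intros; symmetry; apply Hf; auto.
  - assert (D := ev_Ds R1 R2 u (s - s0) t Hu (proj1 Hb) (proj2 Hb)).
    assert (E : is_derive (fun x => x - s0) s 1) by (auto_derive; auto; ring).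
    assert (F := is_derive_comp (fun s => ev u s t) (fun x => x - s0) s _ _ D E).
    unfold scal in F; simpl in F; unfold mult in F; simpl in F; rewrite Rmult_1_l in F; exact F.
Qed.

Lemma rep_is_dt f u s t : rep f u -> in_box s t -> is_derive (fun y => f s y) t (ev (Dt u) (s - s0) t).
Proof.
  intros [Hu Hf] Hb.
  apply is_derive_ext_loc with (fun y => ev u (s - s0) y).
  - apply filter_imp with (2 := in_box_near_t _ _ Hb); intros; symmetry; apply Hf; auto.
  - apply (ev_Dt R1 R2); auto; apply Hb.
Qed.

Lemma rep_ds f u : rep f u -> rep (ds f) (Ds u).
Proof.
  intros Hf; split; [apply An_Ds, Hf|].
  intros s t Hb; apply is_derive_unique, rep_is_ds; auto.
Qed.

Lemma rep_dt f u : rep f u -> rep (dt f) (Dt u).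
Proof.
  intros Hf; split; [apply An_Dt, Hf|].
  intros s t Hb; apply is_derive_unique, rep_is_dt; auto.
Qed.

Lemma rep_continuous f u s t : rep f u -> in_box s t ->
  continuous (fun p : R * R => f (fst p) (snd p)) (s, t).
Proof.
  intros [Hu Hf] Hb.
  apply (continuity_2d_pt_filterlim f s t).
  intros eps; destruct (ev_continuous R1 R2 u (s - s0) t Hu (proj1 Hb) (proj2 Hb) eps) as [d Hd].
  destruct Hb as [Hs Ht].
  destruct (common_lower_bound d (R1 - Rabs (s - s0))) as (x1 & ? & ? & ?); [apply d|lra|].
  destruct (common_lower_bound x1 (R2 - Rabs t)) as (d' & Hd' & ? & ?); [auto|lra|].
  exists (mkposreal _ Hd'); simpl; intros x y Hx Hy.
  rewrite (Hf x y), (Hf s t).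
  - apply Hd; [replace (x - s0 - (s - s0)) with (x - s) by ring|]; lra.
  - split; auto.
  - split.
    + replace (x - s0) with ((s - s0) + (x - s)) by ring; eapply Rle_lt_trans; [apply Rabs_triang|lra].
    + replace y with (t + (y - t)) by ring; eapply Rle_lt_trans; [apply Rabs_triang|lra].
Qed.

End Rep.

(** Representability passes to partial derivatives of every order, so all the conditions reduce to
    three facts about representable functions. The singleton localizes [C2_on] to one point, so that
    different points may use different boxes. *)
Lemma rep_C2_at s0 R1 R2 f u s t : rep s0 R1 R2 f u -> in_box s0 R1 R2 s t ->
  C2_on (fun p => p = (s, t)) f.
Proof.
  intros Hf Hb s' t' E; injection E as -> ->.
  pose proof (rep_ds _ _ _ _ _ Hf) as Hs; pose proof (rep_dt _ _ _ _ _ Hf) as Ht.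
  pose proof (rep_ds _ _ _ _ _ Hs) as Hss; pose proof (rep_dt _ _ _ _ _ Hs) as Hst.
  pose proof (rep_ds _ _ _ _ _ Ht) as Hts; pose proof (rep_dt _ _ _ _ _ Ht) as Htt.
  assert (Es : forall g v, rep s0 R1 R2 g v -> ex_derive (fun x => g x t) s).
  { intros g v Hg; eexists; apply (rep_is_ds _ _ _ _ _ _ _ Hg Hb). }
  assert (Et : forall g v, rep s0 R1 R2 g v -> ex_derive (fun y => g s y) t).
  { intros g v Hg; eexists; apply (rep_is_dt _ _ _ _ _ _ _ Hg Hb). }
  assert (Ec : forall g v, rep s0 R1 R2 g v -> continuous (fun p : R * R => g (fst p) (snd p)) (s, t)).
  { intros g v Hg; apply (rep_continuous _ _ _ _ _ _ _ Hg Hb). }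
  repeat split; [eapply Es|eapply Et|eapply Es|eapply Et|eapply Es|eapply Et|eapply Ec|eapply Ec|eapply Ec
    |eapply Ec|eapply Ec|eapply Ec|eapply Ec]; eassumption.
Qed.

(** * A weighted norm without loss of derivatives *)

(** The binomial coefficient (n+m)!/(n! m!) through Pascal's rule; the inner fixpoint makes the
    double recursion structural. *)
Fixpoint bin2 (n : nat) : nat -> R :=
  match n with
  | O => fun _ => 1
  | S n' => fix aux m := match m with O => 1 | S m' => bin2 n' (S m') + aux m' end
  end.

Lemma bin2_SS n m : bin2 (S n) (S m) = bin2 n (S m) + bin2 (S n) m.
Proof. reflexivity. Qed.

Lemma bin2_n0 n : bin2 n O = 1.
Proof. destruct n; reflexivity. Qed.

Lemma bin2_ge1 n m : 1 <= bin2 n m.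
Proof.
  revert m; induction n as [|n IH]; intros m; [simpl; lra|].
  induction m as [|m IHm]; [simpl; lra|]. rewrite bin2_SS; specialize (IH (S m)); lra.
Qed.

Lemma bin2_mono_n n m n' : (n <= n')%nat -> bin2 n m <= bin2 n' m.
Proof.
  induction 1 as [|n' _ IH]; [lra|]. apply Rle_trans with (1 := IH).
  destruct m as [|m]; [rewrite !bin2_n0; lra|].
  rewrite bin2_SS; pose proof (bin2_ge1 (S n') m); lra.
Qed.

Lemma bin2_mono_m n m m' : (m <= m')%nat -> bin2 n m <= bin2 n m'.
Proof.
  induction 1 as [|m' _ IH]; [lra|]. apply Rle_trans with (1 := IH).
  destruct n as [|n]; [simpl; lra|].
  rewrite bin2_SS; pose proof (bin2_ge1 n (S m')); lra.
Qed.

(** Choosing n out of n+m and n' out of n'+m' gives some of the choices of n+n' out of all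
    n+m+n'+m'. The induction applies Pascal's rule to the first pair. *)
Lemma bin2_mul_le n m n' m' : bin2 n m * bin2 n' m' <= bin2 (n + n') (m + m').
Proof.
  revert m; induction n as [|n IHn]; intros m.
  - simpl bin2 at 1; rewrite Rmult_1_l; apply bin2_mono_m; lia.
  - induction m as [|m IHm].
    + rewrite bin2_n0, Rmult_1_l; apply bin2_mono_n; lia.
    + change (S n + n')%nat with (S (n + n')); change (S m + m')%nat with (S (m + m')).
      rewrite !bin2_SS, Rmult_plus_distr_r.
      apply Rplus_le_compat; [apply (IHn (S m))|apply IHm].
Qed.

(** Both sides are (n+m+1)!/(n! m!). *)
Lemma bin2_ratio n m : INR (S n) * bin2 (S n) m = INR (S m) * bin2 n (S m).
Proof.
  revert m; induction n as [|n IHn]; intros m.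
  - induction m as [|m IHm]; [simpl; ring|].
    rewrite bin2_SS, Rmult_plus_distr_l, IHm, !S_INR; simpl; ring.
  - induction m as [|m IHm].
    + rewrite bin2_SS, !bin2_n0.
      specialize (IHn O); rewrite bin2_n0 in IHn; rewrite (S_INR (S n)); rewrite !S_INR in *; simpl INR in *; lra.
    + rewrite (bin2_SS (S n)), Rmult_plus_distr_l, IHm.
      rewrite (bin2_SS n (S m)), Rmult_plus_distr_l, <- (IHn (S m)).
      rewrite !S_INR; ring.
Qed.

(** An entry of row n+m of Pascal's triangle is at most 2^(n+m). This is the origin of the halves in
    the radii [r / 2] and [A * r / 2]. *)
Lemma bin2_le_pow n m : bin2 n m <= 2 ^ n * 2 ^ m.
Proof.
  revert m; induction n as [|n IHn]; intros m.
  - simpl; rewrite Rmult_1_l; apply pow_R1_Rle; lra.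
  - induction m as [|m IHm].
    + rewrite bin2_n0, Rmult_1_r; apply pow_R1_Rle; lra.
    + rewrite bin2_SS; specialize (IHn (S m)); simpl in *; lra.
Qed.

(* The weight is chosen so that [It (Ds u)] is bounded by [A] times [u], with no loss of derivative;
   it is submultiplicative because of [bin2_mul_le]. *)
Definition wt (A r : R) (n m : nat) : R := A ^ n * r ^ (n + m) / bin2 n m.

Record good_weight (w : nat -> nat -> R) : Prop := {
  gw_pos : forall n m, 0 < w n m;
  gw_one : w O O = 1;
  gw_mul : forall n m n' m', w (n + n')%nat (m + m')%nat <= w n m * w n' m' }.

Lemma gw_nonneg w : good_weight w -> forall n m, 0 <= w n m.
Proof. intros H n m; apply Rlt_le, H. Qed.

Lemma wt_good A r : 0 < A -> 0 < r -> good_weight (wt A r).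
Proof.
  intros HA Hr; split.
  - intros n m; pose proof (bin2_ge1 n m); unfold wt; apply Rdiv_lt_0_compat; [|lra].
    apply Rmult_lt_0_compat; apply pow_lt; auto.
  - unfold wt; simpl; field.
  - intros n m n' m'; unfold wt.
    pose proof (bin2_ge1 n m); pose proof (bin2_ge1 n' m').
    pose proof (bin2_mul_le n m n' m').
    replace (A ^ n * r ^ (n + m) / bin2 n m * (A ^ n' * r ^ (n' + m') / bin2 n' m'))
      with ((A ^ n * r ^ (n + m) * (A ^ n' * r ^ (n' + m'))) / (bin2 n m * bin2 n' m')) by (field; lra).
    replace (A ^ (n + n') * r ^ (n + n' + (m + m'))) with (A ^ n * r ^ (n + m) * (A ^ n' * r ^ (n' + m')))
      by (rewrite !pow_add; ring).
    apply Rmult_le_compat_l.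
    + repeat apply Rmult_le_pos; apply pow_le; lra.
    + apply Rinv_le_contravar; nra.
Qed.

(** For operators that raise the degree in t by one: the result has no row 0, and its other rows are
    compared with those of [y] one step lower. *)
Lemma box_shift_le x y c M N : (forall n m, 0 <= y n m) -> (forall N, box y N <= M) -> 0 <= c ->
  (forall m, x O m = 0) -> (forall n m, x (S n) m <= c * y n m) -> box x N <= c * M.
Proof.
  intros Hy HM Hc H0 HS.
  assert (E0 : sum_f_R0 (x O) N = 0).
  { rewrite (sum_ext _ (fun _ => 0 * 0)) by (intros; rewrite H0; ring); rewrite sum_scal_l; ring. }
  apply Rle_trans with (c * box y N); [|apply Rmult_le_compat_l; auto].
  destruct N as [|N]; unfold box.
  - cbn [sum_f_R0] in E0 |- *; rewrite E0; apply Rmult_le_pos; auto.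
  - rewrite decomp_sum, E0, Rplus_0_l by lia; simpl pred.
    apply Rle_trans with (c * sum_f_R0 (fun n => sum_f_R0 (y n) (S N)) N).
    + rewrite <- sum_scal_l; apply sum_le; intros n _; rewrite <- sum_scal_l; apply sum_le; intros m _; apply HS.
    + apply Rmult_le_compat_l; auto; apply sum_mono_N; auto; intros; apply sum_nonneg; auto.
Qed.

(** The exponent n + m of [r] is the same at (n+1, m) and (n, m+1); after [bin2_ratio] has cancelled
    the integer factors, a single power of [A] remains. *)
Lemma nle_It_Ds A r u M : 0 < A -> 0 < r -> nle (wt A r) u M -> nle (wt A r) (It (Ds u)) (A * M).
Proof.
  intros HA Hr H N.
  assert (Hw := gw_nonneg _ (wt_good A r HA Hr)).
  assert (P : forall n m, 0 <= Rabs (u n m) * wt A r n m) by (intros; apply Rmult_le_pos; auto using Rabs_pos).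
  assert (E : forall n m, Rabs (It (Ds u) (S n) m) * wt A r (S n) m = A * (Rabs (u n (S m)) * wt A r n (S m))).
  { intros n m; unfold It, Ds, wt.
    unfold Rdiv at 1; rewrite !Rabs_mult, (Rabs_pos_eq (INR (S m))), (Rabs_pos_eq (/ INR (S n))).
    2:{ apply Rlt_le, Rinv_0_lt_compat, lt_0_INR; lia. }
    2:{ apply pos_INR. }
    pose proof (bin2_ge1 (S n) m); pose proof (bin2_ge1 n (S m)).
    assert (S1 : INR (S n) <> 0) by (apply not_0_INR; lia).
    assert (S2 : INR (S m) <> 0) by (apply not_0_INR; lia).
    assert (B : bin2 (S n) m = INR (S m) * bin2 n (S m) / INR (S n)).
    { rewrite <- bin2_ratio; field; auto. }
    rewrite B; replace (S n + m)%nat with (n + S m)%nat by lia; rewrite <- (tech_pow_Rmult A); field; repeat split; auto; lra. }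
  apply (box_shift_le _ (fun n m => Rabs (u n (S m)) * wt A r n (S m))); auto; [|lra| |intros; rewrite E; lra].
  - intros N'; apply Rle_trans with (2 := H (S N')).
    apply Rle_trans with (sum_f_R0 (fun n => sum_f_R0 (fun m => Rabs (u n m) * wt A r n m) (S N')) N').
    + apply sum_le; intros n _; rewrite (decomp_sum _ (S N')) by lia; simpl pred; specialize (P n O); lra.
    + apply rect_le_box; auto.
  - intros m; simpl; rewrite Rabs_R0; ring.
Qed.

(** Plain integration moves (n, m) to (n+1, m), hence the additional power of [r]. The division by
    n+1 and the growth of the binomial are estimated away. *)
Lemma nle_It A r u M : 0 < A -> 0 < r -> nle (wt A r) u M -> nle (wt A r) (It u) (A * r * M).
Proof.
  intros HA Hr H N.
  assert (Hw := gw_nonneg _ (wt_good A r HA Hr)).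
  assert (Har : 0 < A * r) by nra.
  assert (P : forall n m, 0 <= Rabs (u n m) * wt A r n m) by (intros; apply Rmult_le_pos; auto using Rabs_pos).
  assert (E : forall n m, Rabs (It u (S n) m) * wt A r (S n) m <= A * r * (Rabs (u n m) * wt A r n m)).
  { intros n m; unfold It.
    assert (S1 : 1 <= INR (S n)) by (apply (le_INR 1); lia).
    unfold Rdiv; rewrite Rabs_mult, (Rabs_pos_eq (/ INR (S n))).
    2:{ apply Rlt_le, Rinv_0_lt_compat; lra. }
    assert (B : wt A r (S n) m <= A * r * wt A r n m).
    { unfold wt; pose proof (bin2_ge1 n m).
      replace (A * r * (A ^ n * r ^ (n + m) / bin2 n m)) with (A ^ S n * r ^ (S n + m) / bin2 n m)
        by (simpl; field; lra).
      apply Rmult_le_compat_l; [apply Rmult_le_pos; apply pow_le; lra|].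
      apply Rinv_le_contravar; [lra|]; apply bin2_mono_n; lia. }
    assert (I : / INR (S n) <= 1) by (rewrite <- Rinv_1; apply Rinv_le_contravar; lra).
    assert (I0 : 0 < / INR (S n)) by (apply Rinv_0_lt_compat; lra).
    replace (A * r * (Rabs (u n m) * wt A r n m)) with (Rabs (u n m) * 1 * (A * r * wt A r n m)) by ring.
    pose proof (Rabs_pos (u n m)).
    apply Rmult_le_compat; auto; [nra|nra]. }
  apply (box_shift_le _ (fun n m => Rabs (u n m) * wt A r n m)); auto; [lra|].
  intros m; simpl; rewrite Rabs_R0; ring.
Qed.

Lemma pw_le_wt A r r1 r2 n m : 0 < A -> 0 < r -> 0 < r1 <= r / 2 -> 0 < r2 <= A * r / 2 ->
  pw r1 r2 n m <= wt A r n m.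
Proof.
  intros HA Hr H1 H2; unfold pw, wt; pose proof (bin2_ge1 n m).
  apply Rle_trans with ((A * r / 2) ^ n * (r / 2) ^ m).
  - apply Rmult_le_compat; try (apply pow_le; lra); apply pow_incr; lra.
  - unfold Rdiv; rewrite !Rpow_mult_distr, pow_add, !pow_inv.
    replace (A ^ n * r ^ n * / 2 ^ n * (r ^ m * / 2 ^ m)) with (A ^ n * (r ^ n * r ^ m) * / (2 ^ n * 2 ^ m)).
    2:{ field; split; apply pow_nonzero; lra. }
    apply Rmult_le_compat_l.
    + repeat apply Rmult_le_pos; apply pow_le; lra.
    + apply Rinv_le_contravar; [lra|apply bin2_le_pow].
Qed.

Lemma nle_wt_pw A r r1 r2 u M : 0 < A -> 0 < r -> 0 < r1 <= r / 2 -> 0 < r2 <= A * r / 2 ->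
  nle (wt A r) u M -> nle (pw r1 r2) u M.
Proof.
  intros HA Hr H1 H2 H N; eapply Rle_trans; [|apply (H N)]; apply box_le; intros n m _ _.
  apply Rmult_le_compat_l; [apply Rabs_pos|apply pw_le_wt; auto].
Qed.

Lemma nle_wt_An A r u M : 0 < A -> 0 < r -> nle (wt A r) u M -> An (r / 2) (A * r / 2) u.
Proof. intros HA Hr H r1 r2 H1 H2; exists M; apply (nle_wt_pw A r); auto; lra. Qed.

(** * Substitution into power series in three variables *)

Definition tri (x : nat -> nat -> nat -> R) (N : nat) : R :=
  sum_f_R0 (fun i => sum_f_R0 (fun j => sum_f_R0 (x i j) N) N) N.

Lemma tri_le x y N : (forall i j k, x i j k <= y i j k) -> tri x N <= tri y N.
Proof. intros H; apply sum_le; intros; apply sum_le; intros; apply sum_le; auto. Qed.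

Lemma tri_ext x y N : (forall i j k, x i j k = y i j k) -> tri x N = tri y N.
Proof. intros H; apply Rle_antisym; apply tri_le; intros; rewrite H; lra. Qed.

Lemma tri_plus x y N : tri (fun i j k => x i j k + y i j k) N = tri x N + tri y N.
Proof.
  unfold tri; rewrite <- sum_plus; apply sum_ext; intros i _.
  rewrite <- sum_plus; apply sum_ext; intros j _; apply sum_plus.
Qed.

Lemma tri_scal c x N : tri (fun i j k => c * x i j k) N = c * tri x N.
Proof.
  unfold tri; rewrite <- sum_scal_l; apply sum_ext; intros i _.
  rewrite <- sum_scal_l; apply sum_ext; intros j _; apply sum_scal_l.
Qed.

Lemma tri_Rabs x N : Rabs (tri x N) <= tri (fun i j k => Rabs (x i j k)) N.
Proof.
  eapply Rle_trans; [apply Rsum_abs|]; apply sum_le; intros i _.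
  eapply Rle_trans; [apply Rsum_abs|]; apply sum_le; intros j _.
  apply Rsum_abs.
Qed.

Lemma tri_nonneg x N : (forall i j k, 0 <= x i j k) -> 0 <= tri x N.
Proof. intros H; apply sum_nonneg; intros; apply sum_nonneg; intros; apply sum_nonneg; auto. Qed.

Lemma tri_mono_N x N N' : (forall i j k, 0 <= x i j k) -> (N <= N')%nat -> tri x N <= tri x N'.
Proof.
  intros H L.
  apply Rle_trans with (sum_f_R0 (fun i => sum_f_R0 (fun j => sum_f_R0 (x i j) N') N') N).
  - apply sum_le; intros i _; apply (rect_le_box (x i)); auto.
  - apply sum_mono_N; auto; intros; apply sum_nonneg; intros; apply sum_nonneg; auto.
Qed.

(** Indicator of an index cube. With it the tail of a substitution is itself a partial sum, for
    coefficients set to zero inside the cube, and obeys the same norm estimate. *)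
Definition low (N i j k : nat) : bool := (i <=? N)%nat && (j <=? N)%nat && (k <=? N)%nat.

Lemma sum_cut x N N' : (N <= N')%nat ->
  sum_f_R0 (fun i => if (i <=? N)%nat then x i else 0) N' = sum_f_R0 x N.
Proof.
  induction 1 as [|N' L IH].
  - apply sum_ext; intros i Hi; rewrite (proj2 (Nat.leb_le i N) Hi); reflexivity.
  - cbn [sum_f_R0]; rewrite IH; destruct (Nat.leb_spec (S N') N); [lia|ring].
Qed.

Lemma tri_cut x N N' : (N <= N')%nat ->
  tri (fun i j k => if low N i j k then x i j k else 0) N' = tri x N.
Proof.
  intros L; unfold tri, low.
  rewrite <- (sum_cut _ N N' L); apply sum_ext; intros i _.
  destruct (i <=? N)%nat; simpl.
  - rewrite <- (sum_cut _ N N' L); apply sum_ext; intros j _.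
    destruct (j <=? N)%nat; simpl.
    + apply sum_cut; auto.
    + rewrite (sum_ext _ (fun _ => 0 * 0)) by (intros; ring); rewrite sum_scal_l; ring.
  - rewrite (sum_ext _ (fun _ => 0 * 0)).
    + rewrite sum_scal_l; ring.
    + intros j _; rewrite (sum_ext _ (fun _ => 0 * 0)) by (intros; ring); rewrite sum_scal_l; ring.
Qed.

Lemma tri_high x N N' : (N <= N')%nat ->
  tri (fun i j k => if low N i j k then 0 else x i j k) N' = tri x N' - tri x N.
Proof.
  intros L; rewrite <- (tri_cut x N N' L).
  rewrite (tri_ext x (fun i j k => (if low N i j k then x i j k else 0) + (if low N i j k then 0 else x i j k)) N').
  - rewrite tri_plus; ring.
  - intros i j k; destruct (low N i j k); ring.
Qed.

Fixpoint pow2 (u : fps2) (i : nat) : fps2 :=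
  match i with O => one2 | S i' => (u * pow2 u i')%S end.

Definition mono (X Y Z : fps2) (i j k : nat) : fps2 := (pow2 X i * pow2 Y j * pow2 Z k)%S.

Definition subN (a : nat -> nat -> nat -> R) (X Y Z : fps2) (N : nat) : fps2 :=
  fun n m => tri (fun i j k => a i j k * mono X Y Z i j k n m) N.

(* Junk unless the coefficients converge, see [subst_lim]. *)
Definition subst (a : nat -> nat -> nat -> R) (X Y Z : fps2) : fps2 :=
  fun n m => real (Lim_seq (fun N => subN a X Y Z N n m)).

Definition absmono (a : nat -> nat -> nat -> R) (r : R) (i j k : nat) : R :=
  Rabs (a i j k) * r ^ i * r ^ j * r ^ k.

Section Subst.
Variable w : nat -> nat -> R.
Hypothesis Hw : good_weight w.

Lemma nle_one : nle w one2 1.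
Proof.
  rewrite <- const2_1; replace 1 with (Rabs 1) at 2 by apply Rabs_R1.
  apply nle_const, gw_one, Hw.
Qed.

Lemma nle_gmul u v M M' : nle w u M -> nle w v M' -> nle w (u * v)%S (M * M').
Proof. apply nle_mul; [apply gw_nonneg; auto|apply gw_mul; auto]. Qed.

Lemma nle_pow u r i : nle w u r -> nle w (pow2 u i) (r ^ i).
Proof. intros H; induction i as [|i IH]; simpl; [apply nle_one|apply nle_gmul; auto]. Qed.

Lemma nle_scal c u M : nle w u M -> nle w (fun n m => c * u n m) (Rabs c * M).
Proof.
  intros H N; eapply Rle_trans; [|apply Rmult_le_compat_l; [apply Rabs_pos|apply (H N)]].
  rewrite <- box_scal; apply box_le; intros n m _ _; rewrite Rabs_mult, Rmult_assoc; lra.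
Qed.

Lemma nle_sum (u : nat -> fps2) (M : nat -> R) N : (forall i, nle w (u i) (M i)) ->
  nle w (fun n m => sum_f_R0 (fun i => u i n m) N) (sum_f_R0 M N).
Proof.
  intros H; induction N as [|N IH]; simpl; [apply H|].
  apply (nle_add w (gw_nonneg _ Hw) (fun n m => sum_f_R0 (fun i => u i n m) N) (u (S N))); auto.
Qed.

Lemma nle_subN a X Y Z r N : nle w X r -> nle w Y r -> nle w Z r ->
  nle w (subN a X Y Z N) (tri (absmono a r) N).
Proof.
  intros HX HY HZ; unfold subN, tri.
  apply (nle_sum (fun i n m => sum_f_R0 (fun j => sum_f_R0 (fun k => a i j k * mono X Y Z i j k n m) N) N)); intros i.
  apply (nle_sum (fun j n m => sum_f_R0 (fun k => a i j k * mono X Y Z i j k n m) N)); intros j.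
  apply (nle_sum (fun k n m => a i j k * mono X Y Z i j k n m)); intros k.
  unfold absmono; rewrite !Rmult_assoc; apply nle_scal.
  rewrite <- Rmult_assoc; unfold mono; repeat apply nle_gmul; apply nle_pow; auto.
Qed.

Lemma subN_diff a X Y Z N N' : (N <= N')%nat ->
  (subN a X Y Z N' - subN a X Y Z N)%S = subN (fun i j k => if low N i j k then 0 else a i j k) X Y Z N'.
Proof.
  intros L; fps_ext; unfold sub2, sersub, subN.
  rewrite <- (tri_high _ N N' L); apply tri_ext; intros i j k; destruct (low N i j k); ring.
Qed.

Lemma nle_subN_diff a X Y Z r N N' : nle w X r -> nle w Y r -> nle w Z r -> (N <= N')%nat ->
  nle w (subN a X Y Z N' - subN a X Y Z N)%S (tri (absmono a r) N' - tri (absmono a r) N).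
Proof.
  intros HX HY HZ L; rewrite subN_diff by auto; rewrite <- (tri_high _ N N' L).
  rewrite (tri_ext _ (absmono (fun i j k => if low N i j k then 0 else a i j k) r)).
  - apply nle_subN; auto.
  - intros i j k; unfold absmono; destruct (low N i j k); [rewrite Rabs_R0; ring|reflexivity].
Qed.

Lemma is_lim_seq_sum (u : nat -> nat -> R) (l : nat -> R) N :
  (forall n, is_lim_seq (u n) (l n)) -> is_lim_seq (fun K => sum_f_R0 (fun n => u n K) N) (sum_f_R0 l N).
Proof.
  intros H; induction N as [|N IH]; simpl; [apply H|].
  apply (is_lim_seq_plus' _ _ _ _ IH (H (S N))).
Qed.

Section Bounded.
Variables (a : nat -> nat -> nat -> R) (X Y Z : fps2) (r M : R).
Hypothesis HX : nle w X r.
Hypothesis HY : nle w Y r.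
Hypothesis HZ : nle w Z r.
Hypothesis HM : forall N, tri (absmono a r) N <= M.

Lemma absmono_nonneg i j k : 0 <= absmono a r i j k.
Proof.
  assert (0 <= r) by (apply (nle_ge0 w (gw_nonneg _ Hw)) with X; auto).
  unfold absmono; repeat apply Rmult_le_pos; try apply pow_le; auto using Rabs_pos.
Qed.

Lemma tri_absmono_lim : exists T, is_lim_seq (tri (absmono a r)) (Finite T) /\ T <= M /\ forall N, tri (absmono a r) N <= T.
Proof.
  destruct (ex_finite_lim_seq_incr (tri (absmono a r)) M) as [T HT]; auto.
  { intros n; apply tri_mono_N; [apply absmono_nonneg|lia]. }
  exists T; repeat split; auto.
  - apply (is_lim_seq_le (tri (absmono a r)) (fun _ => M) T M); auto using is_lim_seq_const.
  - intros N; apply (is_lim_seq_le_loc (fun _ => tri (absmono a r) N) (tri (absmono a r)) (tri (absmono a r) N) T);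
      auto using is_lim_seq_const.
    exists N; intros n Hn; apply tri_mono_N; auto; apply absmono_nonneg.
Qed.

(** Differences of partial sums are bounded in norm by differences of the increasing bounded sums of
    [absmono]; since the weights are positive, each coefficient is Cauchy. *)
Lemma subst_lim n m : is_lim_seq (fun N => subN a X Y Z N n m) (subst a X Y Z n m).
Proof.
  assert (E : ex_finite_lim_seq (fun N => subN a X Y Z N n m)).
  { apply ex_lim_seq_cauchy_corr; intros eps.
    destruct tri_absmono_lim as (T & HT & _ & UT).
    assert (W := gw_pos _ Hw n m).
    assert (P : 0 < eps * w n m) by (apply Rmult_lt_0_compat; [apply eps|auto]).
    destruct (proj2 (is_lim_seq_spec _ _) HT (mkposreal _ P)) as [N0 H0]; simpl in H0.
    assert (G : forall p q, (N0 <= p)%nat -> (p <= q)%nat -> Rabs (subN a X Y Z q n m - subN a X Y Z p n m) < eps).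
    { intros p q Hp Hq.
      pose proof (nle_term _ _ _ n m (gw_nonneg _ Hw) (nle_subN_diff a X Y Z r p q HX HY HZ Hq)) as D.
      specialize (H0 p Hp); apply Rabs_lt_between in H0; specialize (UT q).
      apply Rmult_lt_reg_r with (w n m); auto; unfold sub2, sersub in D; lra. }
    exists N0; intros p q Hp Hq; destruct (Nat.le_ge_cases p q).
    - rewrite Rabs_minus_sym; apply G; auto.
    - apply G; auto. }
  unfold subst; apply Lim_seq_correct' in E; exact E.
Qed.

(** Norm balls are closed under coefficientwise convergence, because a norm bound speaks of finite
    boxes only. *)
Lemma nle_subst_sub v M' K0 : (forall K, (K0 <= K)%nat -> nle w (subN a X Y Z K - v)%S M') ->
  nle w (subst a X Y Z - v)%S M'.
Proof.
  intros H N.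
  apply (is_lim_seq_le_loc (fun K => box (fun n m => Rabs ((subN a X Y Z K - v)%S n m) * w n m) N) (fun _ => M')
    (box (fun n m => Rabs ((subst a X Y Z - v)%S n m) * w n m) N) M').
  - exists K0; intros K HK; apply H; auto.
  - unfold box.
    apply (is_lim_seq_sum (fun n K => sum_f_R0 (fun m => Rabs ((subN a X Y Z K - v)%S n m) * w n m) N)); intros n.
    apply (is_lim_seq_sum (fun m K => Rabs ((subN a X Y Z K - v)%S n m) * w n m)); intros m.
    assert (L := is_lim_seq_abs _ _ (is_lim_seq_minus' _ _ _ _ (subst_lim n m) (is_lim_seq_const (v n m)))).
    exact (is_lim_seq_mult' _ _ _ _ L (is_lim_seq_const (w n m))).
  - apply is_lim_seq_const.
Qed.

Lemma nle_subst : nle w (subst a X Y Z) M.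
Proof.
  replace (subst a X Y Z) with (subst a X Y Z - zero2)%S by ring.
  apply nle_subst_sub with O; intros K _.
  replace (subN a X Y Z K - zero2)%S with (subN a X Y Z K) by ring.
  apply nle_weaken with (tri (absmono a r) K); auto; apply nle_subN; auto.
Qed.

Lemma subst_approx (eps : posreal) : exists N0, forall N, (N0 <= N)%nat -> nle w (subst a X Y Z - subN a X Y Z N)%S eps.
Proof.
  destruct tri_absmono_lim as (T & HT & _ & UT).
  destruct (proj2 (is_lim_seq_spec _ _) HT eps) as [N0 H0]; simpl in H0.
  exists N0; intros N HN; apply nle_subst_sub with N; intros K HK.
  apply nle_weaken with (tri (absmono a r) K - tri (absmono a r) N).
  - apply nle_subN_diff; auto.
  - specialize (H0 N HN); apply Rabs_lt_between in H0; specialize (UT K); lra.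
Qed.

End Bounded.

End Subst.

Lemma const2_scal c u : (const2 c * u)%S = (fun n m => c * u n m).
Proof. fps_ext; apply const2_mul. Qed.

Lemma PSeries_one x : PSeries (ser1 0 1) x = 1.
Proof.
  unfold PSeries; apply is_series_unique, is_series_sum.
  apply is_lim_seq_ext with (fun _ => 1); [|apply is_lim_seq_const].
  intros n; induction n as [|n IH]; simpl; [ring|rewrite <- IH; unfold ser0; ring].
Qed.

Lemma ev_one s t : ev one2 s t = 1.
Proof.
  unfold ev; rewrite <- (PSeries_one t); apply PSeries_ext; intros [|n]; unfold one2; simpl.
  - apply PSeries_one.
  - apply PSeries_const_0.
Qed.

Section EvSubst.
Variables R1 R2 : R.

Lemma An_one : An R1 R2 one2.
Proof.
  intros r1 r2 H1 H2; exists (Rabs 1); rewrite <- const2_1; apply nle_const; unfold pw; simpl; ring.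
Qed.

Lemma An_const c : An R1 R2 (const2 c).
Proof.
  intros r1 r2 H1 H2; exists (Rabs c); apply nle_const; unfold pw; simpl; ring.
Qed.

Lemma ev_scal c u s t : ev (fun n m => c * u n m) s t = c * ev u s t.
Proof.
  unfold ev; rewrite <- PSeries_scal; apply PSeries_ext; intros n; apply (PSeries_scal c (u n)).
Qed.

Lemma ev_const c s t : ev (const2 c) s t = c.
Proof.
  replace (const2 c) with (const2 c * one2)%S by ring.
  rewrite const2_scal, ev_scal, ev_one; ring.
Qed.

Lemma An_scal c u : An R1 R2 u -> An R1 R2 (fun n m => c * u n m).
Proof. intros Hu; rewrite <- const2_scal; apply An_mul; auto; apply An_const. Qed.

Lemma An_pow u i : An R1 R2 u -> An R1 R2 (pow2 u i).
Proof. intros Hu; induction i as [|i IH]; simpl; [apply An_one|apply An_mul; auto]. Qed.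

Lemma ev_pow u i s t : An R1 R2 u -> Rabs s < R1 -> Rabs t < R2 -> ev (pow2 u i) s t = ev u s t ^ i.
Proof.
  intros Hu Hs Ht; induction i as [|i IH]; simpl; [apply ev_one|].
  rewrite (ev_mul R1 R2), IH; auto; apply An_pow; auto.
Qed.

Lemma An_sum (u : nat -> fps2) N : (forall i, An R1 R2 (u i)) -> An R1 R2 (fun n m => sum_f_R0 (fun i => u i n m) N).
Proof.
  intros H; induction N as [|N IH]; simpl; [apply H|].
  apply (An_add R1 R2 (fun n m => sum_f_R0 (fun i => u i n m) N) (u (S N))); auto.
Qed.

Lemma ev_sum (u : nat -> fps2) N s t : (forall i, An R1 R2 (u i)) -> Rabs s < R1 -> Rabs t < R2 ->
  ev (fun n m => sum_f_R0 (fun i => u i n m) N) s t = sum_f_R0 (fun i => ev (u i) s t) N.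
Proof.
  intros H Hs Ht; induction N as [|N IH]; simpl; [reflexivity|].
  rewrite <- IH; apply (ev_add R1 R2 (fun n m => sum_f_R0 (fun i => u i n m) N) (u (S N))); auto using An_sum.
Qed.

Lemma An_subN a X Y Z N : An R1 R2 X -> An R1 R2 Y -> An R1 R2 Z -> An R1 R2 (subN a X Y Z N).
Proof.
  intros HX HY HZ; unfold subN, tri.
  apply (An_sum (fun i n m => sum_f_R0 (fun j => sum_f_R0 (fun k => a i j k * mono X Y Z i j k n m) N) N)); intros i.
  apply (An_sum (fun j n m => sum_f_R0 (fun k => a i j k * mono X Y Z i j k n m) N)); intros j.
  apply (An_sum (fun k n m => a i j k * mono X Y Z i j k n m)); intros k.
  apply An_scal; unfold mono; repeat apply An_mul; apply An_pow; auto.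
Qed.

Lemma ev_subN a X Y Z N s t : An R1 R2 X -> An R1 R2 Y -> An R1 R2 Z -> Rabs s < R1 -> Rabs t < R2 ->
  ev (subN a X Y Z N) s t = tri (fun i j k => a i j k * ev X s t ^ i * ev Y s t ^ j * ev Z s t ^ k) N.
Proof.
  intros HX HY HZ Hs Ht; unfold subN, tri.
  assert (A : forall i j k, An R1 R2 (mono X Y Z i j k)).
  { intros; unfold mono; repeat apply An_mul; apply An_pow; auto. }
  rewrite (ev_sum (fun i n m => sum_f_R0 (fun j => sum_f_R0 (fun k => a i j k * mono X Y Z i j k n m) N) N)); auto.
  2:{ intros i; apply (An_sum (fun j n m => sum_f_R0 (fun k => a i j k * mono X Y Z i j k n m) N)); intros j.
      apply (An_sum (fun k n m => a i j k * mono X Y Z i j k n m)); intros k; apply An_scal; auto. }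
  apply sum_ext; intros i _.
  rewrite (ev_sum (fun j n m => sum_f_R0 (fun k => a i j k * mono X Y Z i j k n m) N)); auto.
  2:{ intros j; apply (An_sum (fun k n m => a i j k * mono X Y Z i j k n m)); intros k; apply An_scal; auto. }
  apply sum_ext; intros j _.
  rewrite (ev_sum (fun k n m => a i j k * mono X Y Z i j k n m)); auto.
  2:{ intros k; apply An_scal; auto. }
  apply sum_ext; intros k _.
  rewrite ev_scal; unfold mono; rewrite !(ev_mul R1 R2), !ev_pow; auto using An_mul, An_pow; ring.
Qed.

End EvSubst.

(** The partial sums approach [subst] in norm, and the norm bounds values on the whole box; so
    evaluation commutes with substitution. *)
Lemma ev_subst A r0 a X Y Z r M s t : 0 < A -> 0 < r0 ->
  nle (wt A r0) X r -> nle (wt A r0) Y r -> nle (wt A r0) Z r -> (forall N, tri (absmono a r) N <= M) ->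
  Rabs s < r0 / 2 -> Rabs t < A * r0 / 2 ->
  is_lim_seq (tri (fun i j k => a i j k * ev X s t ^ i * ev Y s t ^ j * ev Z s t ^ k)) (ev (subst a X Y Z) s t).
Proof.
  intros HA Hr HX HY HZ HM Hs Ht.
  assert (Hw := wt_good A r0 HA Hr).
  assert (Har : 0 < A * r0) by nra.
  pose proof (nle_wt_An _ _ _ _ HA Hr HX) as AX.
  pose proof (nle_wt_An _ _ _ _ HA Hr HY) as AY.
  pose proof (nle_wt_An _ _ _ _ HA Hr HZ) as AZ.
  pose proof (nle_subst _ Hw _ _ _ _ _ _ HX HY HZ HM) as NS.
  pose proof (nle_wt_An _ _ _ _ HA Hr NS) as AS.
  apply is_lim_seq_spec; intros eps.
  assert (P : 0 < eps / 2) by (destruct eps; simpl; lra).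
  destruct (subst_approx _ Hw _ _ _ _ _ _ HX HY HZ HM (mkposreal _ P)) as [N0 H0].
  exists N0; intros N HN; specialize (H0 N HN); simpl in H0.
  rewrite <- (ev_subN (r0 / 2) (A * r0 / 2)); auto.
  rewrite Rabs_minus_sym, <- (ev_sub (r0 / 2) (A * r0 / 2)); auto using An_subN.
  apply Rle_lt_trans with (eps / 2); [|destruct eps; simpl in *; lra].
  apply (ev_bound (r0 / 2) (A * r0 / 2)); try lra.
  apply (nle_wt_pw A r0); auto; lra.
Qed.

(** * Semilinear first-order systems *)

(** Congruence modulo t^N, the sense in which the iteration becomes constant. *)
Definition agree (N : nat) (u v : fps2) : Prop := forall n m, (n < N)%nat -> u n m = v n m.

Lemma agree_add N u v u' v' : agree N u u' -> agree N v v' -> agree N (u + v)%S (u' + v')%S.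
Proof. intros H H' n m L; unfold add2, fadd, seradd; rewrite H, H'; auto. Qed.

Lemma agree_sub N u v u' v' : agree N u u' -> agree N v v' -> agree N (u - v)%S (u' - v')%S.
Proof. intros H H' n m L; unfold sub2, sersub; rewrite H, H'; auto. Qed.

Lemma agree_mul N u v u' v' : agree N u u' -> agree N v v' -> agree N (u * v)%S (u' * v')%S.
Proof.
  intros H H' n m L; rewrite !mul2_sum; apply sum_ext; intros j Hj; apply sum_ext; intros i Hi.
  rewrite H, H' by lia; reflexivity.
Qed.

Lemma agree_pow N u u' i : agree N u u' -> agree N (pow2 u i) (pow2 u' i).
Proof. intros H; induction i as [|i IH]; simpl; [intros n m _; reflexivity|apply agree_mul; auto]. Qed.

Lemma agree_Ds N u u' : agree N u u' -> agree N (Ds u) (Ds u').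
Proof. intros H n m L; unfold Ds; rewrite H; auto. Qed.

Lemma agree_It N u u' : agree N u u' -> agree (S N) (It u) (It u').
Proof. intros H [|n] m L; unfold It; [reflexivity|rewrite H by lia; reflexivity]. Qed.

Lemma agree_subst N a X Y Z X' Y' Z' : agree N X X' -> agree N Y Y' -> agree N Z Z' ->
  agree N (subst a X Y Z) (subst a X' Y' Z').
Proof.
  intros HX HY HZ n m L; unfold subst; f_equal; apply Lim_seq_ext; intros K.
  apply tri_ext; intros i j k; f_equal.
  unfold mono; apply (agree_mul N); auto; [apply agree_mul|]; apply agree_pow; auto.
Qed.

Section Semilinear.
Context {I : Type}.
Notation state := (I -> fps2).

(** Row n of the result depends on rows up to n only. Ring operations, [Ds] and [subst] respect
    this, and [It] gains one row. *)
Definition causal (Phi : state -> fps2) : Prop :=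
  forall N U V, (forall i, agree N (U i) (V i)) -> agree N (Phi U) (Phi V).

Definition in_ball (w : nat -> nat -> R) (u0 : I -> R) (d : R) (U : state) : Prop :=
  forall i, nle w (U i - const2 (u0 i))%S d.

Definition emb (a : fps) : fps2 := fun n m => match n with O => a m | _ => 0 end.

Section Picard.
Variables (a : I -> fps) (L G : I -> state -> fps2).
Hypothesis L_causal : forall i, causal (L i).
Hypothesis G_causal : forall i, causal (G i).

Definition step (U : state) : state :=
  fun i => (emb (a i) + It (Ds (L i U)) + It (G i U))%S.

Fixpoint picard (N : nat) : state :=
  match N with O => fun i => emb (a i) | S N' => step (picard N') end.

(** Each row is taken from an iterate in which it is already final: iterate N no longer changes in
    the rows below N. *)
Definition sol : state := fun i n m => picard (S n) i n m.

Lemma step_agree N U V : (forall i, agree N (U i) (V i)) -> forall i, agree (S N) (step U i) (step V i).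
Proof.
  intros H i; unfold step; apply agree_add; [apply agree_add|].
  - intros n m _; reflexivity.
  - apply agree_It, agree_Ds, L_causal, H.
  - apply agree_It, G_causal, H.
Qed.

Lemma picard_agree N k i : agree N (picard N i) (picard (k + N) i).
Proof.
  revert i; induction N as [|N IH]; intros i; [intros n m L0; lia|].
  rewrite <- plus_n_Sm; apply step_agree, IH.
Qed.

Lemma sol_agree N i : agree N (sol i) (picard N i).
Proof.
  intros n m Ln; unfold sol.
  replace N with ((N - S n) + S n)%nat by lia; apply picard_agree; lia.
Qed.

Lemma sol_fixpoint i : sol i = step sol i.
Proof.
  fps_ext; symmetry; apply (step_agree n sol (picard n)); [|lia].
  intros j; apply sol_agree.
Qed.

End Picard.

Lemma nle_emb A r f c : 0 < A -> 0 < r -> (forall N, sum_f_R0 (fun m => Rabs (f m) * r ^ m) N <= c) ->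
  nle (wt A r) (emb f) c.
Proof.
  intros HA Hr Hc N; unfold box.
  apply Rle_trans with (2 := Hc N).
  assert (E : forall n, sum_f_R0 (fun m => Rabs (emb f n m) * wt A r n m) N =
     match n with O => sum_f_R0 (fun m => Rabs (f m) * r ^ m) N | _ => 0 end).
  { intros [|n].
    - apply sum_ext; intros m _; unfold wt; simpl; field.
    - rewrite (sum_ext _ (fun _ => 0 * 0)); [rewrite sum_scal_l; ring|].
      intros; simpl; rewrite Rabs_R0; ring. }
  rewrite (sum_ext _ _ N (fun n _ => E n)).
  generalize (sum_f_R0 (fun m => Rabs (f m) * r ^ m) N); clear.
  intros x; induction N as [|N IH]; simpl in *; lra.
Qed.

(** The bound [K] is uniform in the weight, hence available before [A] and [r] are fixed. They are
    then chosen to make a ball invariant under [step], and the stationary limit inherits the bound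
    box by box. *)
Theorem semilinear_Cauchy_Kovalevskaya (a : I -> fps) (L G : I -> state -> fps2) (R0 M K d rmax : R) :
  0 < R0 -> 0 < d -> 0 < rmax ->
  (forall i N, sum_f_R0 (fun m => Rabs (a i m) * R0 ^ m) N <= M) ->
  (forall i, causal (L i)) -> (forall i, causal (G i)) ->
  (forall w U, good_weight w -> in_ball w (fun i => a i O) d U ->
     forall i, nle w (L i U) K /\ nle w (G i U) K) ->
  exists A r U, 0 < A /\ 0 < r < rmax /\ in_ball (wt A r) (fun i => a i O) d U /\
    forall i, U i = (emb (a i) + It (Ds (L i U)) + It (G i U))%S.
Proof.
  intros HR Hd Hrm HM HL HG HK.
  (* Positive versions of the bounds, by which one may divide. *)
  set (M1 := Rmax M 0 + 1).
  assert (HM1 : M <= M1) by (unfold M1; pose proof (Rmax_l M 0); lra).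
  assert (HM0 : 0 < M1) by (unfold M1; pose proof (Rmax_r M 0); lra).
  set (K1 := Rmax K 0 + 1).
  assert (HK1 : K <= K1) by (unfold K1; pose proof (Rmax_l K 0); lra).
  assert (HK0 : 0 < K1) by (unfold K1; pose proof (Rmax_r K 0); lra).
  assert (q1 : 0 < 1 / R0) by (apply Rdiv_lt_0_compat; lra).
  assert (q2 : 0 < d / (2 * M1)) by (apply Rdiv_lt_0_compat; lra).
  assert (q3 : 0 < rmax / (2 * R0)) by (apply Rdiv_lt_0_compat; lra).
  (* With [r = th * R0], the four demands give [r <= 1], [th <= 1], norm at most d/2 for the
     non-constant part of the data, and [r <= rmax / 2]. *)
  destruct (common_lower_bound (1 / R0) 1) as (x1 & ? & ? & ?); [auto|lra|].
  destruct (common_lower_bound x1 (d / (2 * M1))) as (x2 & ? & ? & th3); auto.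
  destruct (common_lower_bound x2 (rmax / (2 * R0))) as (th & Hth & ? & th4); auto.
  assert (th1 : th <= 1 / R0) by lra; assert (th2 : th <= 1) by lra; assert (th3' : th <= d / (2 * M1)) by lra.
  set (r := th * R0).
  assert (Hr : 0 < r) by (unfold r; nra).
  assert (Hr1 : r <= 1).
  { unfold r; apply Rmult_le_compat_r with (r := R0) in th1; [|lra].
    unfold Rdiv in th1; rewrite Rmult_assoc, Rinv_l in th1; lra. }
  assert (Hr2 : r < rmax).
  { unfold r; apply Rmult_le_compat_r with (r := R0) in th4; [|lra].
    replace (rmax / (2 * R0) * R0) with (rmax / 2) in th4 by (field; lra); lra. }
  assert (Hthd : th * M1 <= d / 2).
  { apply Rmult_le_compat_r with (r := M1) in th3'; [|lra].
    replace (d / (2 * M1) * M1) with (d / 2) in th3' by (field; lra); lra. }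
  (* The differentiated term now contributes A K1 = d/4 and, as r <= 1, the other integral at most
     d/4; with d/2 from the data the total is d. *)
  set (A := d / (4 * K1)).
  assert (HA : 0 < A) by (unfold A; apply Rdiv_lt_0_compat; lra).
  assert (HAK : A * K1 = d / 4) by (unfold A; field; lra).
  clearbody A.
  assert (Hw := wt_good A r HA Hr).
  assert (E0 : forall i, nle (wt A r) (emb (a i) - const2 (a i O))%S (d / 2)).
  { intros i.
    (* Without the constant term only positive powers of [th] occur, so one factor [th] can be
       extracted. *)
    replace (emb (a i) - const2 (a i O))%S with (emb (fun m => match m with O => 0 | _ => a i m end)).
    2:{ fps_ext; unfold sub2, sersub, emb, const2; destruct n, m; ring. }
    apply nle_emb; auto; intros N; apply Rle_trans with (th * M1); auto.
    apply Rle_trans with (th * sum_f_R0 (fun m => Rabs (a i m) * R0 ^ m) N).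
    - rewrite <- sum_scal_l; apply sum_le; intros [|m] _.
      + rewrite Rabs_R0; simpl; pose proof (Rabs_pos (a i O)); nra.
      + unfold r; rewrite Rpow_mult_distr.
        pose proof (Rabs_pos (a i (S m))); pose proof (pow_lt R0 (S m) HR).
        assert (th ^ S m <= th).
        { simpl; assert (th ^ m <= 1) by (rewrite <- (pow1 m); apply pow_incr; lra).
          pose proof (pow_lt th m Hth); nra. }
        assert (0 <= Rabs (a i (S m)) * R0 ^ S m) by nra.
        nra.
    - apply Rmult_le_compat_l; [lra|]; eapply Rle_trans; [apply HM|auto]. }
  assert (Hstep : forall U, in_ball (wt A r) (fun i => a i O) d U -> in_ball (wt A r) (fun i => a i O) d (step a L G U)).
  { intros U HU i; destruct (HK _ _ Hw HU i) as [HLi HGi].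
    unfold step.
    replace (emb (a i) + It (Ds (L i U)) + It (G i U) - const2 (a i O))%S
      with ((emb (a i) - const2 (a i O)) + It (Ds (L i U)) + It (G i U))%S by ring.
    apply nle_weaken with (d / 2 + A * K1 + A * r * K1).
    - apply nle_add; [apply gw_nonneg; auto| |].
      + apply nle_add; [apply gw_nonneg; auto|auto|].
        apply nle_It_Ds; auto; eapply nle_weaken; eauto.
      + apply nle_It; auto; eapply nle_weaken; eauto.
    - nra. }
  assert (HP : forall N, in_ball (wt A r) (fun i => a i O) d (picard a L G N)).
  { induction N as [|N IH]; [|apply Hstep, IH].
    intros i; apply nle_weaken with (d / 2); [apply E0|lra]. }
  exists A, r, (sol a L G); repeat split; auto.
  (* Only rows up to N enter this box, and there [sol] coincides with iterate N + 1. *)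
  - intros i N; eapply Rle_trans; [|apply (HP (S N) i N)].
    apply box_le; intros n m Hn _; apply Req_le; f_equal; f_equal.
    unfold sub2, sersub; f_equal; apply sol_agree; auto; lia.
  - intros i; apply (sol_fixpoint a L G HL HG).
Qed.

(* [d] is uniform in the weight [w]: the parameters [A] and [r] of [wt] are only chosen afterwards. *)
Definition tame (u0 : I -> R) (Phi : state -> fps2) (c : R) : Prop :=
  causal Phi /\
  forall e, 0 < e -> exists d, 0 < d /\ forall w U, good_weight w -> in_ball w u0 d U ->
    nle w (Phi U - const2 c)%S e.

Variable u0 : I -> R.

Lemma in_ball_le w d d' U : in_ball w u0 d U -> d <= d' -> in_ball w u0 d' U.
Proof. intros H L i; eapply nle_weaken; eauto. Qed.

Lemma tame_proj i : tame u0 (fun U => U i) (u0 i).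
Proof.
  split; [intros N U V H; apply H|].
  intros e He; exists e; split; auto; intros w U _ H; apply H.
Qed.

Lemma nle_zero w : good_weight w -> nle w zero2 0.
Proof.
  intros Hw N; rewrite <- (Rmult_0_l (box (fun _ _ => 0) N)), <- box_scal; apply box_le; intros n m _ _.
  unfold zero2, ser0; rewrite Rabs_R0; lra.
Qed.

Lemma tame_const c : tame u0 (fun _ => const2 c) c.
Proof.
  split; [intros N U V _ n m _; reflexivity|].
  intros e He; exists 1; split; [lra|]; intros w U Hw _.
  replace (const2 c - const2 c)%S with zero2 by ring.
  apply nle_weaken with 0; [apply nle_zero; auto|lra].
Qed.

Lemma const2_sub c d : const2 (c - d) = (const2 c - const2 d)%S.
Proof. fps_ext; unfold const2, sub2, sersub; destruct n, m; ring. Qed.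

Lemma const2_mulc c d : const2 (c * d) = (const2 c * const2 d)%S.
Proof. rewrite const2_scal; fps_ext; unfold const2; destruct n, m; ring. Qed.

Lemma const2_add c d : const2 (c + d) = (const2 c + const2 d)%S.
Proof. fps_ext; unfold const2, add2, fadd, seradd; destruct n, m; ring. Qed.

Lemma tame_add Phi Psi c d : tame u0 Phi c -> tame u0 Psi d -> tame u0 (fun U => Phi U + Psi U)%S (c + d).
Proof.
  intros [C1 H1] [C2 H2]; split; [intros N U V H; apply agree_add; auto|].
  intros e He; destruct (H1 (e / 2)) as (d1 & P1 & B1); [lra|]; destruct (H2 (e / 2)) as (d2 & P2 & B2); [lra|].
  exists (Rmin d1 d2); split; [apply Rmin_glb_lt; auto|]; intros w U Hw HU.
  rewrite const2_add.
  replace (Phi U + Psi U - (const2 c + const2 d))%S with ((Phi U - const2 c) + (Psi U - const2 d))%S by ring.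
  replace e with (e / 2 + e / 2) by field.
  apply nle_add; [apply gw_nonneg; auto|apply B1|apply B2]; auto; eapply in_ball_le; eauto using Rmin_l, Rmin_r.
Qed.

Lemma tame_sub Phi Psi c d : tame u0 Phi c -> tame u0 Psi d -> tame u0 (fun U => Phi U - Psi U)%S (c - d).
Proof.
  intros [C1 H1] [C2 H2]; split; [intros N U V H; apply agree_sub; auto|].
  intros e He; destruct (H1 (e / 2)) as (d1 & P1 & B1); [lra|]; destruct (H2 (e / 2)) as (d2 & P2 & B2); [lra|].
  exists (Rmin d1 d2); split; [apply Rmin_glb_lt; auto|]; intros w U Hw HU.
  rewrite const2_sub.
  replace (Phi U - Psi U - (const2 c - const2 d))%S with ((Phi U - const2 c) - (Psi U - const2 d))%S by ring.
  replace e with (e / 2 + e / 2) by field.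
  apply nle_sub; [apply gw_nonneg; auto|apply B1|apply B2]; auto; eapply in_ball_le; eauto using Rmin_l, Rmin_r.
Qed.

Lemma tame_mul Phi Psi c d : tame u0 Phi c -> tame u0 Psi d -> tame u0 (fun U => Phi U * Psi U)%S (c * d).
Proof.
  intros [C1 H1] [C2 H2]; split; [intros N U V H; apply agree_mul; auto|].
  intros e He.
  (* If both factors are within e1 <= 1 of their constants, the error e1^2 + |c| e1 + e1 |d| is at
     most e1 q. *)
  set (q := 1 + Rabs c + Rabs d).
  pose proof (Rabs_pos c); pose proof (Rabs_pos d).
  assert (Hq : 0 < q) by (unfold q; lra).
  set (e1 := Rmin 1 (e / q)).
  assert (He1 : 0 < e1) by (unfold e1; apply Rmin_glb_lt; [lra|apply Rdiv_lt_0_compat; auto]).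
  assert (E1 : e1 <= 1) by apply Rmin_l.
  assert (E2 : e1 * q <= e).
  { apply Rle_trans with (e / q * q); [apply Rmult_le_compat_r; [lra|apply Rmin_r]|].
    apply Req_le; field; lra. }
  destruct (H1 e1) as (d1 & P1 & B1); auto; destruct (H2 e1) as (d2 & P2 & B2); auto.
  exists (Rmin d1 d2); split; [apply Rmin_glb_lt; auto|]; intros w U Hw HU.
  rewrite const2_mulc.
  replace (Phi U * Psi U - const2 c * const2 d)%S with
    ((Phi U - const2 c) * (Psi U - const2 d) + const2 c * (Psi U - const2 d) + (Phi U - const2 c) * const2 d)%S by ring.
  assert (X1 : nle w (Phi U - const2 c)%S e1) by (apply B1; auto; eapply in_ball_le; eauto using Rmin_l).
  assert (X2 : nle w (Psi U - const2 d)%S e1) by (apply B2; auto; eapply in_ball_le; eauto using Rmin_r).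
  assert (W1 := gw_one _ Hw).
  apply nle_weaken with (e1 * e1 + Rabs c * e1 + e1 * Rabs d).
  - repeat (apply nle_add; [apply gw_nonneg; auto| |]); apply nle_gmul; auto; apply nle_const; auto.
  - unfold q in E2; nra.
Qed.

(** Shrinking the radius from [r0] to [th * r0] multiplies every term of positive degree by at most
    [th], so the deviation from the constant term is at most [th * M]. *)
Lemma tame_subst a r0 M Phi1 Phi2 Phi3 c1 c2 c3 : 0 < r0 -> (forall N, tri (absmono a r0) N <= M) ->
  tame u0 Phi1 c1 -> tame u0 Phi2 c2 -> tame u0 Phi3 c3 ->
  tame u0 (fun U => subst a (Phi1 U - const2 c1)%S (Phi2 U - const2 c2)%S (Phi3 U - const2 c3)%S) (a O O O).
Proof.
  intros Hr HM [C1 H1] [C2 H2] [C3 H3]; split.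
  { intros N U V H; apply agree_subst; apply agree_sub; auto; intros n m _; reflexivity. }
  intros e He.
  assert (M0 : 0 <= M).
  { eapply Rle_trans; [|apply (HM O)]; apply tri_nonneg; intros; unfold absmono.
    repeat apply Rmult_le_pos; try apply pow_le; auto using Rabs_pos; lra. }
  set (th := Rmin 1 (e / (M + 1))).
  assert (Hth : 0 < th) by (unfold th; apply Rmin_glb_lt; [lra|apply Rdiv_lt_0_compat; lra]).
  assert (th1 : th <= 1) by apply Rmin_l.
  assert (th2 : th * (M + 1) <= e).
  { apply Rle_trans with (e / (M + 1) * (M + 1)); [apply Rmult_le_compat_r; [lra|apply Rmin_r]|].
    apply Req_le; field; lra. }
  clearbody th.
  set (r := th * r0).
  assert (Hr' : 0 < r) by (unfold r; nra).
  destruct (H1 r) as (d1 & P1 & B1); auto; destruct (H2 r) as (d2 & P2 & B2); auto;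
  destruct (H3 r) as (d3 & P3 & B3); auto.
  exists (Rmin d1 (Rmin d2 d3)); split; [repeat apply Rmin_glb_lt; auto|]; intros w U Hw HU.
  assert (X1 : nle w (Phi1 U - const2 c1)%S r) by (apply B1; auto; eapply in_ball_le; eauto using Rmin_l).
  assert (X2 : nle w (Phi2 U - const2 c2)%S r).
  { apply B2; auto; eapply in_ball_le; eauto; eapply Rle_trans; [apply Rmin_r|apply Rmin_l]. }
  assert (X3 : nle w (Phi3 U - const2 c3)%S r).
  { apply B3; auto; eapply in_ball_le; eauto; eapply Rle_trans; [apply Rmin_r|apply Rmin_r]. }
  assert (Hle : forall i j k, absmono a r i j k <= absmono a r0 i j k).
  { intros i j k; unfold absmono.
    assert (Q : forall i, 0 <= r ^ i <= r0 ^ i).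
    { intros l; split; [apply pow_le; lra|apply pow_incr; unfold r; nra]. }
    destruct (Q i), (Q j), (Q k); pose proof (Rabs_pos (a i j k)).
    assert (0 <= Rabs (a i j k) * r ^ i) by (apply Rmult_le_pos; auto).
    assert (0 <= Rabs (a i j k) * r ^ i * r ^ j) by (apply Rmult_le_pos; auto).
    apply Rmult_le_compat; auto; apply Rmult_le_compat; auto; apply Rmult_le_compat; auto; lra. }
  apply (nle_subst_sub w Hw a _ _ _ r M X1 X2 X3) with O.
  { intros N; eapply Rle_trans; [apply tri_le, Hle|apply HM]. }
  intros N _.
  (* The series without its constant term: subtracting that constant is then again a
     substitution. *)
  set (a' := fun i j k => match i, j, k with O, O, O => 0 | _, _, _ => a i j k end).
  set (X := (Phi1 U - const2 c1)%S) in *; set (Y := (Phi2 U - const2 c2)%S) in *; set (Z := (Phi3 U - const2 c3)%S) in *.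
  replace (subN a X Y Z N - const2 (a O O O))%S with (subN a' X Y Z N).
  - apply nle_weaken with (tri (absmono a' r) N); [apply nle_subN; auto|].
    apply Rle_trans with (tri (fun i j k => th * absmono a r0 i j k) N).
    + apply tri_le; intros i j k.
      assert (T : forall l, 0 <= th ^ l <= 1).
      { intros l; split; [apply pow_le; lra|rewrite <- (pow1 l); apply pow_incr; lra]. }
      assert (T' : forall l, 0 <= th ^ (S l) <= th).
      { intros l; simpl; destruct (T l); nra. }
      assert (Q : (i = O /\ j = O /\ k = O) \/ th ^ i * th ^ j * th ^ k <= th).
      { destruct (T i), (T j), (T k).
        destruct i as [|i]; [destruct j as [|j]; [destruct k as [|k]; [left; auto|]|]|]; right.
        - destruct (T' k); simpl in *; lra.
        - destruct (T' j). change (th ^ 0) with 1. nra.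
        - destruct (T' i). assert (0 <= th ^ S i * th ^ j <= th) by nra; nra. }
      assert (P : 0 <= absmono a r0 i j k).
      { unfold absmono; repeat apply Rmult_le_pos; try apply pow_le; auto using Rabs_pos; lra. }
      destruct Q as [(-> & -> & ->)|Q].
      * unfold absmono at 1; simpl; rewrite Rabs_R0; nra.
      * apply Rle_trans with (absmono a r i j k).
        -- unfold absmono, a'; destruct i, j, k; try lra.
           rewrite Rabs_R0; simpl; pose proof (Rabs_pos (a O O O)); lra.
        -- replace (absmono a r i j k) with (th ^ i * th ^ j * th ^ k * absmono a r0 i j k).
           ++ apply Rmult_le_compat_r; auto.
           ++ unfold absmono, r; rewrite !Rpow_mult_distr; ring.
    + rewrite tri_scal; apply Rle_trans with (th * M); [apply Rmult_le_compat_l; [lra|apply HM]|nra].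
  - fps_ext; unfold sub2, sersub, subN.
    assert (E : tri (fun i j k => (if low O i j k then a i j k * mono X Y Z i j k n m else 0)) N = const2 (a O O O) n m).
    { rewrite (tri_cut (fun i j k => a i j k * mono X Y Z i j k n m) O N) by lia.
      unfold tri; simpl; unfold mono; simpl.
      replace (one2 * one2 * one2)%S with one2 by ring.
      rewrite <- const2_1; unfold const2; destruct n, m; ring. }
    rewrite <- E.
    apply (Rplus_eq_reg_r (tri (fun i j k => if low O i j k then a i j k * mono X Y Z i j k n m else 0) N)).
    rewrite <- tri_plus; ring_simplify; apply tri_ext; intros i j k.
    unfold low, a'; destruct i, j, k; simpl; ring.
Qed.

Lemma tame_bounded Phi c : tame u0 Phi c -> exists d, 0 < d /\ forall w U, good_weight w -> in_ball w u0 d U ->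
  nle w (Phi U) (1 + Rabs c).
Proof.
  intros [_ H]; destruct (H 1) as (d & Hd & B); [lra|]; exists d; split; auto; intros w U Hw HU.
  replace (Phi U) with ((Phi U - const2 c) + const2 c)%S by ring.
  apply nle_add; [apply gw_nonneg; auto|apply B; auto|apply nle_const, gw_one, Hw].
Qed.

End Semilinear.

(** * Local solutions of the Bjoerling problem *)

(* The expansion of [1 / (l + x)] in powers of [x], as a series in three variables. *)
Definition ainv (l : R) (i j k : nat) : R :=
  match j, k with O, O => (- / l) ^ i * / l | _, _ => 0 end.

Lemma tri_line x N : (forall i j k, (j <> O \/ k <> O) -> x i j k = 0) ->
  tri x N = sum_f_R0 (fun i => x i O O) N.
Proof.
  intros H; unfold tri; apply sum_ext; intros i _.
  assert (Z : forall f N, (forall n, n <> O -> f n = 0) -> sum_f_R0 f N = f O).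
  { clear; intros f N Hf; induction N as [|N IH]; simpl; [reflexivity|]. rewrite IH, (Hf (S N)); auto; ring. }
  rewrite Z; [apply Z; intros; apply H; auto|].
  intros j Hj; rewrite Z; intros; apply H; auto.
Qed.

Lemma geom_sum q N : q <> 1 -> sum_f_R0 (fun i => q ^ i) N = (1 - q ^ S N) / (1 - q).
Proof. intros; apply tech3; auto. Qed.

(** At half the radius of convergence the absolute values are geometric with first term 1/l and
    ratio 1/2. *)
Lemma ainv_bound l N : 0 < l -> tri (absmono (ainv l) (l / 2)) N <= 2 / l.
Proof.
  intros Hl; rewrite tri_line.
  - rewrite (sum_ext _ (fun i => / l * (1 / 2) ^ i)).
    + rewrite sum_scal_l, geom_sum by lra.
      assert (P := pow_lt (1 / 2) (S N)). assert (0 < / l) by (apply Rinv_0_lt_compat; auto).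
      replace (2 / l) with (/ l * 2) by (field; lra).
      apply Rmult_le_compat_l; lra.
    + intros i _; unfold absmono, ainv; simpl.
      rewrite Rabs_mult, <- RPow_abs, Rabs_Ropp, (Rabs_pos_eq (/ l)) by (apply Rlt_le, Rinv_0_lt_compat; auto).
      replace (1 / 2) with (/ l * (l / 2)) by (field; lra).
      rewrite Rpow_mult_distr; ring.
  - intros i j k Hjk; unfold absmono, ainv; destruct j, k; try (rewrite Rabs_R0; ring); destruct Hjk; congruence.
Qed.

Lemma ainv_lim l x : 0 < l -> Rabs x <= l / 2 ->
  is_lim_seq (tri (fun i j k => ainv l i j k * x ^ i * 0 ^ j * 0 ^ k)) (/ (l + x)).
Proof.
  intros Hl Hx.
  assert (Q : Rabs (- x / l) < 1).
  { unfold Rdiv; rewrite Rabs_mult, Rabs_Ropp, (Rabs_pos_eq (/ l)) by (apply Rlt_le, Rinv_0_lt_compat; auto).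
    apply Rmult_lt_reg_r with l; auto; rewrite Rmult_assoc, Rinv_l; lra. }
  assert (Q1 : - x / l <> 1) by (intros E; rewrite E, Rabs_R1 in Q; lra).
  assert (lx : l + x <> 0) by (apply Rabs_le_between in Hx; lra).
  (* Closed form of the geometric partial sums; the remainder is a multiple of (-x/l)^N. *)
  apply is_lim_seq_ext with (fun N => / (l + x) - (- x / l) * / (l + x) * (- x / l) ^ N).
  - intros N; rewrite tri_line.
    + rewrite (sum_ext _ (fun i => / l * (- x / l) ^ i)).
      * rewrite sum_scal_l, geom_sum by auto; simpl; field; repeat split; try lra.
      * intros i _; unfold ainv; simpl.
        replace (- x / l) with (- / l * x) by (field; lra); rewrite Rpow_mult_distr; ring.
    + intros i j k [Hj|Hk]; unfold ainv; destruct j, k; try congruence; simpl; ring.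
  - replace (Finite (/ (l + x))) with (Finite (/ (l + x) - (- x / l) * / (l + x) * 0)) by (f_equal; ring).
    apply (is_lim_seq_minus' _ _ _ _ (is_lim_seq_const _)).
    apply (is_lim_seq_mult' _ _ _ _ (is_lim_seq_const _)).
    apply is_lim_seq_geom; auto.
Qed.

(** The equations determine row n+1 of each series from row n of the other, so zero data propagate
    by a purely formal induction. *)
Lemma Cauchy_Riemann_zero (a b : fps2) : Dt a = Ds b -> Dt b = (- Ds a)%S ->
  (forall m, a O m = 0) -> (forall m, b O m = 0) -> forall n m, a n m = 0 /\ b n m = 0.
Proof.
  intros Ha Hb A0 B0 n; induction n as [|n IH]; intros m; [auto|].
  assert (S0 : INR (S n) <> 0) by (apply not_0_INR; lia).
  assert (E1 : Dt a n m = 0) by (rewrite Ha; unfold Ds; rewrite (proj2 (IH (S m))); ring).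
  assert (E2 : Dt b n m = 0) by (rewrite Hb; unfold opp2, seropp, Ds; rewrite (proj1 (IH (S m))); ring).
  unfold Dt in E1, E2; split.
  - apply Rmult_integral in E1; destruct E1; auto; contradiction.
  - apply Rmult_integral in E2; destruct E2; auto; contradiction.
Qed.

(** * The first-order system for psi_s and psi_t *)

Inductive coord := Cp1 | Cp2 | Cp3 | Cq1 | Cq2 | Cq3.

Notation state := (coord -> fps2).

Definition sDot (U : state) : fps2 := (U Cp1 * U Cp1 + U Cp2 * U Cp2 + U Cp3 * U Cp3)%S.
Definition sX1 (U : state) : fps2 := (U Cp2 * U Cq3 - U Cp3 * U Cq2)%S.
Definition sX2 (U : state) : fps2 := (U Cp3 * U Cq1 - U Cp1 * U Cq3)%S.
Definition sX3 (U : state) : fps2 := (U Cp1 * U Cq2 - U Cp2 * U Cq1)%S.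
(** 1/|p|^2, expanded around the initial value [l] of |p|^2. The two dummy arguments are zero,
    written as differences to match the shape of [tame_subst]. *)
Definition sInv (l : R) (U : state) : fps2 :=
  subst (ainv l) (sDot U - const2 l)%S (const2 0 - const2 0)%S (const2 0 - const2 0)%S.
Definition sN1 l U : fps2 := (sX1 U * sInv l U)%S.
Definition sN2 l U : fps2 := (sX2 U * sInv l U)%S.
Definition sN3 l U : fps2 := (sX3 U * sInv l U)%S.
(** The power series extending H, evaluated at (p x q)/|p|^2. For a general state this vector is off
    the sphere, so the value is that of the extension. *)
Definition sH a l n1 n2 n3 (U : state) : fps2 :=
  subst a (sN1 l U - const2 n1)%S (sN2 l U - const2 n2)%S (sN3 l U - const2 n3)%S.

(* [p = psi_s] and [q = psi_t] satisfy [p_t = q_s] and [q_t = - p_s + 2 H (p x q)]. *)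
Definition linpart (i : coord) (U : state) : fps2 :=
  match i with
  | Cp1 => U Cq1 | Cp2 => U Cq2 | Cp3 => U Cq3
  | Cq1 => (const2 0 - U Cp1)%S | Cq2 => (const2 0 - U Cp2)%S | Cq3 => (const2 0 - U Cp3)%S
  end.

Definition nonlin (h : state -> fps2) (i : coord) (U : state) : fps2 :=
  match i with
  | Cp1 | Cp2 | Cp3 => const2 0
  | Cq1 => (const2 2 * h U * sX1 U)%S
  | Cq2 => (const2 2 * h U * sX2 U)%S
  | Cq3 => (const2 2 * h U * sX3 U)%S
  end.

Lemma const2_0 : const2 0 = zero2.
Proof. fps_ext; destruct n, m; reflexivity. Qed.

Lemma Ds_const c : Ds (const2 c) = zero2.
Proof. fps_ext; unfold Ds, const2, zero2, ser0; destruct n; ring. Qed.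

Lemma Dt_const c : Dt (const2 c) = zero2.
Proof. fps_ext; unfold Dt, const2, zero2, ser0; ring. Qed.

Lemma Dt_emb a : Dt (emb a) = zero2.
Proof. fps_ext; unfold Dt, emb, zero2, ser0; ring. Qed.

Lemma It_zero : It zero2 = zero2.
Proof. fps_ext; unfold It, zero2, ser0; destruct n; unfold Rdiv; ring. Qed.

Lemma ev_t0 u s : ev u s 0 = PSeries (u O) s.
Proof. unfold ev; apply PSeries_0. Qed.

(** The term in [h] is a multiple of p x q and drops out of the t-derivatives of |q|^2 and <p, q>.
    Thus [h] can be any series, and conformality is available before [h] is identified with H along
    the normal. *)
Lemma formal_conformal (U : state) (h : fps2) :
  (forall m, (U Cp1 * U Cp1 + U Cp2 * U Cp2 + U Cp3 * U Cp3 - (U Cq1 * U Cq1 + U Cq2 * U Cq2 + U Cq3 * U Cq3))%S O m = 0) ->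
  (forall m, (const2 2 * (U Cp1 * U Cq1 + U Cp2 * U Cq2 + U Cp3 * U Cq3))%S O m = 0) ->
  Dt (U Cp1) = Ds (U Cq1) -> Dt (U Cp2) = Ds (U Cq2) -> Dt (U Cp3) = Ds (U Cq3) ->
  Dt (U Cq1) = (const2 2 * h * sX1 U - Ds (U Cp1))%S ->
  Dt (U Cq2) = (const2 2 * h * sX2 U - Ds (U Cp2))%S ->
  Dt (U Cq3) = (const2 2 * h * sX3 U - Ds (U Cp3))%S ->
  (U Cp1 * U Cp1 + U Cp2 * U Cp2 + U Cp3 * U Cp3 - (U Cq1 * U Cq1 + U Cq2 * U Cq2 + U Cq3 * U Cq3))%S = zero2 /\
  (const2 2 * (U Cp1 * U Cq1 + U Cp2 * U Cq2 + U Cp3 * U Cq3))%S = zero2.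
Proof.
  intros A0 B0 E1 E2 E3 F1 F2 F3.
  (* [ring] would treat [const2 2] as an unknown. *)
  assert (T : const2 2 = (one2 + one2)%S).
  { rewrite <- const2_1, <- const2_add; reflexivity. }
  set (a := (U Cp1 * U Cp1 + U Cp2 * U Cp2 + U Cp3 * U Cp3 - (U Cq1 * U Cq1 + U Cq2 * U Cq2 + U Cq3 * U Cq3))%S) in *.
  set (b := (const2 2 * (U Cp1 * U Cq1 + U Cp2 * U Cq2 + U Cp3 * U Cq3))%S) in *.
  assert (Z : forall n m, a n m = 0 /\ b n m = 0).
  { apply Cauchy_Riemann_zero; auto; unfold a, b;
    rewrite ?Dt_sub, ?Ds_sub, ?Dt_add, ?Ds_add, ?Dt_mul, ?Ds_mul, ?Dt_sub, ?Ds_sub, ?Dt_add, ?Ds_add, ?Dt_mul, ?Ds_mul,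
      ?Dt_const, ?Ds_const, E1, E2, E3, F1, F2, F3; unfold sX1, sX2, sX3; rewrite T; ring. }
  split; fps_ext; apply Z.
Qed.

Lemma ex_pseries_radius a x y : ex_pseries a y -> Rabs x < Rabs y -> Rbar_lt (Rabs x) (CV_radius a).
Proof.
  intros Hy Hxy; apply Rbar_lt_le_trans with (Finite (Rabs y)); [exact Hxy|].
  apply Rbar_not_lt_le; intros L; apply (CV_disk_outside a y L).
  apply ex_pseries_R in Hy; apply ex_series_lim_0, Hy.
Qed.

Lemma analytic_local (I : R -> Prop) f s0 : analytic_on I f -> I s0 ->
  exists a r, 0 < r /\ forall x, Rabs x < r ->
    Rbar_lt (Rabs x) (CV_radius a) /\ f (s0 + x) = PSeries a x /\
    Derive f (s0 + x) = PSeries (PS_derive a) x.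
Proof.
  intros Hf Hs; destruct (Hf s0 Hs) as (a & r & Hr & H); exists a, r; split; auto.
  assert (R : forall x, Rabs x < r -> Rbar_lt (Rabs x) (CV_radius a)).
  { intros x Hx; pose proof (Rabs_pos x).
    assert (E : Rabs ((Rabs x + r) / 2) = (Rabs x + r) / 2) by (apply Rabs_pos_eq; lra).
    apply ex_pseries_radius with ((Rabs x + r) / 2); [|lra].
    exists (f (s0 + (Rabs x + r) / 2)).
    specialize (H (s0 + (Rabs x + r) / 2)); replace (s0 + (Rabs x + r) / 2 - s0) with ((Rabs x + r) / 2) in H by ring.
    apply H; lra. }
  assert (V : forall x, Rabs x < r -> f (s0 + x) = PSeries a x).
  { intros x Hx; specialize (H (s0 + x)); replace (s0 + x - s0) with x in H by ring.
    symmetry; apply is_pseries_unique, H, Hx. }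
  intros x Hx; repeat split; auto.
  apply is_derive_unique.
  apply is_derive_ext_loc with (fun s => PSeries a (s - s0)).
  (* The box only supplies a neighbourhood of s0 + x; its second coordinate is a dummy. *)
  - assert (Hb : in_box s0 r 1 (s0 + x) 0).
    { split; [replace (s0 + x - s0) with x by ring; auto|rewrite Rabs_R0; lra]. }
    apply filter_imp with (2 := in_box_near_s s0 r 1 (s0 + x) 0 Hb).
    intros s [Hs' _]; rewrite <- V; auto; f_equal; ring.
  - assert (E : is_derive (fun s => s - s0) (s0 + x) 1) by (auto_derive; auto; ring).
    assert (D : is_derive (PSeries a) (s0 + x - s0) (PSeries (PS_derive a) x)).
    { replace (s0 + x - s0) with x by ring; apply is_derive_PSeries; auto. }
    assert (F := is_derive_comp (PSeries a) (fun s => s - s0) (s0 + x) _ _ D E).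
    unfold scal in F; simpl in F; unfold mult in F; simpl in F; rewrite Rmult_1_l in F; exact F.
Qed.

Lemma abs_sum_bound a r : 0 <= r -> Rbar_lt (Rabs r) (CV_radius a) ->
  exists M, forall N, sum_f_R0 (fun m => Rabs (a m) * r ^ m) N <= M.
Proof.
  intros Hr H; exists (Series (fun m => Rabs (a m * r ^ m))); intros N.
  rewrite (sum_ext _ (fun m => Rabs (a m * r ^ m))).
  - apply sum_le_Series; [intros; apply Rabs_pos|apply CV_disk_inside; auto].
  - intros m _; rewrite Rabs_mult, <- RPow_abs, (Rabs_pos_eq r); auto.
Qed.

Definition evV (X1 X2 X3 : fps2) (s t : R) : V3 := mkV (ev X1 s t) (ev X2 s t) (ev X3 s t).

Definition normal (p q : V3) : V3 := vscal (/ vdot p p) (vcross p q).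

(** The series are the coordinates of psi in powers of t and of the offset from [s0]; rows 0 and 1
    are then beta and B. The equation psi_ss + psi_tt = 2 H(n) psi_s x psi_t is the real form of the
    system. It mentions H itself, so that solutions built from different extensions can be
    compared. *)
Record local_sol (H : V3 -> R) (beta B : R -> V3) (s0 R1 R2 : R) (X1 X2 X3 : fps2) : Prop := {
  ls_An1 : An R1 R2 X1;
  ls_An2 : An R1 R2 X2;
  ls_An3 : An R1 R2 X3;
  ls_beta : forall s, Rabs s < R1 -> mkV (PSeries (X1 O) s) (PSeries (X2 O) s) (PSeries (X3 O) s) = beta (s0 + s);
  ls_B : forall s, Rabs s < R1 ->
    mkV (PSeries (X1 1%nat) s) (PSeries (X2 1%nat) s) (PSeries (X3 1%nat) s) = B (s0 + s);
  ls_conf : forall s t, Rabs s < R1 -> Rabs t < R2 ->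
    let p := evV (Ds X1) (Ds X2) (Ds X3) s t in
    let q := evV (Dt X1) (Dt X2) (Dt X3) s t in
    vdot p p = vdot q q /\ vdot p q = 0 /\ 0 < vdot p p;
  ls_pde : forall s t, Rabs s < R1 -> Rabs t < R2 ->
    let p := evV (Ds X1) (Ds X2) (Ds X3) s t in
    let q := evV (Dt X1) (Dt X2) (Dt X3) s t in
    evV (Dt (Dt X1)) (Dt (Dt X2)) (Dt (Dt X3)) s t =
    vadd (vscal (-1) (evV (Ds (Ds X1)) (Ds (Ds X2)) (Ds (Ds X3)) s t))
      (vscal (2 * H (normal p q)) (vcross p q)) }.

(** Lagrange's identity |p x q|^2 + <p, q>^2 = |p|^2 |q|^2. *)
Lemma cross_sq p q : vdot p p = vdot q q -> vdot p q = 0 ->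
  vdot (vcross p q) (vcross p q) = vdot p p * vdot p p.
Proof.
  intros E F; rewrite E at 2.
  replace (vdot p p * vdot q q) with (vdot (vcross p q) (vcross p q) + vdot p q * vdot p q)
    by (unfold vdot, vcross, mkV, vx, vy, vz; simpl; ring).
  rewrite F; ring.
Qed.

Lemma normal_on_sphere p q : vdot p p = vdot q q -> vdot p q = 0 -> 0 < vdot p p -> on_sphere (normal p q).
Proof.
  intros E F P; unfold on_sphere, normal.
  replace (vdot (vscal (/ vdot p p) (vcross p q)) (vscal (/ vdot p p) (vcross p q)))
    with (/ vdot p p * / vdot p p * vdot (vcross p q) (vcross p q))
    by (unfold vdot, vscal, mkV, vx, vy, vz; simpl; ring).
  rewrite cross_sq by auto; field; lra.
Qed.

Lemma coord_uniform (P : coord -> R -> Prop) :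
  (forall i, exists d, 0 < d /\ P i d) -> (forall i d d', P i d -> 0 < d' <= d -> P i d') ->
  exists d, 0 < d /\ forall i, P i d.
Proof.
  intros H Hm.
  destruct (H Cp1) as (d1 & D1 & E1), (H Cp2) as (d2 & D2 & E2), (H Cp3) as (d3 & D3 & E3),
    (H Cq1) as (d4 & D4 & E4), (H Cq2) as (d5 & D5 & E5), (H Cq3) as (d6 & D6 & E6).
  destruct (common_lower_bound d1 d2) as (x1 & ? & ? & ?); auto.
  destruct (common_lower_bound x1 d3) as (x2 & ? & ? & ?); auto.
  destruct (common_lower_bound x2 d4) as (x3 & ? & ? & ?); auto.
  destruct (common_lower_bound x3 d5) as (x4 & ? & ? & ?); auto.
  destruct (common_lower_bound x4 d6) as (d & ? & ? & ?); auto.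
  exists d; split; auto; intros []; eapply Hm; eauto; split; auto; lra.
Qed.

Section TameMaps.
Variable u0 : coord -> R.
Notation tame := (tame u0).

Definition cDot := u0 Cp1 * u0 Cp1 + u0 Cp2 * u0 Cp2 + u0 Cp3 * u0 Cp3.
Definition cX1 := u0 Cp2 * u0 Cq3 - u0 Cp3 * u0 Cq2.
Definition cX2 := u0 Cp3 * u0 Cq1 - u0 Cp1 * u0 Cq3.
Definition cX3 := u0 Cp1 * u0 Cq2 - u0 Cp2 * u0 Cq1.

Lemma tame_eq Phi c c' : c = c' -> tame Phi c -> tame Phi c'.
Proof. intros ->; auto. Qed.

Lemma tame_sDot : tame sDot cDot.
Proof. unfold sDot, cDot; repeat apply tame_add; apply tame_mul; apply tame_proj. Qed.
Lemma tame_sX1 : tame sX1 cX1.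
Proof. unfold sX1, cX1; apply tame_sub; apply tame_mul; apply tame_proj. Qed.
Lemma tame_sX2 : tame sX2 cX2.
Proof. unfold sX2, cX2; apply tame_sub; apply tame_mul; apply tame_proj. Qed.
Lemma tame_sX3 : tame sX3 cX3.
Proof. unfold sX3, cX3; apply tame_sub; apply tame_mul; apply tame_proj. Qed.

Lemma tame_sInv : 0 < cDot -> tame (sInv cDot) (/ cDot).
Proof.
  intros Hl; apply tame_eq with (ainv cDot O O O); [unfold ainv; simpl; ring|].
  apply (tame_subst u0 (ainv cDot) (cDot / 2) (2 / cDot) sDot (fun _ => const2 0) (fun _ => const2 0) cDot 0 0);
    [lra| |apply tame_sDot|apply tame_const|apply tame_const].
  intros N; apply ainv_bound; auto.
Qed.

Lemma tame_sN1 : 0 < cDot -> tame (sN1 cDot) (cX1 * / cDot).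
Proof. intros; apply tame_mul; [apply tame_sX1|apply tame_sInv; auto]. Qed.
Lemma tame_sN2 : 0 < cDot -> tame (sN2 cDot) (cX2 * / cDot).
Proof. intros; apply tame_mul; [apply tame_sX2|apply tame_sInv; auto]. Qed.
Lemma tame_sN3 : 0 < cDot -> tame (sN3 cDot) (cX3 * / cDot).
Proof. intros; apply tame_mul; [apply tame_sX3|apply tame_sInv; auto]. Qed.

Lemma tame_sH a r M : 0 < cDot -> 0 < r -> (forall N, tri (absmono a r) N <= M) ->
  tame (sH a cDot (cX1 * / cDot) (cX2 * / cDot) (cX3 * / cDot)) (a O O O).
Proof.
  intros Hl Hr HM; apply (tame_subst u0 a r M); auto using tame_sN1, tame_sN2, tame_sN3.
Qed.

Lemma tame_linpart i : exists c, tame (linpart i) c.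
Proof.
  destruct i; eexists; unfold linpart; first [apply tame_proj|apply tame_sub; [apply tame_const|apply tame_proj]].
Qed.

Lemma tame_nonlin h c i : tame h c -> exists c', tame (nonlin h i) c'.
Proof.
  intros Hh; destruct i; eexists; unfold nonlin; try apply tame_const;
    (apply tame_mul; [apply tame_mul; [apply tame_const|exact Hh]|]);
    [apply tame_sX1|apply tame_sX2|apply tame_sX3].
Qed.

End TameMaps.

Lemma vnorm_eq_dot u v : vnorm u = vnorm v -> vdot u u = vdot v v.
Proof.
  unfold vnorm; intros E; apply sqrt_inj; auto; unfold vdot; nra.
Qed.

Lemma vdot_pos v : v <> mkV 0 0 0 -> 0 < vdot v v.
Proof.
  intros Hv; destruct v as [[x y] z]; unfold vdot, vx, vy, vz; simpl.
  destruct (Req_dec x 0) as [->|]; [destruct (Req_dec y 0) as [->|]; [destruct (Req_dec z 0) as [->|]|]|]; try nra.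
  exfalso; apply Hv; reflexivity.
Qed.

Lemma zero_of_locally_zero (a : fps) r : 0 < r -> Rbar_lt 0 (CV_radius a) ->
  (forall x, Rabs x < r -> PSeries a x = 0) -> forall n, a n = 0.
Proof.
  intros Hr Ha H n; apply (PSeries_ext_recip a (fun _ => 0) n); auto.
  - rewrite CV_radius_const_0; exact I.
  - exists (mkposreal r Hr); intros y Hy; rewrite PSeries_const_0; apply H.
    unfold ball in Hy; simpl in Hy; unfold AbsRing_ball, abs, minus, plus, opp in Hy; simpl in Hy.
    replace y with (y + - 0) by ring; exact Hy.
Qed.

Lemma ev_zero s t : ev zero2 s t = 0.
Proof. rewrite <- const2_0; apply ev_const. Qed.

(** * Existence near one point of the interval *)

Section LocalExistence.
Variables (H : V3 -> R) (J : R -> Prop) (beta B : R -> V3) (s0 rmax : R).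
Hypothesis HH : analytic_on_sphere H.
Hypothesis Hdata : bjorling_data J beta B.
Hypothesis Hrmax : 0 < rmax.
Hypothesis HJ : forall s, Rabs (s - s0) < rmax -> J s.

Definition bcoord (i : coord) (s : R) : R :=
  match i with
  | Cp1 => vx (beta s) | Cp2 => vy (beta s) | Cp3 => vz (beta s)
  | Cq1 => vx (B s) | Cq2 => vy (B s) | Cq3 => vz (B s)
  end.

Lemma data_series : exists (b : coord -> fps) (r : R), 0 < r <= rmax /\
  (forall i x, Rabs x < r -> Rbar_lt (Rabs x) (CV_radius (b i)) /\ bcoord i (s0 + x) = PSeries (b i) x /\
    Derive (bcoord i) (s0 + x) = PSeries (PS_derive (b i)) x) /\
  exists M, forall i N, sum_f_R0 (fun m => Rabs (b i m) * (r / 2) ^ m) N <= M /\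
     sum_f_R0 (fun m => Rabs (PS_derive (b i) m) * (r / 2) ^ m) N <= M.
Proof.
  assert (Js0 : J s0) by (apply HJ; rewrite Rminus_diag, Rabs_R0; auto).
  destruct Hdata as ((A1 & A2 & A3) & (A4 & A5 & A6) & _).
  assert (E : forall i, exists a r, 0 < r /\ forall x, Rabs x < r ->
    Rbar_lt (Rabs x) (CV_radius a) /\ bcoord i (s0 + x) = PSeries a x /\
    Derive (bcoord i) (s0 + x) = PSeries (PS_derive a) x).
  { intros []; eapply analytic_local; eauto. }
  destruct (choice _ E) as [b Hb].
  destruct (coord_uniform (fun i r => forall x, Rabs x < r ->
    Rbar_lt (Rabs x) (CV_radius (b i)) /\ bcoord i (s0 + x) = PSeries (b i) x /\
    Derive (bcoord i) (s0 + x) = PSeries (PS_derive (b i)) x)) as (r & Hr & Hbr); auto.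
  { intros i d d' Hd L x Hx; apply Hd; lra. }
  set (r' := Rmin r rmax).
  assert (Hr' : 0 < r' <= rmax) by (split; [apply Rmin_glb_lt; auto|apply Rmin_r]).
  assert (L : r' <= r) by apply Rmin_l.
  exists b, r'; split; auto; split; [intros; apply Hbr; lra|].
  assert (X : Rabs (r' / 2) < r') by (rewrite Rabs_pos_eq; lra).
  (* [coord_uniform] works with conditions inherited by smaller numbers, so an upper bound is
     encoded as the reciprocal of a small [c]. *)
  assert (M1 : exists M, 0 < M /\ forall i, forall c, 0 < c <= / M -> forall N, sum_f_R0 (fun m => Rabs (b i m) * (r' / 2) ^ m) N <= / c /\
     sum_f_R0 (fun m => Rabs (PS_derive (b i) m) * (r' / 2) ^ m) N <= / c).
  { destruct (coord_uniform (fun i c => forall N, sum_f_R0 (fun m => Rabs (b i m) * (r' / 2) ^ m) N <= / c /\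
     sum_f_R0 (fun m => Rabs (PS_derive (b i) m) * (r' / 2) ^ m) N <= / c)) as (c & Hc & Hb').
    - intros i.
      destruct (abs_sum_bound (b i) (r' / 2)) as [Ma HMa]; [lra|apply Hbr; lra|].
      destruct (abs_sum_bound (PS_derive (b i)) (r' / 2)) as [Mb HMb]; [lra|rewrite CV_radius_derive; apply Hbr; lra|].
      assert (P : 0 < Rmax 1 (Rmax Ma Mb)) by (pose proof (Rmax_l 1 (Rmax Ma Mb)); lra).
      exists (/ Rmax 1 (Rmax Ma Mb)); split; [apply Rinv_0_lt_compat; auto|].
      intros N; rewrite Rinv_inv; split; (eapply Rle_trans; [first [apply HMa|apply HMb]|]);
        (eapply Rle_trans; [|apply Rmax_r]); [apply Rmax_l|apply Rmax_r].
    - intros i d d' Hd L' N; destruct (Hd N); assert (/ d <= / d') by (apply Rinv_le_contravar; lra); lra.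
    - exists (/ c); split; [apply Rinv_0_lt_compat; auto|]; intros i c' Hc' N.
      rewrite Rinv_inv in Hc'; destruct (Hb' i N); assert (/ c <= / c') by (apply Rinv_le_contravar; lra); lra. }
  destruct M1 as (M & HM & HM'); exists M; intros i N.
  destruct (HM' i (/ M)) with (N := N) as [Q1 Q2]; [split; [apply Rinv_0_lt_compat; auto|lra]|].
  rewrite Rinv_inv in Q1, Q2; auto.
Qed.

(** Initial values p = beta' and q = B on t = 0. *)
Definition sdata (b : coord -> fps) (i : coord) : fps :=
  match i with Cp1 | Cp2 | Cp3 => PS_derive (b i) | _ => b i end.

Lemma Dt_fix a L G : Dt (emb a + It L + It G)%S = (L + G)%S.
Proof. rewrite !Dt_add, Dt_emb, !Dt_It; ring. Qed.

Lemma Ds_emb a : Ds (emb a) = emb (PS_derive a).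
Proof. fps_ext; unfold Ds, emb, PS_derive; destruct n; ring. Qed.

Theorem local_existence : exists R1 R2 X1 X2 X3, 0 < R1 <= rmax /\ 0 < R2 /\
  local_sol H beta B s0 R1 R2 X1 X2 X3.
Proof.
  destruct data_series as (b & rho & Hrho & Hb & M & HM).
  set (a := sdata b).
  set (u0 := fun i => a i O).
  assert (V0 : forall f, PSeries f 0 = f O) by (intros; apply PSeries_0).
  assert (vd : forall x, Rabs x < rho -> vderiv beta (s0 + x) =
    mkV (PSeries (a Cp1) x) (PSeries (a Cp2) x) (PSeries (a Cp3) x)).
  { intros x Hx; unfold vderiv; unfold a, sdata; f_equal; try f_equal;
    [apply (Hb Cp1 x Hx)|apply (Hb Cp2 x Hx)|apply (Hb Cp3 x Hx)]. }
  assert (vB : forall x, Rabs x < rho -> B (s0 + x) =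
    mkV (PSeries (a Cq1) x) (PSeries (a Cq2) x) (PSeries (a Cq3) x)).
  { intros x Hx; unfold a, sdata.
    destruct (Hb Cq1 x Hx) as (_ & <- & _), (Hb Cq2 x Hx) as (_ & <- & _), (Hb Cq3 x Hx) as (_ & <- & _).
    simpl; destruct (B (s0 + x)) as [[x1 x2] x3]; reflexivity. }
  assert (JJ : forall x, Rabs x < rho -> J (s0 + x)).
  { intros x Hx; apply HJ; replace (s0 + x - s0) with x by ring; lra. }
  destruct Hdata as (_ & _ & Hreg & Hnorm & Horth).
  assert (R0 : Rabs 0 < rho) by (rewrite Rabs_R0; lra).
  assert (HL : 0 < cDot u0).
  { pose proof (vdot_pos _ (Hreg _ (JJ 0 R0))) as P; rewrite (vd 0 R0) in P.
    unfold vdot, mkV, vx, vy, vz in P; simpl in P; rewrite !V0 in P; exact P. }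
  assert (HN : cDot u0 = u0 Cq1 * u0 Cq1 + u0 Cq2 * u0 Cq2 + u0 Cq3 * u0 Cq3).
  { pose proof (vnorm_eq_dot _ _ (Hnorm _ (JJ 0 R0))) as P; rewrite (vd 0 R0), (vB 0 R0) in P.
    unfold vdot, mkV, vx, vy, vz in P; simpl in P; rewrite !V0 in P; exact P. }
  assert (HO : u0 Cp1 * u0 Cq1 + u0 Cp2 * u0 Cq2 + u0 Cp3 * u0 Cq3 = 0).
  { pose proof (Horth _ (JJ 0 R0)) as P; rewrite (vd 0 R0), (vB 0 R0) in P.
    unfold vdot, mkV, vx, vy, vz in P; simpl in P; rewrite !V0 in P; exact P. }
  set (l := cDot u0) in *.
  set (n1 := cX1 u0 * / l); set (n2 := cX2 u0 * / l); set (n3 := cX3 u0 * / l).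
  assert (Hn : on_sphere (mkV n1 n2 n3)).
  { pose (p := mkV (u0 Cp1) (u0 Cp2) (u0 Cp3)); pose (q := mkV (u0 Cq1) (u0 Cq2) (u0 Cq3)).
    replace (mkV n1 n2 n3) with (normal p q).
    - apply normal_on_sphere; auto.
    - unfold normal, vscal, mkV, n1, n2, n3; change (vdot p p) with l.
      f_equal; [f_equal|]; rewrite Rmult_comm; reflexivity. }
  destruct (HH _ Hn) as (ah & rh & Hrh & Habs & Hlim).
  (* Absolute convergence at the point whose three offsets are rh/2 is exactly the [absmono] bound
     that substitution requires. *)
  destruct (Habs (mkV (n1 + rh / 2) (n2 + rh / 2) (n3 + rh / 2))) as [Mh HMh].
  { unfold in_polydisc, mkV, vx, vy, vz; simpl.
    repeat split; match goal with |- Rabs (?x + ?y - ?x) < _ => replace (x + y - x) with y by ring end;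
      rewrite Rabs_pos_eq; lra. }
  assert (HMh' : forall N, tri (absmono ah (rh / 2)) N <= Mh).
  { intros N; eapply Rle_trans; [|apply (HMh N)]; apply Req_le; unfold psum3_abs.
    apply tri_ext; intros i j k; unfold absmono, mkV, vx, vy, vz; simpl.
    repeat match goal with |- context [Rabs (?x + ?y - ?x)] => replace (x + y - x) with y by ring end.
    rewrite (Rabs_pos_eq (rh / 2)) by lra; ring. }
  set (h := sH ah l n1 n2 n3).
  assert (Th : tame u0 h (ah O O O)) by (apply tame_sH with (rh / 2) Mh; auto; lra).
  assert (ED : exists d, 0 < d /\ forall i : coord, exists K, forall w U, good_weight w -> in_ball w u0 d U ->
     nle w (linpart i U) K /\ nle w (nonlin h i U) K).
  { apply coord_uniform.
    - intros i; destruct (tame_linpart u0 i) as [c1 T1]; destruct (tame_nonlin u0 h _ i Th) as [c2 T2].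
      destruct (tame_bounded u0 _ _ T1) as (d1 & D1 & B1); destruct (tame_bounded u0 _ _ T2) as (d2 & D2 & B2).
      exists (Rmin d1 d2); split; [apply Rmin_glb_lt; auto|].
      exists (Rmax (1 + Rabs c1) (1 + Rabs c2)); intros w U Hw HU; split.
      + eapply nle_weaken; [apply B1; auto; eapply in_ball_le; eauto; apply Rmin_l|apply Rmax_l].
      + eapply nle_weaken; [apply B2; auto; eapply in_ball_le; eauto; apply Rmin_r|apply Rmax_r].
    - intros i d d' [K HK] L; exists K; intros w U Hw HU; apply HK; auto; eapply in_ball_le; eauto; lra. }
  destruct ED as (d1 & Hd1 & HK1).
  (* The ball is made so small that |p|^2 stays within l/2 of [l], which keeps it positive and the
     geometric series convergent, and that the normal stays in the polydisc of the expansion of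
     H. *)
  destruct (proj2 (tame_sDot u0) (l / 2)) as (d2 & Hd2 & B2); [lra|].
  destruct (proj2 (tame_sN1 u0 HL) (rh / 2)) as (d3 & Hd3 & B3); [lra|].
  destruct (proj2 (tame_sN2 u0 HL) (rh / 2)) as (d4 & Hd4 & B4); [lra|].
  destruct (proj2 (tame_sN3 u0 HL) (rh / 2)) as (d5 & Hd5 & B5); [lra|].
  destruct (common_lower_bound d1 d2) as (y1 & ? & ? & ?); auto.
  destruct (common_lower_bound y1 d3) as (y2 & ? & ? & ?); auto.
  destruct (common_lower_bound y2 d4) as (y3 & ? & ? & ?); auto.
  destruct (common_lower_bound y3 d5) as (d & Hd & ? & dd5); auto.
  assert (dd1 : d <= d1) by lra; assert (dd2 : d <= d2) by lra.
  assert (dd3 : d <= d3) by lra; assert (dd4 : d <= d4) by lra.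
  destruct (choice _ HK1) as [Kf HKf].
  set (K := Rmax (Kf Cp1) (Rmax (Kf Cp2) (Rmax (Kf Cp3) (Rmax (Kf Cq1) (Rmax (Kf Cq2) (Kf Cq3)))))).
  assert (HKK : forall i, Kf i <= K).
  { intros []; unfold K; repeat (first [apply Rmax_l|apply Rmax_r|eapply Rle_trans; [|apply Rmax_r]]). }
  destruct (semilinear_Cauchy_Kovalevskaya a linpart (nonlin h) (rho / 2) M K d (rho / 2)) as (A & r & U & HA & Hr & HU & Hfix); auto; try lra.
  { intros i N; unfold a, sdata; destruct i; apply HM. }
  { intros i; destruct (tame_linpart u0 i) as [c []]; auto. }
  { intros i; destruct (tame_nonlin u0 h _ i Th) as [c []]; auto. }
  { intros w U Hw HU i; destruct (HKf i w U Hw) as [Q1 Q2].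
    - eapply in_ball_le; eauto.
    - split; eapply nle_weaken; eauto. }
  assert (Hw := wt_good A r HA (proj1 Hr)).
  assert (Hr0 : 0 < r) by lra.
  assert (HAr : 0 < A * r) by nra.
  set (R1 := r / 2); set (R2 := A * r / 2).
  assert (HR1 : 0 < R1) by (unfold R1; lra).
  assert (HR2 : 0 < R2) by (unfold R2; lra).
  assert (UN : forall i, exists M', nle (wt A r) (U i) M').
  { intros i; exists (d + Rabs (a i O)).
    replace (U i) with ((U i - const2 (a i O)) + const2 (a i O))%S by ring.
    apply nle_add; [apply gw_nonneg; auto|apply HU|apply nle_const, gw_one, Hw]. }
  assert (UA : forall i, An R1 R2 (U i)).
  { intros i; destruct (UN i) as [M' HM']; eapply nle_wt_An; eauto. }
  (* psi is beta plus the t-integral of q. The existential keeps the series opaque, with its formula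
     as a hypothesis. *)
  assert (EX : forall i j, exists X, An R1 R2 X /\ X = (emb (b i) + It (U j))%S).
  { intros i j; eexists; split; [|reflexivity]; apply An_add.
    - apply (nle_wt_An A r _ M); auto; apply nle_emb; auto.
      intros N; eapply Rle_trans; [|apply (proj1 (HM i N))]; apply sum_le; intros m _.
      apply Rmult_le_compat_l; [apply Rabs_pos|apply pow_incr; lra].
    - destruct (UN j) as [M' HM']; eapply nle_wt_An; eauto; apply nle_It; eauto. }
  destruct (EX Cp1 Cq1) as (X1 & AX1 & EX1), (EX Cp2 Cq2) as (X2 & AX2 & EX2), (EX Cp3 Cq3) as (X3 & AX3 & EX3).
  assert (FT : forall i, Dt (U i) = (Ds (linpart i U) + nonlin h i U)%S).
  { intros i; rewrite (Hfix i) at 1; apply Dt_fix. }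
  assert (T1 : Dt X1 = U Cq1) by (rewrite EX1, Dt_add, Dt_emb, Dt_It; ring).
  assert (T2 : Dt X2 = U Cq2) by (rewrite EX2, Dt_add, Dt_emb, Dt_It; ring).
  assert (T3 : Dt X3 = U Cq3) by (rewrite EX3, Dt_add, Dt_emb, Dt_It; ring).
  (* psi_s is beta' plus the integral of q_s, which is the fixed point equation of p. *)
  assert (S1 : Ds X1 = U Cp1).
  { rewrite (Hfix Cp1), EX1, Ds_add, Ds_emb, Ds_It; simpl; rewrite const2_0, It_zero; unfold a; simpl; ring. }
  assert (S2 : Ds X2 = U Cp2).
  { rewrite (Hfix Cp2), EX2, Ds_add, Ds_emb, Ds_It; simpl; rewrite const2_0, It_zero; unfold a; simpl; ring. }
  assert (S3 : Ds X3 = U Cp3).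
  { rewrite (Hfix Cp3), EX3, Ds_add, Ds_emb, Ds_It; simpl; rewrite const2_0, It_zero; unfold a; simpl; ring. }
  clear EX.
  assert (row0 : forall i, U i O = a i).
  { intros i; apply functional_extensionality; intros m; rewrite (Hfix i).
    unfold add2, fadd, seradd, It, emb; ring. }
  assert (rowX : forall i j m, (emb (b i) + It (U j))%S O m = b i m).
  { intros i j m; unfold add2, fadd, seradd, It, emb; ring. }
  assert (rowX1 : forall i j m, (emb (b i) + It (U j))%S 1%nat m = U j O m).
  { intros i j m; unfold add2, fadd, seradd, It, emb; simpl; field. }
  assert (R1rho : R1 < rho) by (unfold R1; lra).
  assert (FTp1 : Dt (U Cp1) = Ds (U Cq1)) by (rewrite FT; simpl; rewrite const2_0; ring).
  assert (FTp2 : Dt (U Cp2) = Ds (U Cq2)) by (rewrite FT; simpl; rewrite const2_0; ring).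
  assert (FTp3 : Dt (U Cp3) = Ds (U Cq3)) by (rewrite FT; simpl; rewrite const2_0; ring).
  assert (FTq1 : Dt (U Cq1) = (const2 2 * h U * sX1 U - Ds (U Cp1))%S)
    by (rewrite FT; simpl; rewrite Ds_sub, Ds_const; ring).
  assert (FTq2 : Dt (U Cq2) = (const2 2 * h U * sX2 U - Ds (U Cp2))%S)
    by (rewrite FT; simpl; rewrite Ds_sub, Ds_const; ring).
  assert (FTq3 : Dt (U Cq3) = (const2 2 * h U * sX3 U - Ds (U Cp3))%S)
    by (rewrite FT; simpl; rewrite Ds_sub, Ds_const; ring).
  assert (row_ev : forall i x, ev (U i) x 0 = PSeries (a i) x) by (intros; rewrite ev_t0, row0; reflexivity).
  assert (R20 : Rabs 0 < R2) by (rewrite Rabs_R0; auto).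
  (* Turns identities between values on t = 0 into vanishing coefficients, the form in which the
     formal argument needs its initial conditions. *)
  assert (zero_row : forall u, An R1 R2 u -> (forall x, Rabs x < R1 -> ev u x 0 = 0) -> forall m, u O m = 0).
  { intros u Hu Hz; apply zero_of_locally_zero with R1; auto.
    - rewrite <- Rabs_R0; eapply ex_pseries_row; eauto; rewrite Rabs_R0; auto.
    - intros x Hx; rewrite <- ev_t0; auto. }
  destruct (formal_conformal U (h U)) as [CF1 CF2]; auto.
  { apply zero_row; [repeat first [apply An_sub|apply An_add|apply An_mul]; apply UA|].
    intros x Hx; rewrite (ev_sub R1 R2), !(ev_add R1 R2), !(ev_mul R1 R2), !row_ev; auto using An_add, An_mul.
    pose proof (vnorm_eq_dot _ _ (Hnorm _ (JJ x ltac:(lra)))) as P; rewrite vd, vB in P by lra.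
    unfold vdot, mkV, vx, vy, vz in P; cbn [fst snd] in P; lra. }
  { apply zero_row; [repeat first [apply An_add|apply An_mul]; try apply UA; apply An_const|].
    intros x Hx; rewrite (ev_mul R1 R2), !(ev_add R1 R2), !(ev_mul R1 R2), !row_ev; auto using An_add, An_mul, An_const.
    pose proof (Horth _ (JJ x ltac:(lra))) as P; rewrite vd, vB in P by lra.
    unfold vdot, mkV, vx, vy, vz in P; cbn [fst snd] in P; rewrite P; ring. }
  assert (ND : nle (wt A r) (sDot U - const2 l)%S (l / 2)) by (apply B2; auto; eapply in_ball_le; eauto).
  assert (N1 : nle (wt A r) (sN1 l U - const2 n1)%S (rh / 2)) by (apply B3; auto; eapply in_ball_le; eauto).
  assert (N2 : nle (wt A r) (sN2 l U - const2 n2)%S (rh / 2)) by (apply B4; auto; eapply in_ball_le; eauto).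
  assert (N3 : nle (wt A r) (sN3 l U - const2 n3)%S (rh / 2)) by (apply B5; auto; eapply in_ball_le; eauto).
  assert (N0 : nle (wt A r) (const2 0 - const2 0)%S (l / 2)).
  { replace (const2 0 - const2 0)%S with zero2 by ring; eapply nle_weaken; [apply nle_zero; auto|lra]. }
  assert (Ainv : An R1 R2 (sInv l U)).
  { eapply nle_wt_An; auto; apply (nle_subst _ Hw (ainv l) _ _ _ (l / 2) (2 / l) ND N0 N0).
    intros N; apply ainv_bound; auto. }
  assert (Ah : An R1 R2 (h U)).
  { eapply nle_wt_An; auto; apply (nle_subst _ Hw ah _ _ _ (rh / 2) Mh N1 N2 N3 HMh'). }
  assert (AXs : An R1 R2 (sX1 U) /\ An R1 R2 (sX2 U) /\ An R1 R2 (sX3 U)).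
  { unfold sX1, sX2, sX3; repeat split; apply An_sub; apply An_mul; apply UA. }
  destruct AXs as (AS1 & AS2 & AS3).
  assert (AD : An R1 R2 (sDot U)) by (unfold sDot; repeat apply An_add; apply An_mul; apply UA).
  exists R1, R2, X1, X2, X3; split; [unfold R1; lra|]; split; [auto|].
  assert (evsub : forall u c e s t, An R1 R2 u -> nle (wt A r) (u - const2 c)%S e -> Rabs s < R1 -> Rabs t < R2 ->
     Rabs (ev u s t - c) <= e).
  { intros u c e s t Hu He Hs Ht. rewrite <- (ev_const c s t), <- (ev_sub R1 R2); auto using An_const.
    apply (ev_bound R1 R2); try lra; apply (nle_wt_pw A r); unfold R1, R2 in *; auto; lra. }
  assert (conf : forall s t, Rabs s < R1 -> Rabs t < R2 ->
    let p := mkV (ev (U Cp1) s t) (ev (U Cp2) s t) (ev (U Cp3) s t) in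
    let q := mkV (ev (U Cq1) s t) (ev (U Cq2) s t) (ev (U Cq3) s t) in
    vdot p p = vdot q q /\ vdot p q = 0 /\ 0 < vdot p p /\ ev (sDot U) s t = vdot p p).
  { intros s t Hs Ht p q.
    assert (E1 := f_equal (fun u => ev u s t) CF1); assert (E2 := f_equal (fun u => ev u s t) CF2); cbv beta in E1, E2.
    rewrite ev_zero in E1, E2.
    rewrite (ev_sub R1 R2), !(ev_add R1 R2), !(ev_mul R1 R2) in E1; auto using An_add, An_mul.
    rewrite (ev_mul R1 R2), !(ev_add R1 R2), !(ev_mul R1 R2), ev_const in E2; auto using An_add, An_mul, An_const.
    assert (E3 : ev (sDot U) s t = vdot p p).
    { unfold sDot; rewrite !(ev_add R1 R2), !(ev_mul R1 R2); auto using An_add, An_mul. }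
    pose proof (evsub _ _ _ s t AD ND Hs Ht) as E4; rewrite E3 in E4; apply Rabs_le_between in E4.
    repeat split; auto; try lra; unfold vdot, p, q, mkV, vx, vy, vz; simpl; lra. }
  (* The same partial sums tend to the value of the substituted series and to the sum of the
     geometric series. *)
  assert (evinv : forall s t, Rabs s < R1 -> Rabs t < R2 -> ev (sInv l U) s t = / ev (sDot U) s t).
  { intros s t Hs Ht.
    pose proof (ev_subst A r (ainv l) _ _ _ (l / 2) (2 / l) s t HA Hr0 ND N0 N0 (fun N => ainv_bound l N HL) Hs Ht) as LL.
    pose proof (evsub _ _ _ s t AD ND Hs Ht) as E4.
    replace (ev (const2 0 - const2 0)%S s t) with 0 in LL
      by (replace (const2 0 - const2 0)%S with zero2 by ring; rewrite ev_zero; auto).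
    rewrite (ev_sub R1 R2), ev_const in LL; auto using An_const.
    pose proof (ainv_lim l (ev (sDot U) s t - l) HL E4) as LL'.
    replace (l + (ev (sDot U) s t - l)) with (ev (sDot U) s t) in LL' by ring.
    apply is_lim_seq_unique in LL; apply is_lim_seq_unique in LL'.
    assert (EE : Finite (ev (sInv l U) s t) = Finite (/ ev (sDot U) s t)) by (etransitivity; [symmetry; exact LL|exact LL']).
    injection EE; auto. }
  assert (evh : forall s t, Rabs s < R1 -> Rabs t < R2 ->
    let p := mkV (ev (U Cp1) s t) (ev (U Cp2) s t) (ev (U Cp3) s t) in
    let q := mkV (ev (U Cq1) s t) (ev (U Cq2) s t) (ev (U Cq3) s t) in
    ev (h U) s t = H (normal p q) /\
    vcross p q = mkV (ev (sX1 U) s t) (ev (sX2 U) s t) (ev (sX3 U) s t)).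
  { intros s t Hs Ht p q.
    destruct (conf s t Hs Ht) as (C1 & C2 & C3 & C4); fold p q in C1, C2, C3, C4.
    assert (CX : vcross p q = mkV (ev (sX1 U) s t) (ev (sX2 U) s t) (ev (sX3 U) s t)).
    { unfold sX1, sX2, sX3; rewrite !(ev_sub R1 R2), !(ev_mul R1 R2); auto using An_mul. }
    split; auto.
    assert (NN : normal p q = mkV (ev (sN1 l U) s t) (ev (sN2 l U) s t) (ev (sN3 l U) s t)).
    { unfold normal; rewrite CX; unfold sN1, sN2, sN3; rewrite !(ev_mul R1 R2), evinv, C4 by auto.
      unfold vscal, mkV, vx, vy, vz; simpl; f_equal; [f_equal|]; ring. }
    assert (A1 : An R1 R2 (sN1 l U)) by (apply An_mul; auto).
    assert (A2 : An R1 R2 (sN2 l U)) by (apply An_mul; auto).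
    assert (A3 : An R1 R2 (sN3 l U)) by (apply An_mul; auto).
    pose proof (ev_subst A r ah _ _ _ (rh / 2) Mh s t HA Hr0 N1 N2 N3 HMh' Hs Ht) as LL.
    rewrite !(ev_sub R1 R2), !ev_const in LL; auto using An_const.
    (* Conformality is used here: the normal is on the sphere, so the extension sums to H. *)
    assert (LL' : is_lim_seq (psum3 ah (mkV n1 n2 n3) (normal p q)) (H (normal p q))).
    { apply Hlim; [|apply normal_on_sphere; auto].
      rewrite NN; unfold in_polydisc, mkV, vx, vy, vz; simpl.
      repeat split; (eapply Rle_lt_trans; [eapply evsub; eauto|lra]). }
    rewrite NN in LL' at 1.
    assert (EE : Finite (ev (h U) s t) = Finite (H (normal p q))).
    { rewrite <- (is_lim_seq_unique _ _ LL'); symmetry; apply (is_lim_seq_unique _ _ LL). }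
    injection EE; auto. }
  split; auto.
  - intros s Hs; rewrite EX1, EX2, EX3.
    rewrite !(PSeries_ext _ _ s (rowX _ _)).
    destruct (Hb Cp1 s) as (_ & <- & _); [lra|]; destruct (Hb Cp2 s) as (_ & <- & _); [lra|].
    destruct (Hb Cp3 s) as (_ & <- & _); [lra|]; simpl.
    destruct (beta (s0 + s)) as [[x1 x2] x3]; reflexivity.
  - intros s Hs; rewrite EX1, EX2, EX3.
    rewrite !(PSeries_ext _ _ s (rowX1 _ _)), !row0, vB by lra; reflexivity.
  - intros s t Hs Ht; rewrite S1, S2, S3, T1, T2, T3; destruct (conf s t Hs Ht) as (C1 & C2 & C3 & _); auto.
  - intros s t Hs Ht; rewrite S1, S2, S3, T1, T2, T3, FTq1, FTq2, FTq3.
    destruct (evh s t Hs Ht) as [E1 E2]; unfold evV.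
    rewrite <- E1, E2, !(ev_sub R1 R2), !(ev_mul R1 R2), ev_const; auto using An_mul, An_Ds, An_const.
    unfold vadd, vscal, mkV, vx, vy, vz; simpl; f_equal; [f_equal|]; ring.
Qed.

End LocalExistence.

(** * Uniqueness *)

(** A crude form of the bound i rho^(i-1): the factor i is absorbed by doubling the radius, as i <=
    2^i. *)
Lemma pow_Lipschitz rho x y i : 0 < rho -> Rabs x <= rho -> Rabs y <= rho ->
  Rabs (x ^ i - y ^ i) <= / rho * (2 * rho) ^ i * Rabs (x - y).
Proof.
  intros Hr Hx Hy; pose proof (Rabs_pos (x - y)) as D.
  induction i as [|i IH].
  - simpl; rewrite Rminus_diag, Rabs_R0; assert (0 < / rho) by (apply Rinv_0_lt_compat; auto); nra.
  - replace (x ^ S i - y ^ S i) with (x * (x ^ i - y ^ i) + (x - y) * y ^ i) by (simpl; ring).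
    eapply Rle_trans; [apply Rabs_triang|]; rewrite !Rabs_mult.
    assert (P : Rabs (y ^ i) <= (2 * rho) ^ i).
    { rewrite <- RPow_abs; apply pow_incr; pose proof (Rabs_pos y); lra. }
    assert (Q : Rabs x * Rabs (x ^ i - y ^ i) <= rho * (/ rho * (2 * rho) ^ i * Rabs (x - y))).
    { apply Rmult_le_compat; auto using Rabs_pos. }
    replace (rho * (/ rho * (2 * rho) ^ i * Rabs (x - y))) with ((2 * rho) ^ i * Rabs (x - y)) in Q by (field; lra).
    replace (/ rho * (2 * rho) ^ S i * Rabs (x - y)) with (2 * (2 * rho) ^ i * Rabs (x - y)) by (simpl; field; lra).
    nra.
Qed.

(** The three variables are changed one at a time. *)
Lemma mono_Lipschitz rho x1 x2 x3 y1 y2 y3 i j k : 0 < rho ->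
  Rabs x1 <= rho -> Rabs x2 <= rho -> Rabs x3 <= rho -> Rabs y1 <= rho -> Rabs y2 <= rho -> Rabs y3 <= rho ->
  Rabs (x1 ^ i * x2 ^ j * x3 ^ k - y1 ^ i * y2 ^ j * y3 ^ k) <=
  / rho * ((2 * rho) ^ i * (2 * rho) ^ j * (2 * rho) ^ k) * (Rabs (x1 - y1) + Rabs (x2 - y2) + Rabs (x3 - y3)).
Proof.
  intros Hr X1 X2 X3 Y1 Y2 Y3.
  assert (B : forall z l, Rabs z <= rho -> Rabs (z ^ l) <= (2 * rho) ^ l).
  { intros z l Hz; rewrite <- RPow_abs; apply pow_incr; pose proof (Rabs_pos z); lra. }
  replace (x1 ^ i * x2 ^ j * x3 ^ k - y1 ^ i * y2 ^ j * y3 ^ k) with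
    ((x1 ^ i - y1 ^ i) * x2 ^ j * x3 ^ k + y1 ^ i * (x2 ^ j - y2 ^ j) * x3 ^ k + y1 ^ i * y2 ^ j * (x3 ^ k - y3 ^ k)) by ring.
  assert (T : forall a b c a' b' c', Rabs a <= a' -> Rabs b <= b' -> Rabs c <= c' -> Rabs (a * b * c) <= a' * b' * c').
  { intros a b c a' b' c' Ha Hb Hc; rewrite !Rabs_mult.
    apply Rmult_le_compat; auto using Rabs_pos; [apply Rmult_le_pos; apply Rabs_pos|].
    apply Rmult_le_compat; auto using Rabs_pos. }
  pose proof (T _ _ _ _ _ _ (pow_Lipschitz rho x1 y1 i Hr X1 Y1) (B x2 j X2) (B x3 k X3)) as T1.
  pose proof (T _ _ _ _ _ _ (B y1 i Y1) (pow_Lipschitz rho x2 y2 j Hr X2 Y2) (B x3 k X3)) as T2.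
  pose proof (T _ _ _ _ _ _ (B y1 i Y1) (B y2 j Y2) (pow_Lipschitz rho x3 y3 k Hr X3 Y3)) as T3.
  eapply Rle_trans; [apply Rabs_triang|]; eapply Rle_trans; [apply Rplus_le_compat_r, Rabs_triang|].
  lra.
Qed.

(** The terms of the series are Lipschitz with summable constants, and the estimate passes to the
    limit of the partial sums, which is known to be H at points of the sphere. *)
Lemma H_Lipschitz H p : analytic_on_sphere H -> on_sphere p ->
  exists rho L, 0 < rho /\ forall x y, on_sphere x -> on_sphere y -> in_polydisc p rho x -> in_polydisc p rho y ->
    Rabs (H x - H y) <= L * (Rabs (vx x - vx y) + Rabs (vy x - vy y) + Rabs (vz x - vz y)).
Proof.
  intros HH Hp; destruct (HH p Hp) as (a & r & Hr & Habs & Hlim).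
  (* A quarter, so that the doubled radius [2 * rho] is r/2, still inside the polydisc of
     convergence. *)
  set (rho := r / 4).
  destruct (Habs (mkV (vx p + r / 2) (vy p + r / 2) (vz p + r / 2))) as [M HM].
  { unfold in_polydisc, mkV, vx, vy, vz; simpl.
    repeat split; match goal with |- Rabs (?x + ?y - ?x) < _ => replace (x + y - x) with y by ring end;
      rewrite Rabs_pos_eq; lra. }
  assert (HM' : forall N, tri (absmono a (2 * rho)) N <= M).
  { intros N; eapply Rle_trans; [|apply (HM N)]; apply Req_le; unfold psum3_abs.
    apply tri_ext; intros i j k; unfold absmono, mkV, vx, vy, vz; simpl.
    repeat match goal with |- context [Rabs (?x + ?y - ?x)] => replace (x + y - x) with y by ring end.
    replace (2 * rho) with (r / 2) by (unfold rho; field).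
    rewrite (Rabs_pos_eq (r / 2)) by lra; ring. }
  assert (Hrho : 0 < rho) by (unfold rho; lra).
  exists rho, (/ rho * M); split; auto; intros x y Sx Sy Px Py.
  assert (Lx : is_lim_seq (psum3 a p x) (H x)).
  { apply Hlim; auto; destruct Px as (? & ? & ?); unfold rho in *; repeat split; lra. }
  assert (Ly : is_lim_seq (psum3 a p y) (H y)).
  { apply Hlim; auto; destruct Py as (? & ? & ?); unfold rho in *; repeat split; lra. }
  set (D := Rabs (vx x - vx y) + Rabs (vy x - vy y) + Rabs (vz x - vz y)).
  apply (is_lim_seq_le (fun N => Rabs (psum3 a p x N - psum3 a p y N)) (fun _ => / rho * M * D)
     (Rabs (H x - H y)) (/ rho * M * D)); [|apply (is_lim_seq_abs _ _ (is_lim_seq_minus' _ _ _ _ Lx Ly))|apply is_lim_seq_const].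
  assert (HD : 0 <= D) by (unfold D; repeat apply Rplus_le_le_0_compat; apply Rabs_pos).
  assert (Hi : 0 < / rho) by (apply Rinv_0_lt_compat; auto).
  intros N; apply Rle_trans with (/ rho * D * tri (absmono a (2 * rho)) N).
  2:{ replace (/ rho * M * D) with (/ rho * D * M) by ring; apply Rmult_le_compat_l; auto; apply Rmult_le_pos; lra. }
  set (m := fun (z : V3) i j k => (vx z - vx p) ^ i * (vy z - vy p) ^ j * (vz z - vz p) ^ k).
  assert (E : psum3 a p x N - psum3 a p y N = tri (fun i j k => a i j k * (m x i j k - m y i j k)) N).
  { replace (psum3 a p x N) with (tri (fun i j k => a i j k * m x i j k) N)
      by (apply tri_ext; intros; unfold m; ring).
    replace (psum3 a p y N) with (tri (fun i j k => a i j k * m y i j k) N)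
      by (apply tri_ext; intros; unfold m; ring).
    rewrite (tri_ext (fun i j k => a i j k * (m x i j k - m y i j k)) (fun i j k => a i j k * m x i j k + (-1) * (a i j k * m y i j k)))
      by (intros; ring).
    rewrite tri_plus, tri_scal; ring. }
  rewrite E; eapply Rle_trans; [apply tri_Rabs|]; rewrite <- tri_scal; apply tri_le; intros i j k.
  rewrite Rabs_mult; unfold absmono.
  destruct Px as (? & ? & ?), Py as (? & ? & ?).
  pose proof (mono_Lipschitz rho (vx x - vx p) (vy x - vy p) (vz x - vz p) (vx y - vx p) (vy y - vy p) (vz y - vz p) i j k Hrho) as Q.
  replace (vx x - vx p - (vx y - vx p)) with (vx x - vx y) in Q by ring.
  replace (vy x - vy p - (vy y - vy p)) with (vy x - vy y) in Q by ring.
  replace (vz x - vz p - (vz y - vz p)) with (vz x - vz y) in Q by ring.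
  fold D in Q; unfold m.
  apply Rle_trans with (Rabs (a i j k) * (/ rho * ((2 * rho) ^ i * (2 * rho) ^ j * (2 * rho) ^ k) * D)).
  - apply Rmult_le_compat_l; [apply Rabs_pos|apply Q; lra].
  - apply Req_le; ring.
Qed.

(** * Contact of order [K] at t = 0 *)

Definition eqO (K : nat) (f g : R -> R) : Prop :=
  exists C d, 0 <= C /\ 0 < d /\ forall t, Rabs t < d -> Rabs (f t - g t) <= C * Rabs t ^ K.

Lemma eqO_ext K f g f' g' d : 0 < d -> (forall t, Rabs t < d -> f t = f' t /\ g t = g' t) ->
  eqO K f' g' -> eqO K f g.
Proof.
  intros Hd E (C & d' & HC & Hd' & B); exists C, (Rmin d d'); repeat split; auto; [apply Rmin_glb_lt; auto|].
  intros t Ht; destruct (E t) as [-> ->]; [eapply Rlt_le_trans; [apply Ht|apply Rmin_l]|].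
  apply B; eapply Rlt_le_trans; [apply Ht|apply Rmin_r].
Qed.

Lemma eqO_sub K f g f' g' : eqO K f g -> eqO K f' g' -> eqO K (fun t => f t - f' t) (fun t => g t - g' t).
Proof.
  intros (C & d & HC & Hd & B) (C' & d' & HC' & Hd' & B'); exists (C + C'), (Rmin d d'); repeat split; [lra|apply Rmin_glb_lt; lra|].
  intros t Ht; replace (f t - f' t - (g t - g' t)) with ((f t - g t) - (f' t - g' t)) by ring.
  assert (Rabs t < d) by (eapply Rlt_le_trans; [apply Ht|apply Rmin_l]).
  assert (Rabs t < d') by (eapply Rlt_le_trans; [apply Ht|apply Rmin_r]).
  specialize (B t); specialize (B' t); unfold Rminus at 1; eapply Rle_trans; [apply Rabs_triang|]; rewrite Rabs_Ropp; lra.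
Qed.

Lemma eqO_refl K f : eqO K f f.
Proof.
  exists 0, 1; repeat split; try lra; intros t _; rewrite Rminus_diag, Rabs_R0; lra.
Qed.

Lemma eqO_add K f g f' g' : eqO K f g -> eqO K f' g' -> eqO K (fun t => f t + f' t) (fun t => g t + g' t).
Proof.
  intros E E'; assert (Z := eqO_sub K (fun _ => 0) (fun _ => 0) _ _ (eqO_refl K _) E').
  apply eqO_ext with (fun t => f t - (0 - f' t)) (fun t => g t - (0 - g' t)) 1; [lra|intros; split; ring|].
  apply (eqO_sub K f g _ _ E Z).
Qed.

Lemma cont0_near f e : continuity_pt f 0 -> 0 < e -> exists d, 0 < d /\ forall t, Rabs t < d -> Rabs (f t - f 0) < e.
Proof.
  intros Hf He; destruct (proj1 (continuity_pt_locally f 0) Hf (mkposreal e He)) as [d Hd].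
  exists d; split; [apply d|]; intros t Ht; apply (Hd t).
  unfold ball; simpl; unfold AbsRing_ball, abs, minus, plus, opp; simpl.
  replace (t + - 0) with t by ring; auto.
Qed.

Definition bounded0 (f : R -> R) : Prop :=
  exists C d, 0 <= C /\ 0 < d /\ forall t, Rabs t < d -> Rabs (f t) <= C.

Lemma cont0_bounded f : continuity_pt f 0 -> bounded0 f.
Proof.
  intros Hf; destruct (cont0_near f 1 Hf) as (d & Hd & B); [lra|]; exists (Rabs (f 0) + 1), d; repeat split; auto.
  - pose proof (Rabs_pos (f 0)); lra.
  - intros t Ht; specialize (B t Ht); replace (f t) with (f 0 + (f t - f 0)) by ring.
    eapply Rle_trans; [apply Rabs_triang|lra].
Qed.

(** From f f' - g g' = f (f' - g') + (f - g) g'. Stated with boundedness because this is what the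
    Lipschitz estimate provides for H along a normal. *)
Lemma eqO_mul_bounded K f g f' g' : bounded0 f -> bounded0 g' -> eqO K f g -> eqO K f' g' ->
  eqO K (fun t => f t * f' t) (fun t => g t * g' t).
Proof.
  intros (D & e & HD & He & BD) (D' & e' & HD' & He' & BD') (C & d & HC & Hd & B) (C' & d' & HC' & Hd' & B').
  destruct (common_lower_bound d d') as (x1 & ? & ? & ?); auto.
  destruct (common_lower_bound x1 e) as (x2 & ? & ? & ?); auto.
  destruct (common_lower_bound x2 e') as (x & ? & ? & ?); auto.
  exists (D * C' + C * D'), x; repeat split; auto.
  - apply Rplus_le_le_0_compat; apply Rmult_le_pos; auto.
  - intros t Ht.
    assert (Rabs t < d) by lra; assert (Rabs t < d') by lra; assert (Rabs t < e) by lra; assert (Rabs t < e') by lra.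
    replace (f t * f' t - g t * g' t) with (f t * (f' t - g' t) + (f t - g t) * g' t) by ring.
    eapply Rle_trans; [apply Rabs_triang|]; rewrite !Rabs_mult, Rmult_plus_distr_r.
    apply Rplus_le_compat.
    + rewrite Rmult_assoc; apply Rmult_le_compat; auto using Rabs_pos.
    + replace (C * D' * Rabs t ^ K) with (C * Rabs t ^ K * D') by ring; apply Rmult_le_compat; auto using Rabs_pos.
Qed.

Lemma eqO_mul K f g f' g' : continuity_pt f 0 -> continuity_pt g' 0 -> eqO K f g -> eqO K f' g' ->
  eqO K (fun t => f t * f' t) (fun t => g t * g' t).
Proof. intros; apply eqO_mul_bounded; auto using cont0_bounded. Qed.

Lemma eqO_inv K f g : continuity_pt f 0 -> continuity_pt g 0 -> f 0 <> 0 -> g 0 <> 0 -> eqO K f g ->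
  eqO K (fun t => / f t) (fun t => / g t).
Proof.
  intros Cf Cg F0 G0 E.
  assert (Ci : forall h, continuity_pt h 0 -> h 0 <> 0 -> continuity_pt (fun t => / h t) 0).
  { intros h Ch H0; apply (continuity_pt_inv h 0); auto. }
  assert (NZ : forall h, continuity_pt h 0 -> h 0 <> 0 -> exists d, 0 < d /\ forall t, Rabs t < d -> h t <> 0).
  { intros h Ch H0; destruct (cont0_near h (Rabs (h 0)) Ch) as (d & Hd & B); [apply Rabs_pos_lt; auto|].
    exists d; split; auto; intros t Ht Z; specialize (B t Ht); rewrite Z, Rminus_0_l, Rabs_Ropp in B; lra. }
  destruct (NZ f Cf F0) as (d & Hd & Nf), (NZ g Cg G0) as (d' & Hd' & Ng).
  assert (E1 : eqO K (fun t => (g t - f t)) (fun t => f t - f t)).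
  { destruct E as (C & e & HC & He & B); exists C, e; repeat split; auto; intros t Ht.
    rewrite Rminus_diag, Rminus_0_r, Rabs_minus_sym; auto. }
  (* Since 1/f = 1/g + (g - f)/(f g), the claim reduces to a product with a continuous factor. *)
  assert (E2 : eqO K (fun t => (g t - f t) * (/ f t * / g t)) (fun t => (f t - f t) * (/ f t * / g t))).
  { apply eqO_mul; auto using eqO_refl.
    - apply (continuity_pt_minus g f); auto.
    - apply (continuity_pt_mult (fun t => / f t) (fun t => / g t)); auto. }
  assert (E3 := eqO_add K (fun t => / g t) (fun t => / g t) _ _ (eqO_refl K _) E2).
  apply eqO_ext with (3 := E3) (d := Rmin d d'); [apply Rmin_glb_lt; auto|].
  intros t Ht; assert (f t <> 0) by (apply Nf; eapply Rlt_le_trans; [apply Ht|apply Rmin_l]).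
  assert (g t <> 0) by (apply Ng; eapply Rlt_le_trans; [apply Ht|apply Rmin_r]).
  split; field; auto.
Qed.

Lemma eqO_at0 K f g : eqO (S K) f g -> f 0 = g 0.
Proof.
  intros (C & d & HC & Hd & B); specialize (B 0); rewrite Rabs_R0 in B; specialize (B Hd).
  simpl in B; rewrite Rmult_0_l, Rmult_0_r in B.
  pose proof (Rabs_pos (f 0 - g 0)); apply Rminus_diag_uniq; destruct (Req_dec (f 0 - g 0) 0) as [|N]; auto.
  apply Rabs_pos_lt in N; lra.
Qed.

Lemma PSeries_cont0 a : Rbar_lt 0 (CV_radius a) -> continuity_pt (PSeries a) 0.
Proof. intros H; apply PSeries_continuity; rewrite Rabs_R0; auto. Qed.

Lemma radius_near a : Rbar_lt 0 (CV_radius a) -> exists d, 0 < d /\ forall t, Rabs t < d -> Rbar_lt (Rabs t) (CV_radius a).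
Proof.
  intros H; destruct (CV_radius a) as [r| |]; simpl in *; [exists r; auto| |easy].
  exists 1; split; [lra|auto].
Qed.

Lemma PSeries_minus_near a b : Rbar_lt 0 (CV_radius a) -> Rbar_lt 0 (CV_radius b) ->
  Rbar_lt 0 (CV_radius (PS_minus a b)) /\
  exists d, 0 < d /\ forall t, Rabs t < d -> PSeries (PS_minus a b) t = PSeries a t - PSeries b t.
Proof.
  intros Ha Hb; split.
  - eapply Rbar_lt_le_trans; [|apply (CV_radius_plus a (PS_opp b))]; rewrite CV_radius_opp.
    unfold Rbar_min; destruct (CV_radius a), (CV_radius b); simpl in *; try easy; apply Rmin_glb_lt; auto.
  - destruct (radius_near a Ha) as (d & Hd & A), (radius_near b Hb) as (d' & Hd' & A').
    exists (Rmin d d'); split; [apply Rmin_glb_lt; auto|]; intros t Ht.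
    apply PSeries_minus; apply CV_radius_inside; [apply A|apply A']; eapply Rlt_le_trans; try apply Ht; [apply Rmin_l|apply Rmin_r].
Qed.

Lemma decr_radius a n : Rbar_lt 0 (CV_radius a) -> Rbar_lt 0 (CV_radius (PS_decr_n a n)).
Proof.
  intros H; induction n as [|n IH].
  - rewrite (CV_radius_ext _ a); auto.
  - rewrite (CV_radius_ext _ (PS_decr_1 (PS_decr_n a n))).
    + rewrite CV_radius_decr_1; auto.
    + intros k; unfold PS_decr_n, PS_decr_1; f_equal; lia.
Qed.

(** The difference is t^K times a power series, which is bounded near 0. *)
Lemma eqO_series K a b : Rbar_lt 0 (CV_radius a) -> Rbar_lt 0 (CV_radius b) ->
  (forall j, (j < K)%nat -> a j = b j) -> eqO K (PSeries a) (PSeries b).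
Proof.
  intros Ha Hb E; destruct (PSeries_minus_near a b Ha Hb) as (R & d & Hd & D).
  destruct (cont0_bounded _ (PSeries_cont0 _ (decr_radius _ K R))) as (C & d' & HC & Hd' & B).
  exists C, (Rmin d d'); repeat split; auto; [apply Rmin_glb_lt; auto|]; intros t Ht.
  rewrite <- D by (eapply Rlt_le_trans; [apply Ht|apply Rmin_l]).
  rewrite (PSeries_decr_n_aux _ K).
  - rewrite Rabs_mult, <- RPow_abs, Rmult_comm; apply Rmult_le_compat_r; [apply pow_le, Rabs_pos|].
    apply B; eapply Rlt_le_trans; [apply Ht|apply Rmin_r].
  - intros k Hk; unfold PS_minus, PS_plus, PS_opp; rewrite E by auto.
    unfold plus, opp; simpl; ring.
Qed.

(** The difference is t^K g(t) with g continuous and g(0) = a K - b K. Contact of order K + 1 gives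
    |g(t)| <= C t for small t > 0, which forces g(0) = 0. *)
Lemma eqO_coef K a b : Rbar_lt 0 (CV_radius a) -> Rbar_lt 0 (CV_radius b) ->
  (forall j, (j < K)%nat -> a j = b j) -> eqO (S K) (PSeries a) (PSeries b) -> a K = b K.
Proof.
  intros Ha Hb E (C & e & HC & He & B); destruct (PSeries_minus_near a b Ha Hb) as (R & d & Hd & D).
  set (g := PSeries (PS_decr_n (PS_minus a b) K)).
  assert (Cg : continuity_pt g 0) by (apply PSeries_cont0, decr_radius, R).
  assert (G0 : g 0 = a K - b K).
  { unfold g; rewrite PSeries_0; unfold PS_decr_n, PS_minus, PS_plus, PS_opp, plus, opp; simpl.
    rewrite Nat.add_0_r; ring. }
  destruct (Req_dec (g 0) 0) as [Z|NZ]; [lra|exfalso].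
  assert (P := Rabs_pos_lt _ NZ).
  destruct (cont0_near g (Rabs (g 0) / 2) Cg) as (d' & Hd' & Bg); [lra|].
  assert (q : 0 < Rabs (g 0) / (2 * (C + 1))) by (apply Rdiv_lt_0_compat; lra).
  destruct (common_lower_bound d e) as (x1 & ? & ? & ?); auto.
  destruct (common_lower_bound x1 d') as (x2 & ? & ? & ?); auto.
  destruct (common_lower_bound x2 (Rabs (g 0) / (2 * (C + 1)))) as (x & ? & ? & ?); auto.
  (* So small that C t and |g(t) - g(0)| are both below |g(0)|/2. *)
  set (t := x / 2).
  assert (Ht : 0 < t) by (unfold t; lra).
  assert (At : Rabs t = t) by (apply Rabs_pos_eq; lra).
  specialize (B t); specialize (Bg t); specialize (D t); rewrite At in *.
  rewrite <- D in B by (unfold t; lra).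
  rewrite (PSeries_decr_n_aux _ K) in B.
  2:{ intros k Hk; unfold PS_minus, PS_plus, PS_opp; rewrite E by auto; unfold plus, opp; simpl; ring. }
  fold g in B; rewrite Rabs_mult, <- RPow_abs, At in B.
  assert (B' : Rabs (g t) <= C * t).
  { apply Rmult_le_reg_l with (t ^ K); [apply pow_lt; auto|].
    eapply Rle_trans; [apply B; unfold t; lra|]; simpl; apply Req_le; ring. }
  assert (B'' : Rabs (g t - g 0) < Rabs (g 0) / 2) by (apply Bg; unfold t; lra).
  assert (T : Rabs (g 0) <= Rabs (g t) + Rabs (g t - g 0)).
  { replace (g 0) with (g t + - (g t - g 0)) at 1 by ring; eapply Rle_trans; [apply Rabs_triang|].
    rewrite Rabs_Ropp; lra. }
  assert (C * t < Rabs (g 0) / 2).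
  { apply Rle_lt_trans with ((C + 1) * t); [nra|].
    apply Rlt_le_trans with ((C + 1) * (Rabs (g 0) / (2 * (C + 1)))).
    - apply Rmult_lt_compat_l; unfold t; lra.
    - apply Req_le; field; lra. }
  lra.
Qed.

Definition cont3 (f : R -> V3) : Prop :=
  continuity_pt (fun t => vx (f t)) 0 /\ continuity_pt (fun t => vy (f t)) 0 /\ continuity_pt (fun t => vz (f t)) 0.

Definition eqO3 K (f g : R -> V3) : Prop :=
  eqO K (fun t => vx (f t)) (fun t => vx (g t)) /\ eqO K (fun t => vy (f t)) (fun t => vy (g t)) /\
  eqO K (fun t => vz (f t)) (fun t => vz (g t)).

Lemma cont_mul f g : continuity_pt f 0 -> continuity_pt g 0 -> continuity_pt (fun t => f t * g t) 0.
Proof. apply continuity_pt_mult. Qed.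
Lemma cont_sub f g : continuity_pt f 0 -> continuity_pt g 0 -> continuity_pt (fun t => f t - g t) 0.
Proof. apply continuity_pt_minus. Qed.
Lemma cont_add f g : continuity_pt f 0 -> continuity_pt g 0 -> continuity_pt (fun t => f t + g t) 0.
Proof. apply continuity_pt_plus. Qed.

Lemma eqO3_cross K p q p' q' : cont3 p -> cont3 q' -> cont3 p' -> cont3 q -> eqO3 K p p' -> eqO3 K q q' ->
  eqO3 K (fun t => vcross (p t) (q t)) (fun t => vcross (p' t) (q' t)).
Proof.
  intros (? & ? & ?) (? & ? & ?) (? & ? & ?) (? & ? & ?) (? & ? & ?) (? & ? & ?).
  unfold vcross, mkV; repeat split; unfold vx, vy, vz; simpl; apply eqO_sub; apply eqO_mul; auto.
Qed.

Lemma cont3_cross p q : cont3 p -> cont3 q -> cont3 (fun t => vcross (p t) (q t)).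
Proof.
  intros (? & ? & ?) (? & ? & ?).
  unfold vcross, mkV; repeat split; unfold vx, vy, vz; simpl; apply cont_sub; apply cont_mul; auto.
Qed.

Lemma eqO_dot K p q p' q' : cont3 p -> cont3 q' -> eqO3 K p p' -> eqO3 K q q' ->
  eqO K (fun t => vdot (p t) (q t)) (fun t => vdot (p' t) (q' t)).
Proof.
  intros (? & ? & ?) (? & ? & ?) (? & ? & ?) (? & ? & ?); unfold vdot.
  repeat apply eqO_add; apply eqO_mul; auto.
Qed.

Lemma cont_dot p q : cont3 p -> cont3 q -> continuity_pt (fun t => vdot (p t) (q t)) 0.
Proof.
  intros (? & ? & ?) (? & ? & ?); unfold vdot; repeat apply cont_add; apply cont_mul; auto.
Qed.

Lemma eqO3_scal K f g p q : continuity_pt f 0 -> cont3 q -> eqO K f g -> eqO3 K p q ->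
  eqO3 K (fun t => vscal (f t) (p t)) (fun t => vscal (g t) (q t)).
Proof.
  intros ? (? & ? & ?) ? (? & ? & ?); unfold vscal, mkV; repeat split; unfold vx, vy, vz; simpl; apply eqO_mul; auto.
Qed.

Lemma cont3_scal f p : continuity_pt f 0 -> cont3 p -> cont3 (fun t => vscal (f t) (p t)).
Proof.
  intros ? (? & ? & ?); unfold vscal, mkV; repeat split; unfold vx, vy, vz; simpl; apply cont_mul; auto.
Qed.

(** Equal initial normals put both curves in one neighbourhood with a Lipschitz bound, which
    transfers the order of contact. *)
Lemma eqO_H H K n n' : analytic_on_sphere H -> cont3 n -> cont3 n' -> n 0 = n' 0 ->
  (exists d, 0 < d /\ forall t, Rabs t < d -> on_sphere (n t) /\ on_sphere (n' t)) ->
  eqO3 K n n' -> eqO K (fun t => H (n t)) (fun t => H (n' t)).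
Proof.
  intros HH (N1 & N2 & N3) (N1' & N2' & N3') E0 (d0 & Hd0 & S) ((C1 & e1 & HC1 & He1 & B1) & (C2 & e2 & HC2 & He2 & B2) & (C3 & e3 & HC3 & He3 & B3)).
  destruct (H_Lipschitz H (n 0) HH) as (rho & L & Hrho & HL).
  { apply S; rewrite Rabs_R0; auto. }
  destruct (cont0_near _ rho N1 Hrho) as (f1 & Hf1 & F1), (cont0_near _ rho N2 Hrho) as (f2 & Hf2 & F2),
    (cont0_near _ rho N3 Hrho) as (f3 & Hf3 & F3), (cont0_near _ rho N1' Hrho) as (g1 & Hg1 & G1),
    (cont0_near _ rho N2' Hrho) as (g2 & Hg2 & G2), (cont0_near _ rho N3' Hrho) as (g3 & Hg3 & G3).
  rewrite <- E0 in G1, G2, G3.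
  destruct (common_lower_bound d0 e1) as (x1 & ? & ? & ?); auto. destruct (common_lower_bound x1 e2) as (x2 & ? & ? & ?); auto.
  destruct (common_lower_bound x2 e3) as (x3 & ? & ? & ?); auto. destruct (common_lower_bound x3 f1) as (x4 & ? & ? & ?); auto.
  destruct (common_lower_bound x4 f2) as (x5 & ? & ? & ?); auto. destruct (common_lower_bound x5 f3) as (x6 & ? & ? & ?); auto.
  destruct (common_lower_bound x6 g1) as (x7 & ? & ? & ?); auto. destruct (common_lower_bound x7 g2) as (x8 & ? & ? & ?); auto.
  destruct (common_lower_bound x8 g3) as (d & Hd & ? & ?); auto.
  exists (Rabs L * (C1 + C2 + C3)), d; repeat split; auto.
  { apply Rmult_le_pos; [apply Rabs_pos|lra]. }
  intros t Ht; eapply Rle_trans.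
  - apply HL; try (apply S; lra).
    + repeat split; [apply F1|apply F2|apply F3]; lra.
    + repeat split; [apply G1|apply G2|apply G3]; lra.
  - specialize (B1 t); specialize (B2 t); specialize (B3 t).
    set (D := Rabs (vx (n t) - vx (n' t)) + Rabs (vy (n t) - vy (n' t)) + Rabs (vz (n t) - vz (n' t))).
    assert (0 <= D) by (unfold D; repeat apply Rplus_le_le_0_compat; apply Rabs_pos).
    apply Rle_trans with (Rabs L * D); [apply Rmult_le_compat_r; auto; apply Rle_abs|].
    rewrite Rmult_assoc; apply Rmult_le_compat_l; [apply Rabs_pos|].
    unfold D; assert (P : 0 <= Rabs t ^ K) by (apply pow_le, Rabs_pos).
    rewrite !Rmult_plus_distr_r; repeat apply Rplus_le_compat; [apply B1|apply B2|apply B3]; lra.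
Qed.

(** Contact of order 0 with the constant curve at [n 0] means a bounded difference. *)
Lemma bounded0_H H n : analytic_on_sphere H -> cont3 n ->
  (exists d, 0 < d /\ forall t, Rabs t < d -> on_sphere (n t)) -> bounded0 (fun t => H (n t)).
Proof.
  intros HH Cn (d & Hd & S).
  assert (E : eqO 0 (fun t => H (n t)) (fun t => H (n 0))).
  { assert (Z : Rabs 0 < d) by (rewrite Rabs_R0; auto).
    apply (eqO_H H 0 n (fun _ => n 0)); auto.
    - repeat split; apply continuity_pt_const; intros x y; reflexivity.
    - exists d; split; auto.
    - assert (Q : forall f, continuity_pt f 0 -> eqO 0 f (fun _ => f 0)).
      { intros f Cf; destruct (cont0_near f 1 Cf) as (e & He & B); [lra|].
        exists 1, e; repeat split; try lra; intros t Ht; simpl; specialize (B t Ht); lra. }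
      destruct Cn as (C1 & C2 & C3); repeat split;
        [apply (Q _ C1)|apply (Q _ C2)|apply (Q _ C3)]. }
  destruct E as (C & e & HC & He & B); exists (C + Rabs (H (n 0))), e; repeat split; auto.
  - pose proof (Rabs_pos (H (n 0))); lra.
  - intros t Ht; specialize (B t Ht); simpl in B.
    replace (H (n t)) with ((H (n t) - H (n 0)) + H (n 0)) by ring; eapply Rle_trans; [apply Rabs_triang|lra].
Qed.

Lemma PSeries_Dt u n x : PSeries (Dt u n) x = INR (S n) * PSeries (u (S n)) x.
Proof. apply (PSeries_scal (INR (S n)) (u (S n))). Qed.

(** * Two local solutions over a common part of the interval *)

Section Overlap.
Variables (s1 s2 R1 R2 R1' R2' : R).
Hypothesis HR2 : 0 < R2.
Hypothesis HR2' : 0 < R2'.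
Definition overlap (s : R) : Prop := Rabs (s - s1) < R1 /\ Rabs (s - s2) < R1'.

Lemma row_derive c R S0 u n s : 0 < S0 -> An R S0 u -> Rabs (s - c) < R ->
  is_derive (fun s => PSeries (u n) (s - c)) s (PSeries (Ds u n) (s - c)).
Proof.
  intros HS Hu Hs.
  assert (E : is_derive (fun s => s - c) s 1) by (auto_derive; auto; ring).
  assert (D : is_derive (PSeries (u n)) (s - c) (PSeries (PS_derive (u n)) (s - c))).
  { apply is_derive_PSeries; eapply ex_pseries_row; eauto. }
  assert (F := is_derive_comp (PSeries (u n)) (fun s => s - c) s _ _ D E).
  unfold scal in F; simpl in F; unfold mult in F; simpl in F; rewrite Rmult_1_l in F; exact F.
Qed.

(** The overlap is open in s, so equal rows have equal derivatives there. *)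
Lemma rows_Ds_eq u v n : An R1 R2 u -> An R1' R2' v ->
  (forall s, overlap s -> PSeries (u n) (s - s1) = PSeries (v n) (s - s2)) ->
  forall s, overlap s -> PSeries (Ds u n) (s - s1) = PSeries (Ds v n) (s - s2).
Proof.
  intros Hu Hv E s [Hs Hs'].
  assert (D := row_derive s1 R1 R2 u n s HR2 Hu Hs).
  assert (D' := row_derive s2 R1' R2' v n s HR2' Hv Hs').
  apply is_derive_unique in D; rewrite <- D.
  apply is_derive_unique; apply is_derive_ext_loc with (2 := D').
  assert (B1 : in_box s1 R1 1 s 0) by (split; auto; rewrite Rabs_R0; lra).
  assert (B2 : in_box s2 R1' 1 s 0) by (split; auto; rewrite Rabs_R0; lra).
  generalize (filter_and _ _ (in_box_near_s _ _ _ _ _ B1) (in_box_near_s _ _ _ _ _ B2)).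
  apply filter_imp; intros y [[Y1 _] [Y2 _]]; symmetry; apply E; split; auto.
Qed.

Lemma col_cont R S0 u x : 0 < S0 -> An R S0 u -> Rabs x < R -> continuity_pt (fun t => ev u x t) 0.
Proof.
  intros HS Hu Hx; apply (PSeries_cont0 (fun n => PSeries (u n) x)).
  rewrite <- Rabs_R0; eapply ex_pseries_col; eauto; rewrite Rabs_R0; auto.
Qed.

Lemma col_eqO K u v s : An R1 R2 u -> An R1' R2' v -> overlap s ->
  (forall j, (j < K)%nat -> PSeries (u j) (s - s1) = PSeries (v j) (s - s2)) ->
  eqO K (fun t => ev u (s - s1) t) (fun t => ev v (s - s2) t).
Proof.
  intros Hu Hv [Hs Hs'] E.
  apply (eqO_series K (fun n => PSeries (u n) (s - s1)) (fun n => PSeries (v n) (s - s2))); auto;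
    rewrite <- Rabs_R0; eapply ex_pseries_col; eauto; rewrite Rabs_R0; auto.
Qed.

Lemma col_coef K u v s : An R1 R2 u -> An R1' R2' v -> overlap s ->
  (forall j, (j < K)%nat -> PSeries (u j) (s - s1) = PSeries (v j) (s - s2)) ->
  eqO (S K) (fun t => ev u (s - s1) t) (fun t => ev v (s - s2) t) ->
  PSeries (u K) (s - s1) = PSeries (v K) (s - s2).
Proof.
  intros Hu Hv [Hs Hs'] E EO.
  apply (eqO_coef K (fun n => PSeries (u n) (s - s1)) (fun n => PSeries (v n) (s - s2))); auto;
    rewrite <- Rabs_R0; eapply ex_pseries_col; eauto; rewrite Rabs_R0; auto.
Qed.

Variables (H : V3 -> R) (beta B : R -> V3) (X1 X2 X3 Y1 Y2 Y3 : fps2).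
Hypothesis HH : analytic_on_sphere H.
Hypothesis LX : local_sol H beta B s1 R1 R2 X1 X2 X3.
Hypothesis LY : local_sol H beta B s2 R1' R2' Y1 Y2 Y3.

Definition same_row n := forall s, overlap s ->
  PSeries (X1 n) (s - s1) = PSeries (Y1 n) (s - s2) /\
  PSeries (X2 n) (s - s1) = PSeries (Y2 n) (s - s2) /\
  PSeries (X3 n) (s - s1) = PSeries (Y3 n) (s - s2).

Lemma mkV_inj a b c a' b' c' : mkV a b c = mkV a' b' c' -> a = a' /\ b = b' /\ c = c'.
Proof. unfold mkV; intros E; injection E; auto. Qed.

Lemma same_row_0 : same_row 0.
Proof.
  intros s [Hs Hs']; apply mkV_inj; rewrite (ls_beta _ _ _ _ _ _ _ _ _ LX), (ls_beta _ _ _ _ _ _ _ _ _ LY); auto.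
  f_equal; ring.
Qed.

Lemma same_row_1 : same_row 1.
Proof.
  intros s [Hs Hs']; apply mkV_inj; rewrite (ls_B _ _ _ _ _ _ _ _ _ LX), (ls_B _ _ _ _ _ _ _ _ _ LY); auto.
  f_equal; ring.
Qed.

(* If the two solutions agree up to [t^(K+1)], the two right-hand sides of the equation agree modulo
   [t^(K+1)], so the coefficients of [t^K] in the second [t]-derivatives coincide. Only values of [H] on
   the sphere enter, so the two different local extensions of [H] do not matter. *)
Lemma same_row_step K : (forall j, (j < S (S K))%nat -> same_row j) -> same_row (S (S K)).
Proof.
  intros IH s Hs; destruct LX as [AX1 AX2 AX3 _ _ confX pdeX], LY as [AY1 AY2 AY3 _ _ confY pdeY].
  pose proof Hs as [Hs1 Hs2].
  set (p := fun t => evV (Ds X1) (Ds X2) (Ds X3) (s - s1) t).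
  set (q := fun t => evV (Dt X1) (Dt X2) (Dt X3) (s - s1) t).
  set (p' := fun t => evV (Ds Y1) (Ds Y2) (Ds Y3) (s - s2) t).
  set (q' := fun t => evV (Dt Y1) (Dt Y2) (Dt Y3) (s - s2) t).
  assert (DS : forall j, (j < S (S K))%nat -> forall s, overlap s ->
    PSeries (Ds X1 j) (s - s1) = PSeries (Ds Y1 j) (s - s2) /\
    PSeries (Ds X2 j) (s - s1) = PSeries (Ds Y2 j) (s - s2) /\
    PSeries (Ds X3 j) (s - s1) = PSeries (Ds Y3 j) (s - s2)).
  { intros j Hj s' Hs'; repeat split; apply rows_Ds_eq; auto; intros; apply (IH j Hj); auto. }
  assert (Ep : eqO3 (S K) p p').
  { repeat split; apply col_eqO; auto using An_Ds; intros j Hj; apply DS; auto. }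
  assert (Eq : eqO3 (S K) q q').
  (* Row j of [Dt] involves row j + 1 of psi; for j <= K this is still covered by the induction
     hypothesis. *)
  { repeat split; apply col_eqO; auto using An_Dt; intros j Hj; rewrite !PSeries_Dt; f_equal;
      apply (IH (S j)); auto; lia. }
  assert (Ess : eqO3 (S K) (fun t => evV (Ds (Ds X1)) (Ds (Ds X2)) (Ds (Ds X3)) (s - s1) t)
                         (fun t => evV (Ds (Ds Y1)) (Ds (Ds Y2)) (Ds (Ds Y3)) (s - s2) t)).
  { repeat split; apply col_eqO; auto using An_Ds; intros j Hj; apply rows_Ds_eq; auto using An_Ds;
      intros; apply DS; auto. }
  assert (Cp : cont3 p) by (repeat split; apply (col_cont R1 R2); auto using An_Ds).
  assert (Cq : cont3 q) by (repeat split; apply (col_cont R1 R2); auto using An_Dt).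
  assert (Cp' : cont3 p') by (repeat split; apply (col_cont R1' R2'); auto using An_Ds).
  assert (Cq' : cont3 q') by (repeat split; apply (col_cont R1' R2'); auto using An_Dt).
  assert (Z : Rabs 0 < R2) by (rewrite Rabs_R0; auto).
  assert (Z' : Rabs 0 < R2') by (rewrite Rabs_R0; auto).
  assert (Einv : eqO (S K) (fun t => / vdot (p t) (p t)) (fun t => / vdot (p' t) (p' t))).
  { apply eqO_inv; [apply cont_dot; auto|apply cont_dot; auto| | |apply eqO_dot; auto].
    - destruct (confX (s - s1) 0 Hs1 Z) as (_ & _ & P); unfold p; lra.
    - destruct (confY (s - s2) 0 Hs2 Z') as (_ & _ & P); unfold p'; lra. }
  assert (Ci : continuity_pt (fun t => / vdot (p t) (p t)) 0).
  { apply (continuity_pt_inv (fun t => vdot (p t) (p t))); [apply cont_dot; auto|].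
    destruct (confX (s - s1) 0 Hs1 Z) as (_ & _ & P); unfold p; lra. }
  assert (Ci' : continuity_pt (fun t => / vdot (p' t) (p' t)) 0).
  { apply (continuity_pt_inv (fun t => vdot (p' t) (p' t))); [apply cont_dot; auto|].
    destruct (confY (s - s2) 0 Hs2 Z') as (_ & _ & P); unfold p'; lra. }
  assert (En : eqO3 (S K) (fun t => normal (p t) (q t)) (fun t => normal (p' t) (q' t))).
  { apply eqO3_scal; auto; [apply cont3_cross|apply eqO3_cross]; auto. }
  assert (Cn : cont3 (fun t => normal (p t) (q t))) by (apply cont3_scal; auto; apply cont3_cross; auto).
  assert (Cn' : cont3 (fun t => normal (p' t) (q' t))) by (apply cont3_scal; auto; apply cont3_cross; auto).
  assert (EH : eqO (S K) (fun t => H (normal (p t) (q t))) (fun t => H (normal (p' t) (q' t)))).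
  { apply eqO_H; auto.
    (* Contact of positive order gives equal values at t = 0. *)
    - destruct En as (e1 & e2 & e3); apply eqO_at0 in e1, e2, e3.
      destruct (normal (p 0) (q 0)) as [[? ?] ?], (normal (p' 0) (q' 0)) as [[? ?] ?].
      unfold vx, vy, vz in *; simpl in *; congruence.
    - exists (Rmin R2 R2'); split; [apply Rmin_glb_lt; auto|]; intros t Ht.
      destruct (confX (s - s1) t Hs1) as (A1 & A2 & A3); [eapply Rlt_le_trans; [apply Ht|apply Rmin_l]|].
      destruct (confY (s - s2) t Hs2) as (B1 & B2 & B3); [eapply Rlt_le_trans; [apply Ht|apply Rmin_r]|].
      split; apply normal_on_sphere; auto. }
  assert (Etc : forall (c c' : R -> R) (f f' : R -> R), eqO (S K) c c' -> eqO (S K) f f' ->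
     eqO (S K) (fun t => -1 * c t + f t) (fun t => -1 * c' t + f' t)).
  { intros c c' f f' Ec Ef; apply eqO_ext with (fun t => f t - c t) (fun t => f' t - c' t) 1;
      [lra|intros; split; ring|apply eqO_sub; auto]. }
  assert (EX : eqO3 (S K) (fun t => vcross (p t) (q t)) (fun t => vcross (p' t) (q' t))) by (apply eqO3_cross; auto).
  assert (CX : cont3 (fun t => vcross (p t) (q t))) by (apply cont3_cross; auto).
  assert (CX' : cont3 (fun t => vcross (p' t) (q' t))) by (apply cont3_cross; auto).
  assert (BH : bounded0 (fun t => H (normal (p' t) (q' t)))).
  { apply bounded0_H; auto; exists R2'; split; auto; intros t Ht.
    destruct (confY (s - s2) t Hs2 Ht) as (B1 & B2 & B3); apply normal_on_sphere; auto. }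
  assert (EF : eqO3 (S K)
     (fun t => vscal (2 * H (normal (p t) (q t))) (vcross (p t) (q t)))
     (fun t => vscal (2 * H (normal (p' t) (q' t))) (vcross (p' t) (q' t)))).
  { assert (M : forall f f', continuity_pt f 0 -> eqO (S K) f f' ->
      eqO (S K) (fun t => 2 * H (normal (p t) (q t)) * f t) (fun t => 2 * H (normal (p' t) (q' t)) * f' t)).
    { intros f f' Cf Ef.
      assert (T := eqO_mul_bounded _ _ _ _ _ (cont0_bounded _ Cf) BH Ef EH).
      apply eqO_ext with (3 := eqO_add _ _ _ _ _ T T) (d := 1); [lra|intros; split; ring]. }
    destruct EX as (? & ? & ?), CX as (? & ? & ?); repeat split; apply M; auto. }
  assert (Ett : eqO3 (S K) (fun t => evV (Dt (Dt X1)) (Dt (Dt X2)) (Dt (Dt X3)) (s - s1) t)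
                           (fun t => evV (Dt (Dt Y1)) (Dt (Dt Y2)) (Dt (Dt Y3)) (s - s2) t)).
  { assert (Hm : 0 < Rmin R2 R2') by (apply Rmin_glb_lt; auto).
    destruct Ess as (e1 & e2 & e3), EF as (f1 & f2 & f3).
    assert (PX : forall t, Rabs t < Rmin R2 R2' -> Rabs t < R2) by (intros t Ht; eapply Rlt_le_trans; [apply Ht|apply Rmin_l]).
    assert (PY : forall t, Rabs t < Rmin R2 R2' -> Rabs t < R2') by (intros t Ht; eapply Rlt_le_trans; [apply Ht|apply Rmin_r]).
    repeat split;
      [apply eqO_ext with (3 := Etc _ _ _ _ e1 f1) (d := Rmin R2 R2')
      |apply eqO_ext with (3 := Etc _ _ _ _ e2 f2) (d := Rmin R2 R2')
      |apply eqO_ext with (3 := Etc _ _ _ _ e3 f3) (d := Rmin R2 R2')]; auto; intros t Ht;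
      (rewrite (pdeX (s - s1) t Hs1 (PX t Ht)), (pdeY (s - s2) t Hs2 (PY t Ht)); split; reflexivity). }
  (* Row K of [Dt (Dt u)] is (K+1)(K+2) times row K+2 of [u]. *)
  assert (Fin : forall u v, An R1 R2 u -> An R1' R2' v ->
     (forall j, (j < S (S K))%nat -> PSeries (u j) (s - s1) = PSeries (v j) (s - s2)) ->
     eqO (S K) (fun t => ev (Dt (Dt u)) (s - s1) t) (fun t => ev (Dt (Dt v)) (s - s2) t) ->
     PSeries (u (S (S K))) (s - s1) = PSeries (v (S (S K))) (s - s2)).
  { intros u v Hu Hv E EO.
    assert (C : PSeries (Dt (Dt u) K) (s - s1) = PSeries (Dt (Dt v) K) (s - s2)).
    { apply col_coef; auto using An_Dt; intros j Hj; rewrite !PSeries_Dt; do 2 f_equal; apply E; lia. }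
    rewrite !PSeries_Dt in C.
    apply Rmult_eq_reg_l in C; [|apply not_0_INR; lia].
    apply Rmult_eq_reg_l in C; [auto|apply not_0_INR; lia]. }
  destruct Ett as (e1 & e2 & e3).
  repeat split; apply Fin; auto; intros j Hj; apply (IH j Hj); auto.
Qed.

Lemma same_rows n : same_row n.
Proof.
  induction n as [n IH] using (well_founded_induction Wf_nat.lt_wf).
  destruct n as [|[|K]]; [apply same_row_0|apply same_row_1|apply same_row_step; auto].
Qed.

(** All coefficients in powers of t agree on the overlap, so the sums agree for every [t], whatever
    the two radii in t are. *)
Theorem local_unique s t : overlap s -> evV X1 X2 X3 (s - s1) t = evV Y1 Y2 Y3 (s - s2) t.
Proof.
  intros Hs; unfold evV, ev.
  f_equal; apply PSeries_ext; intros n; apply (same_rows n s Hs).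
Qed.

End Overlap.

(** * Gluing *)

Lemma R_ball_abs x e y : ball x e y <-> Rabs (y - x) < e.
Proof. reflexivity. Qed.

Lemma open_line (O : R * R -> Prop) x y dx dy tau : open O -> O (x + tau * dx, y + tau * dy) ->
  locally tau (fun tau' => O (x + tau' * dx, y + tau' * dy)).
Proof.
  intros HO Hp; destruct (HO _ Hp) as [e He].
  pose proof (Rabs_pos dx); pose proof (Rabs_pos dy).
  assert (Hd : 0 < e / (1 + Rabs dx + Rabs dy)) by (apply Rdiv_lt_0_compat; [apply e|lra]).
  exists (mkposreal _ Hd); intros tau' Ht; rewrite R_ball_abs in Ht; simpl in Ht.
  assert (B : Rabs (tau' - tau) * (1 + Rabs dx + Rabs dy) < e).
  { apply Rmult_lt_reg_r with (/ (1 + Rabs dx + Rabs dy)); [apply Rinv_0_lt_compat; lra|].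
    rewrite Rmult_assoc, Rinv_r, Rmult_1_r by lra; exact Ht. }
  pose proof (Rabs_pos (tau' - tau)).
  apply He; split; rewrite R_ball_abs; cbn [fst snd].
  - replace (x + tau' * dx - (x + tau * dx)) with ((tau' - tau) * dx) by ring; rewrite Rabs_mult; nra.
  - replace (y + tau' * dy - (y + tau * dy)) with ((tau' - tau) * dy) by ring; rewrite Rabs_mult; nra.
Qed.

(* The indicator function of [U] along the segment is locally constant, hence has zero derivative. *)
Lemma segment_same_side (Om U V : R * R -> Prop) x y dx dy : open Om -> open U -> open V ->
  (forall p, Om p -> U p \/ V p) -> (forall p, Om p -> U p -> V p -> False) ->
  (forall tau, 0 <= tau <= 1 -> Om (x + tau * dx, y + tau * dy)) ->
  (U (x, y) <-> U (x + dx, y + dy)).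
Proof.
  intros HOm HU HV Hc Hd Hseg.
  set (g := fun tau => if excluded_middle_informative (U (x + tau * dx, y + tau * dy)) then 1 else 0).
  assert (g_in : forall tau, U (x + tau * dx, y + tau * dy) -> g tau = 1).
  { intros tau u; unfold g; destruct excluded_middle_informative; [auto|contradiction]. }
  assert (g_out : forall tau, ~ U (x + tau * dx, y + tau * dy) -> g tau = 0).
  { intros tau u; unfold g; destruct excluded_middle_informative; [contradiction|auto]. }
  assert (D : forall tau, 0 <= tau <= 1 -> is_derive g tau (@zero R_NormedModule)).
  { intros tau Ht; pose proof (Hseg tau Ht) as O1.
    assert (L : locally tau (fun tau' => g tau' = g tau)).
    { destruct (classic (U (x + tau * dx, y + tau * dy))) as [u|nu].
      - apply filter_imp with (2 := open_line U x y dx dy tau HU u); intros tau' u'.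
        rewrite !g_in; auto.
      - destruct (Hc _ O1) as [u|v]; [contradiction|].
        generalize (filter_and _ _ (open_line V x y dx dy tau HV v) (open_line Om x y dx dy tau HOm O1)).
        apply filter_imp; intros tau' [v' o'].
        rewrite !g_out; auto; intros u'; eapply Hd; eauto. }
    apply (is_derive_ext_loc (fun _ => g tau)).
    - apply filter_imp with (2 := L); intros; symmetry; auto.
    - apply (is_derive_const (V := R_NormedModule)). }
  assert (E := eq_is_derive g 0 1 D Rlt_0_1).
  unfold g in E; rewrite !Rmult_0_l, !Rplus_0_r, !Rmult_1_l in E.
  destruct (excluded_middle_informative (U (x, y))), (excluded_middle_informative (U (x + dx, y + dy)));
    try tauto; exfalso; lra.
Qed.

(** * The union of the boxes as a domain *)

Section Domain.
Variables (J : R -> Prop) (r1 r2 : R -> R).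
Hypothesis J_convex : forall s s' tau, J s -> J s' -> 0 <= tau <= 1 -> J (s + tau * (s' - s)).
Hypothesis r1_pos : forall s, J s -> 0 < r1 s.
Hypothesis r2_pos : forall s, J s -> 0 < r2 s.
Hypothesis r1_J : forall s0 s, J s0 -> Rabs (s - s0) < r1 s0 -> J s.

Definition Dom (p : R * R) : Prop := exists s0, J s0 /\ in_box s0 (r1 s0) (r2 s0) (fst p) (snd p).

Lemma Dom_axis s : J s -> Dom (s, 0).
Proof.
  intros Hs; exists s; split; auto; split; simpl; [rewrite Rminus_diag|]; rewrite Rabs_R0; auto.
Qed.

Lemma Dom_open : open Dom.
Proof.
  intros [s t] (s0 & Hs0 & Hs & Ht); simpl in Hs, Ht.
  assert (P : 0 < Rmin (r1 s0 - Rabs (s - s0)) (r2 s0 - Rabs t)) by (apply Rmin_glb_lt; lra).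
  exists (mkposreal _ P); intros [s' t'] [B1 B2]; rewrite R_ball_abs in B1, B2; cbn [fst snd pos] in B1, B2.
  pose proof (Rmin_l (r1 s0 - Rabs (s - s0)) (r2 s0 - Rabs t)).
  pose proof (Rmin_r (r1 s0 - Rabs (s - s0)) (r2 s0 - Rabs t)).
  exists s0; split; auto; split; simpl.
  - replace (s' - s0) with ((s' - s) + (s - s0)) by ring; eapply Rle_lt_trans; [apply Rabs_triang|lra].
  - replace t' with ((t' - t) + t) by ring; eapply Rle_lt_trans; [apply Rabs_triang|lra].
Qed.

(** A vertical segment inside one box joins each point to the axis, and convexity of [J] joins
    points of the axis; no such segment can cross a separation. *)
Lemma Dom_connected : connected_set Dom.
Proof.
  intros U V HU HV Hc Hd ([s t] & O1 & u1) ([s' t'] & O2 & v1).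
  assert (down : forall s t, Dom (s, t) -> J s /\ (U (s, 0) <-> U (s, t))).
  { intros x y (s0 & Hs0 & Hs & Ht); simpl in Hs, Ht; split; [eapply r1_J; eauto|].
    pose proof (segment_same_side Dom U V x 0 0 y Dom_open HU HV Hc Hd) as E.
    rewrite Rplus_0_l, Rplus_0_r in E; apply E; intros tau Htau.
    exists s0; split; auto; split; simpl.
    - replace (x + tau * 0 - s0) with (x - s0) by ring; auto.
    - rewrite Rplus_0_l, Rabs_mult, (Rabs_pos_eq tau) by lra; pose proof (Rabs_pos y); nra. }
  destruct (down s t O1) as [Js E1], (down s' t' O2) as [Js' E2].
  pose proof (segment_same_side Dom U V s 0 (s' - s) 0 Dom_open HU HV Hc Hd) as E.
  replace (s + (s' - s)) with s' in E by ring; rewrite Rplus_0_l in E.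
  apply (Hd (s', t')); auto; apply E2, E, E1; auto.
  intros tau Htau; rewrite Rmult_0_r, Rplus_0_l; apply Dom_axis; auto.
Qed.

End Domain.

(** * The complex formulas in real terms *)

Lemma V3_eta v : v = mkV (vx v) (vy v) (vz v).
Proof. destruct v as [[x y] z]; reflexivity. Qed.

Lemma vx_mkV x y z : vx (mkV x y z) = x.
Proof. reflexivity. Qed.
Lemma vy_mkV x y z : vy (mkV x y z) = y.
Proof. reflexivity. Qed.
Lemma vz_mkV x y z : vz (mkV x y z) = z.
Proof. reflexivity. Qed.

Lemma ds_0 s t : ds (fun _ _ => 0) s t = 0.
Proof. apply (Derive_const 0). Qed.
Lemma dt_0 s t : dt (fun _ _ => 0) s t = 0.
Proof. apply (Derive_const 0). Qed.

Lemma ds_half f s t : ds (fun a b => f a b / 2) s t = ds f s t / 2.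
Proof.
  unfold ds; rewrite (Derive_ext _ (fun u => / 2 * f u t)) by (intros; field).
  rewrite Derive_scal; field.
Qed.
Lemma dt_half f s t : dt (fun a b => f a b / 2) s t = dt f s t / 2.
Proof.
  unfold dt; rewrite (Derive_ext _ (fun u => / 2 * f s u)) by (intros; field).
  rewrite Derive_scal; change (fun u => f s u) with (f s); field.
Qed.

Ltac cring := unfold Cminus, Cplus, Cmult, Copp, RtoC, Ci; cbn [fst snd]; f_equal; field.

Lemma psi_z_eq psi s t : psi_z psi s t =
  mkCV (vx (ps psi s t) / 2, - vx (pt psi s t) / 2) (vy (ps psi s t) / 2, - vy (pt psi s t) / 2)
       (vz (ps psi s t) / 2, - vz (pt psi s t) / 2).
Proof.
  unfold psi_z, dz, cvscal, cvadd, cvscal, cps, cpt, cds, cdt, cpsi, V3toCV3, mkCV, cx, cy, cz, Re, Im, RtoC; cbn [fst snd].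
  rewrite !ds_0, !dt_0.
  unfold ps, pt, mkV, vx, vy, vz; cbn [fst snd]; f_equal; [f_equal|]; cring.
Qed.

Lemma psi_zb_eq psi s t : psi_zb psi s t =
  mkCV (vx (ps psi s t) / 2, vx (pt psi s t) / 2) (vy (ps psi s t) / 2, vy (pt psi s t) / 2)
       (vz (ps psi s t) / 2, vz (pt psi s t) / 2).
Proof.
  unfold psi_zb, dzb, cvscal, cvadd, cvscal, cps, cpt, cds, cdt, cpsi, V3toCV3, mkCV, cx, cy, cz, Re, Im, RtoC; cbn [fst snd].
  rewrite !ds_0, !dt_0.
  unfold ps, pt, mkV, vx, vy, vz; cbn [fst snd]; f_equal; [f_equal|]; cring.
Qed.

(** The imaginary parts are differences of mixed derivatives; they vanish once [local_surface] is
    given the symmetry. *)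
Lemma psi_zzb_eq psi s t : psi_zzb psi s t =
  mkCV ((vx (ps (ps psi) s t) + vx (pt (pt psi) s t)) / 4, (vx (ps (pt psi) s t) - vx (pt (ps psi) s t)) / 4)
       ((vy (ps (ps psi) s t) + vy (pt (pt psi) s t)) / 4, (vy (ps (pt psi) s t) - vy (pt (ps psi) s t)) / 4)
       ((vz (ps (ps psi) s t) + vz (pt (pt psi) s t)) / 4, (vz (ps (pt psi) s t) - vz (pt (ps psi) s t)) / 4).
Proof.
  unfold psi_zzb.
  replace (dzb (cpsi psi)) with (psi_zb psi) by reflexivity.
  replace (psi_zb psi) with (fun s t =>
    mkCV (vx (ps psi s t) / 2, vx (pt psi s t) / 2) (vy (ps psi s t) / 2, vy (pt psi s t) / 2)
       (vz (ps psi s t) / 2, vz (pt psi s t) / 2)).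
  2:{ apply functional_extensionality; intros a; apply functional_extensionality; intros b.
      rewrite psi_zb_eq; reflexivity. }
  unfold dz, cvscal, cvadd, cvscal, cps, cpt, cds, cdt, mkCV, cx, cy, cz, Re, Im; cbn [fst snd].
  rewrite !(ds_half (fun a b => vx (ps psi a b))), !(ds_half (fun a b => vx (pt psi a b))),
    !(dt_half (fun a b => vx (ps psi a b))), !(dt_half (fun a b => vx (pt psi a b))),
    !(ds_half (fun a b => vy (ps psi a b))), !(ds_half (fun a b => vy (pt psi a b))),
    !(dt_half (fun a b => vy (ps psi a b))), !(dt_half (fun a b => vy (pt psi a b))),
    !(ds_half (fun a b => vz (ps psi a b))), !(ds_half (fun a b => vz (pt psi a b))),
    !(dt_half (fun a b => vz (ps psi a b))), !(dt_half (fun a b => vz (pt psi a b))).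
  change (ps (ps psi) s t) with (mkV (ds (fun a b => vx (ps psi a b)) s t) (ds (fun a b => vy (ps psi a b)) s t) (ds (fun a b => vz (ps psi a b)) s t)).
  change (ps (pt psi) s t) with (mkV (ds (fun a b => vx (pt psi a b)) s t) (ds (fun a b => vy (pt psi a b)) s t) (ds (fun a b => vz (pt psi a b)) s t)).
  change (pt (ps psi) s t) with (mkV (dt (fun a b => vx (ps psi a b)) s t) (dt (fun a b => vy (ps psi a b)) s t) (dt (fun a b => vz (ps psi a b)) s t)).
  change (pt (pt psi) s t) with (mkV (dt (fun a b => vx (pt psi a b)) s t) (dt (fun a b => vy (pt psi a b)) s t) (dt (fun a b => vz (pt psi a b)) s t)).
  rewrite ?vx_mkV, ?vy_mkV, ?vz_mkV.
  f_equal; [f_equal|]; cring.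
Qed.

(** (p - iq)/2 wedge (p + iq)/2 = (i/2) p x q. *)
Lemma cross_zzb psi s t : cvcross (psi_z psi s t) (psi_zb psi s t) =
  cvscal (0, / 2) (V3toCV3 (vcross (ps psi s t) (pt psi s t))).
Proof.
  rewrite psi_z_eq, psi_zb_eq.
  unfold cvcross, cvscal, V3toCV3, vcross, mkCV, cx, cy, cz; cbn [fst snd].
  rewrite ?vx_mkV, ?vy_mkV, ?vz_mkV.
  f_equal; [f_equal|]; cring.
Qed.

(** The factor 2/(i lambda^2) times i/2 is the real number 1/lambda^2. *)
Lemma eta_eq psi s t : 0 < lambda2 psi s t ->
  eta_c psi s t = V3toCV3 (normal (ps psi s t) (pt psi s t)).
Proof.
  intros Hl; unfold eta_c; rewrite cross_zzb; unfold normal; fold (lambda2 psi s t).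
  set (c := vcross _ _).
  assert (E : Cmult (Cdiv (RtoC 2) (Cmult Ci (RtoC (lambda2 psi s t)))) (0, / 2) = RtoC (/ lambda2 psi s t)).
  { unfold Cdiv, Cinv, Cmult, Ci, RtoC; cbn [fst snd]; f_equal; field; lra. }
  replace (cvscal (Cdiv (RtoC 2) (Cmult Ci (RtoC (lambda2 psi s t)))) (cvscal (0, / 2) (V3toCV3 c)))
    with (cvscal (RtoC (/ lambda2 psi s t)) (V3toCV3 c)).
  - unfold cvscal, V3toCV3, vscal, mkCV, cx, cy, cz; cbn [fst snd].
    rewrite ?vx_mkV, ?vy_mkV, ?vz_mkV.
    rewrite !RtoC_mult; reflexivity.
  - rewrite <- E; unfold cvscal, mkCV, cx, cy, cz; cbn [fst snd]; f_equal; [f_equal|]; rewrite Cmult_assoc; reflexivity.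
Qed.

Lemma cvRe_V3toCV3 v : cvRe (V3toCV3 v) = v.
Proof. destruct v as [[x y] z]; reflexivity. Qed.

Lemma cvIm_V3toCV3 v : cvIm (V3toCV3 v) = mkV 0 0 0.
Proof. reflexivity. Qed.

Lemma vdot_scal_l c u v : vdot (vscal c u) v = c * vdot u v.
Proof. unfold vdot, vscal, mkV, vx, vy, vz; simpl; ring. Qed.
Lemma vdot_add_l u v w : vdot (vadd u v) w = vdot u w + vdot v w.
Proof. unfold vdot, vadd, mkV, vx, vy, vz; simpl; ring. Qed.
Lemma vdot_comm u v : vdot u v = vdot v u.
Proof. unfold vdot; ring. Qed.

(** With E = G and F = 0 the mean curvature is (L + N)/(2E), and the equation gives L + N = 2 H <p x
    q, n> = 2 H E. The complex system is the same equation divided by 4, with symmetric mixed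
    derivatives. *)
Lemma local_surface H (psi : R -> R -> V3) s t :
  let p := ps psi s t in let q := pt psi s t in
  vdot p p = vdot q q -> vdot p q = 0 -> 0 < vdot p p ->
  pt (pt psi) s t = vadd (vscal (-1) (ps (ps psi) s t)) (vscal (2 * H (normal p q)) (vcross p q)) ->
  pt (ps psi) s t = ps (pt psi) s t ->
  psi_zzb psi s t = cvscal (Copp (Cmult Ci (RtoC (H (cvRe (eta_c psi s t)))))) (cvcross (psi_z psi s t) (psi_zb psi s t)) /\
  (cvIm (eta_c psi s t) = mkV 0 0 0 /\ vnorm (cvRe (eta_c psi s t)) = 1 /\
   vdot (cvRe (eta_c psi s t)) p = 0 /\ vdot (cvRe (eta_c psi s t)) q = 0 /\ lambda2 psi s t = vdot q q) /\
  mean_curvature psi (cvRe (eta_c psi s t)) s t = H (cvRe (eta_c psi s t)).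
Proof.
  intros p q E F P pde mixed.
  rewrite eta_eq by exact P; rewrite cvRe_V3toCV3, cvIm_V3toCV3; fold p q.
  set (n := normal p q) in *.
  assert (Sn : vdot n n = 1) by (apply normal_on_sphere; auto).
  split; [|split].
  - rewrite psi_zzb_eq, cross_zzb, pde, mixed; fold p q.
    generalize (vcross p q) (ps (ps psi) s t) (H n); intros c d h.
    unfold cvscal, V3toCV3, vadd, vscal, mkCV, cx, cy, cz; cbn [fst snd].
    rewrite ?vx_mkV, ?vy_mkV, ?vz_mkV.
    f_equal; [f_equal|]; cring.
  - repeat split; auto.
    + unfold vnorm; rewrite Sn; apply sqrt_1.
    + unfold n, normal; rewrite vdot_scal_l.
      replace (vdot (vcross p q) p) with 0 by (unfold vdot, vcross, mkV, vx, vy, vz; simpl; ring); ring.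
    + unfold n, normal; rewrite vdot_scal_l.
      replace (vdot (vcross p q) q) with 0 by (unfold vdot, vcross, mkV, vx, vy, vz; simpl; ring); ring.
  - unfold mean_curvature; fold p q; rewrite F, <- E, pde, vdot_add_l, !vdot_scal_l.
    assert (C : vdot (vcross p q) n = vdot p p).
    { unfold n, normal; rewrite vdot_comm, vdot_scal_l, cross_sq by auto; field; lra. }
    rewrite C; field; lra.
Qed.

Lemma interval_convex a b s s' tau : rbar_open_interval a b s -> rbar_open_interval a b s' -> 0 <= tau <= 1 ->
  rbar_open_interval a b (s + tau * (s' - s)).
Proof.
  intros [A1 A2] [B1 B2] Ht.
  assert (E : Rmin s s' <= s + tau * (s' - s) <= Rmax s s').
  { unfold Rmin, Rmax; destruct (Rle_dec s s'); nra. }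
  split; [destruct a|destruct b]; simpl in *; auto; try easy.
  - apply Rlt_le_trans with (2 := proj1 E); apply Rmin_glb_lt; auto.
  - apply Rle_lt_trans with (1 := proj2 E); apply Rmax_lub_lt; auto.
Qed.

Lemma interval_open a b s : rbar_open_interval a b s ->
  exists r, 0 < r /\ forall s', Rabs (s' - s) < r -> rbar_open_interval a b s'.
Proof.
  intros [A B].
  assert (Ha : exists r, 0 < r /\ forall s', Rabs (s' - s) < r -> Rbar_lt a s').
  { destruct a as [a| |]; simpl in *; try easy.
    - exists (s - a); split; [lra|]; intros s' Hs'; apply Rabs_lt_between in Hs'; lra.
    - exists 1; split; [lra|auto]. }
  assert (Hb : exists r, 0 < r /\ forall s', Rabs (s' - s) < r -> Rbar_lt s' b).
  { destruct b as [b| |]; simpl in *; try easy.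
    - exists (b - s); split; [lra|]; intros s' Hs'; apply Rabs_lt_between in Hs'; lra.
    - exists 1; split; [lra|auto]. }
  destruct Ha as (r & Hr & Ha), Hb as (r' & Hr' & Hb); exists (Rmin r r'); split; [apply Rmin_glb_lt; auto|].
  intros s' Hs'; split; [apply Ha|apply Hb]; eapply Rlt_le_trans; try apply Hs'; [apply Rmin_l|apply Rmin_r].
Qed.

Lemma C2_on_of_rep (Om : R * R -> Prop) f :
  (forall s t, Om (s, t) -> exists s0 R1 R2 u, in_box s0 R1 R2 s t /\ rep s0 R1 R2 f u) -> C2_on Om f.
Proof.
  intros H s t Ho; destruct (H s t Ho) as (s0 & R1 & R2 & u & Hb & Hr).
  apply (rep_C2_at s0 R1 R2 f u s t Hr Hb); reflexivity.
Qed.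

Theorem mainTheorem1 (H : V3 -> R) (a b : Rbar) (beta B : R -> V3) :
  analytic_on_sphere H ->
  Rbar_lt a b ->
  bjorling_data (rbar_open_interval a b) beta B ->
  exists (Om : R * R -> Prop) (psi : R -> R -> V3),
    is_domain Om /\
    (forall s, rbar_open_interval a b s -> Om (s, 0)) /\
    conformal_immersion_on Om psi /\
    (* the system *)
    (forall s t, Om (s, t) ->
       psi_zzb psi s t =
       cvscal (Copp (Cmult Ci (RtoC (H (cvRe (eta_c psi s t))))))
              (cvcross (psi_z psi s t) (psi_zb psi s t))) /\
    (forall s, rbar_open_interval a b s -> psi s 0 = beta s) /\
    (forall s, rbar_open_interval a b s -> pt psi s 0 = B s) /\
    (* eta is the unit normal of psi, lambda^2 the conformal factor *)
    (forall s t, Om (s, t) ->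
       cvIm (eta_c psi s t) = mkV 0 0 0 /\
       vnorm (cvRe (eta_c psi s t)) = 1 /\
       vdot (cvRe (eta_c psi s t)) (ps psi s t) = 0 /\
       vdot (cvRe (eta_c psi s t)) (pt psi s t) = 0 /\
       lambda2 psi s t = vdot (pt psi s t) (pt psi s t)) /\
    (* consequence: psi is an H-surface *)
    (forall s t, Om (s, t) ->
       mean_curvature psi (cvRe (eta_c psi s t)) s t = H (cvRe (eta_c psi s t))) /\
    (* and T_{beta(s)} Sigma = span(beta'(s), B(s)) *)
    (forall s, rbar_open_interval a b s -> forall v : V3,
       (exists x y, v = vadd (vscal x (ps psi s 0)) (vscal y (pt psi s 0))) <->
       (exists x y, v = vadd (vscal x (vderiv beta s)) (vscal y (B s)))).
Proof.
  intros HH _ Hdata; set (J := rbar_open_interval a b) in *.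
  (* Dummy values outside [J] let the axiom of choice return total functions. *)
  assert (Loc : forall s0, exists T : R * R * (fps2 * fps2 * fps2), J s0 ->
    0 < fst (fst T) /\ 0 < snd (fst T) /\ (forall s, Rabs (s - s0) < fst (fst T) -> J s) /\
    local_sol H beta B s0 (fst (fst T)) (snd (fst T)) (fst (fst (snd T))) (snd (fst (snd T))) (snd (snd T))).
  { intros s0; destruct (classic (J s0)) as [Js|N].
    - destruct (interval_open a b s0 Js) as (r & Hr & HJ).
      destruct (local_existence H J beta B s0 r HH Hdata Hr HJ) as (R1 & R2 & X1 & X2 & X3 & L1 & L2 & L3).
      exists (R1, R2, (X1, X2, X3)); intros _; cbn [fst snd].
      split; [apply L1|split; [exact L2|split; [|exact L3]]].
      intros s Hs; apply HJ; lra.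
    - exists (0, 0, (zero2, zero2, zero2)); intros; contradiction. }
  destruct (choice _ Loc) as [T HT].
  set (r1 := fun s => fst (fst (T s))); set (r2 := fun s => snd (fst (T s))).
  set (X1 := fun s => fst (fst (snd (T s)))); set (X2 := fun s => snd (fst (snd (T s)))); set (X3 := fun s => snd (snd (T s))).
  assert (r1_pos : forall s, J s -> 0 < r1 s) by (intros s Hs; apply (HT s Hs)).
  assert (r2_pos : forall s, J s -> 0 < r2 s) by (intros s Hs; apply (HT s Hs)).
  assert (r1_J : forall s0 s, J s0 -> Rabs (s - s0) < r1 s0 -> J s) by (intros s0 s Hs; apply (HT s0 Hs)).
  assert (Lsol : forall s, J s -> local_sol H beta B s (r1 s) (r2 s) (X1 s) (X2 s) (X3 s)) by (intros s Hs; apply (HT s Hs)).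
  clearbody r1 r2 X1 X2 X3; clear T HT Loc.
  (* Selects some box containing the point; by [local_unique] the value of [psi] does not depend on
     the selection. *)
  set (c := fun s t => epsilon (inhabits 0) (fun s0 => J s0 /\ in_box s0 (r1 s0) (r2 s0) s t)).
  set (psi := fun s t => evV (X1 (c s t)) (X2 (c s t)) (X3 (c s t)) (s - c s t) t).
  assert (glue : forall s0 s t, J s0 -> in_box s0 (r1 s0) (r2 s0) s t -> psi s t = evV (X1 s0) (X2 s0) (X3 s0) (s - s0) t).
  { intros s0 s t Hs0 Hb; unfold psi.
    assert (Hc : J (c s t) /\ in_box (c s t) (r1 (c s t)) (r2 (c s t)) s t).
    { unfold c; apply epsilon_spec; exists s0; auto. }
    destruct Hc as [Jc Bc].
    apply (local_unique (c s t) s0 (r1 (c s t)) (r2 (c s t)) (r1 s0) (r2 s0) (r2_pos _ Jc) (r2_pos _ Hs0)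
      H beta B _ _ _ _ _ _ HH (Lsol _ Jc) (Lsol _ Hs0)).
    split; [apply Bc|apply Hb]. }
  clearbody psi; clear c.
  assert (reps : forall s0, J s0 -> rep s0 (r1 s0) (r2 s0) (fun s t => vx (psi s t)) (X1 s0) /\
    rep s0 (r1 s0) (r2 s0) (fun s t => vy (psi s t)) (X2 s0) /\ rep s0 (r1 s0) (r2 s0) (fun s t => vz (psi s t)) (X3 s0)).
  { intros s0 Hs0; destruct (Lsol s0 Hs0) as [A1 A2 A3 _ _ _ _].
    split; [|split]; (split; [assumption|intros s t Hb; rewrite (glue s0 s t Hs0 Hb); reflexivity]). }
  assert (key : forall s t, Dom J r1 r2 (s, t) ->
    let p := ps psi s t in let q := pt psi s t in
    vdot p p = vdot q q /\ vdot p q = 0 /\ 0 < vdot p p /\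
    pt (pt psi) s t = vadd (vscal (-1) (ps (ps psi) s t)) (vscal (2 * H (normal p q)) (vcross p q)) /\
    pt (ps psi) s t = ps (pt psi) s t).
  { intros s t (s0 & Hs0 & Hb) p q; simpl in Hb.
    destruct (reps s0 Hs0) as (p1 & p2 & p3).
    pose proof (rep_ds _ _ _ _ _ p1) as s1; pose proof (rep_ds _ _ _ _ _ p2) as s2; pose proof (rep_ds _ _ _ _ _ p3) as s3.
    pose proof (rep_dt _ _ _ _ _ p1) as t1; pose proof (rep_dt _ _ _ _ _ p2) as t2; pose proof (rep_dt _ _ _ _ _ p3) as t3.
    assert (Ep : p = evV (Ds (X1 s0)) (Ds (X2 s0)) (Ds (X3 s0)) (s - s0) t).
    { unfold p, ps, evV; f_equal; [apply s1|apply s2|apply s3]; auto. }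
    assert (Eq : q = evV (Dt (X1 s0)) (Dt (X2 s0)) (Dt (X3 s0)) (s - s0) t).
    { unfold q, pt, evV; f_equal; [apply t1|apply t2|apply t3]; auto. }
    assert (Ess : ps (ps psi) s t = evV (Ds (Ds (X1 s0))) (Ds (Ds (X2 s0))) (Ds (Ds (X3 s0))) (s - s0) t).
    { unfold evV; rewrite (V3_eta (ps (ps psi) s t)); f_equal;
        [apply (rep_ds _ _ _ _ _ s1)|apply (rep_ds _ _ _ _ _ s2)|apply (rep_ds _ _ _ _ _ s3)]; auto. }
    assert (Ett : pt (pt psi) s t = evV (Dt (Dt (X1 s0))) (Dt (Dt (X2 s0))) (Dt (Dt (X3 s0))) (s - s0) t).
    { unfold evV; rewrite (V3_eta (pt (pt psi) s t)); f_equal;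
        [apply (rep_dt _ _ _ _ _ t1)|apply (rep_dt _ _ _ _ _ t2)|apply (rep_dt _ _ _ _ _ t3)]; auto. }
    assert (Est : pt (ps psi) s t = evV (Dt (Ds (X1 s0))) (Dt (Ds (X2 s0))) (Dt (Ds (X3 s0))) (s - s0) t).
    { unfold evV; rewrite (V3_eta (pt (ps psi) s t)); f_equal;
        [apply (rep_dt _ _ _ _ _ s1)|apply (rep_dt _ _ _ _ _ s2)|apply (rep_dt _ _ _ _ _ s3)]; auto. }
    assert (Ets : ps (pt psi) s t = evV (Ds (Dt (X1 s0))) (Ds (Dt (X2 s0))) (Ds (Dt (X3 s0))) (s - s0) t).
    { unfold evV; rewrite (V3_eta (ps (pt psi) s t)); f_equal;
        [apply (rep_ds _ _ _ _ _ t1)|apply (rep_ds _ _ _ _ _ t2)|apply (rep_ds _ _ _ _ _ t3)]; auto. }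
    destruct (ls_conf _ _ _ _ _ _ _ _ _ (Lsol s0 Hs0) (s - s0) t (proj1 Hb) (proj2 Hb)) as (c1 & c2 & c3).
    pose proof (ls_pde _ _ _ _ _ _ _ _ _ (Lsol s0 Hs0) (s - s0) t (proj1 Hb) (proj2 Hb)) as c4.
    (* Mixed derivatives coincide because [Ds] and [Dt] commute on coefficients. *)
    rewrite Ess, Ett, Est, Ets, Ep, Eq, !Ds_Dt; auto. }
  assert (at0 : forall s, J s -> psi s 0 = beta s).
  { intros s Hs; rewrite (glue s s 0 Hs).
    - rewrite Rminus_diag; unfold evV; rewrite !ev_t0.
      rewrite (ls_beta _ _ _ _ _ _ _ _ _ (Lsol s Hs)); [f_equal; ring|rewrite Rabs_R0; auto].
    - split; [rewrite Rminus_diag|]; rewrite Rabs_R0; auto. }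
  assert (pt0 : forall s, J s -> pt psi s 0 = B s).
  { intros s Hs; destruct (reps s Hs) as (p1 & p2 & p3).
    assert (Hb : in_box s (r1 s) (r2 s) s 0) by (split; [rewrite Rminus_diag|]; rewrite Rabs_R0; auto).
    assert (R0 : Rabs 0 < r1 s) by (rewrite Rabs_R0; auto).
    rewrite (V3_eta (pt psi s 0)).
    change (mkV (dt (fun a b => vx (psi a b)) s 0) (dt (fun a b => vy (psi a b)) s 0) (dt (fun a b => vz (psi a b)) s 0) = B s).
    rewrite (proj2 (rep_dt _ _ _ _ _ p1) s 0 Hb), (proj2 (rep_dt _ _ _ _ _ p2) s 0 Hb), (proj2 (rep_dt _ _ _ _ _ p3) s 0 Hb).
    rewrite Rminus_diag, !ev_t0, !PSeries_Dt; simpl INR; rewrite !Rmult_1_l.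
    rewrite (ls_B _ _ _ _ _ _ _ _ _ (Lsol s Hs) 0 R0); f_equal; ring. }
  (* [J] is open, so psi = beta holds near [s] on the axis and can be differentiated. *)
  assert (ps0 : forall s, J s -> ps psi s 0 = vderiv beta s).
  { intros s Hs; destruct (interval_open a b s Hs) as (r & Hr & HJ).
    assert (L : locally s (fun u => psi u 0 = beta u)).
    { exists (mkposreal r Hr); intros u Hu; apply at0, HJ, Hu. }
    unfold ps, vderiv, ds; f_equal; apply Derive_ext_loc; apply filter_imp with (2 := L); intros u ->; reflexivity. }
  assert (surf := fun s t (O : Dom J r1 r2 (s, t)) => match key s t O with
    conj k1 (conj k2 (conj k3 (conj k4 k5))) => local_surface H psi s t k1 k2 k3 k4 k5 end).
  exists (Dom J r1 r2), psi; split; [|split; [|split; [|split; [|split; [|split; [|split; [|split]]]]]]].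
  - split; [apply Dom_open|apply Dom_connected; auto].
    intros; apply interval_convex; auto.
  - intros s Hs; apply Dom_axis; auto.
  - split.
    + split; [|split]; apply C2_on_of_rep; intros s t (s0 & Hs0 & Hb); destruct (reps s0 Hs0) as (p1 & p2 & p3);
        exists s0, (r1 s0), (r2 s0); eexists; (split; [exact Hb|]); [exact p1|exact p2|exact p3].
    + intros s t O; destruct (key s t O) as (k1 & k2 & k3 & _); repeat split; auto.
      intros Z; rewrite Z in k3; unfold vdot, mkV, vx, vy, vz in k3; simpl in k3; lra.
  - intros s t O; apply surf; auto.
  - exact at0.
  - exact pt0.
  - intros s t O; apply surf; auto.
  - intros s t O; apply surf; auto.
  (* On the axis the spanning vectors themselves coincide: psi_s = beta' and psi_t = B. *)
  - intros s Hs v; rewrite ps0, pt0 by auto; reflexivity.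
Qed.
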